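(* Let $C\in\mathcal{K}_{(0)}(\mathbb{C})$ be origin-symmetric and let $-1\le p<1$ be non-zero. If $K\in\mathcal{S}_0(\mathbb{C}^n)$, then $$\frac{V_{2n}(\mathrm{I}_{C,p}K)}{V_{2n}(\mathrm{I}_{C,p}B^{2n})}\le\frac{V_{2n}(\mathrm{I}_pK)}{V_{2n}(\mathrm{I}_pB^{2n})}.$$
   Context: Identify $\mathbb{C}^n\cong\mathbb{R}^{2n}$ with Euclidean inner product $\langle\cdot,\cdot\rangle$, unit sphere $\mathbb{S}^{2n-1}$ and Euclidean unit ball $B^{2n}$; $V_i$ is $i$-dimensional volume. $\mathcal{S}_0(\mathbb{C}^n)=\mathcal{S}_0(\mathbb{R}^{2n})$ is the set of star bodies: compact sets, star-shaped with respect to the origin, whose radial function $\rho_K(u)=\sup\{\lambda\ge0:\lambda u\in K\}$, $u\neq0$, is positive and continuous. $\mathcal{K}_{(0)}(\mathbb{C})$ is the set of compact convex subsets of $\mathbb{C}\cong\mathbb{R}^2$ containing the origin in their interior; $C$ is origin-symmetric if $C=-C$. For $C\in\mathcal{K}_{(0)}(\mathbb{C})$ and $p>-2$ non-zero, the complex $L_p$-intersection body $\mathrm{I}_{C,p}K$ is the star body with radial function $\rho_{\mathrm{I}_{C,p}K}(u)^{-p}=\int_K h_{Cu}(x)^p\,dx$, $u\in\mathbb{S}^{2n-1}$, where $Cu=\{cu:c\in C\}$ and $h_L(x)=\sup\{\langle x,y\rangle:y\in L\}$. For $p>-1$ non-zero, the (real) $L_p$-intersection body $\mathrm{I}_pK$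 is the star body with radial function $\rho_{\mathrm{I}_pK}(u)^{-p}=\int_K|\langle x,u\rangle|^p\,dx$. For $p=-1$, $\mathrm{I}_{-1}K$ denotes the classical intersection body of $K$ in $\mathbb{R}^{2n}$, with radial function $\rho_{\mathrm{I}_{-1}K}(u)=V_{2n-1}(K\cap u^\perp)$, $u\in\mathbb{S}^{2n-1}$, where $u^\perp=\{x:\langle x,u\rangle=0\}$ (the inequality does not depend on the constant normalization of $\mathrm{I}_{-1}$). *)

(* Defs.v *)
From HB Require Import structures.
From mathcomp Require Import all_boot all_order all_algebra.
From mathcomp Require Import complex.
From mathcomp Require Import all_classical all_reals all_analysis.

Set Implicit Arguments.
Unset Strict Implicit.
Unset Printing Implicit Defensive.

Import Order.TTheory GRing.Theory Num.Theory numFieldNormedType.Exports.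

Local Open Scope classical_set_scope.
Local Open Scope ring_scope.
Local Open Scope complex_scope.

(* Product sigma-algebra on row vectors, as the library does for n.-tuple T. For
   T = R it is the Borel sigma-algebra of R^n. *)
Section measurable_rV.
Context {d : measure_display} {T : sigmaRingType d}.
Variable n : nat.

Let coors : 'I_n -> 'rV[T]_n -> T := fun i x => x 0 i.

Let rV_set0 : g_sigma_preimage coors set0.
Proof. exact: sigma_algebra0. Qed.

Let rV_setC A : g_sigma_preimage coors A -> g_sigma_preimage coors (~` A).
Proof. exact: sigma_algebraC. Qed.

Let rV_bigcup (F : _^nat) : (forall i, g_sigma_preimage coors (F i)) ->
  g_sigma_preimage coors (\bigcup_i (F i)).
Proof. exact: sigma_algebra_bigcup. Qed.

HB.instance Definition _ := @isMeasurable.Build (measure_tuple_display d)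
  'rV[T]_n (g_sigma_preimage coors) rV_set0 rV_setC rV_bigcup.

End measurable_rV.

Section measurable_rV_theory.
Context d1 d2 (T1 : measurableType d1) (T2 : measurableType d2).

Lemma measurable_rV_coord n (i : 'I_n) :
  measurable_fun [set: 'rV[T2]_n] (fun x : 'rV[T2]_n => x 0 i).
Proof.
move=> _ Y mY; rewrite setTI; apply: sub_sigma_algebra => /=.
rewrite -bigcup_seq/=; exists i => /=; first by rewrite mem_index_enum.
by exists Y => //; rewrite setTI.
Qed.

Lemma measurable_fun_rVP n (f : T1 -> 'rV[T2]_n) :
  (forall i, measurable_fun [set: T1] (fun x => f x 0 i)) ->
  measurable_fun [set: T1] f.
Proof.
move=> mf.
have : g_sigma_preimage (fun i => (fun x : 'rV[T2]_n => x 0 i) \o f)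
    `<=` measurable.
  apply: smallest_sub; first exact: sigma_algebra_measurable.
  rewrite -bigcup_seq => A [i _ [B mB <-]]; exact: mf.
rewrite g_sigma_preimage_comp => prefS _ A mA.
by apply: prefS; exists A.
Qed.

End measurable_rV_theory.

Section lebesgue_rV.
Variable R : realType.

Definition rV_cons n (p : measurableTypeR R * 'rV[R]_n) : 'rV[R]_n.+1 :=
  row_mx (p.1)%:M p.2 : 'rV[R]_(1 + n).

Definition rV_uncons n (x : 'rV[R]_n.+1) : measurableTypeR R * 'rV[R]_n :=
  (x 0 0, rsubmx (x : 'rV[R]_(1 + n))).

Lemma rV_consK n : cancel (@rV_cons n) (@rV_uncons n).
Proof.
move=> [a v]; rewrite /rV_uncons /rV_cons row_mxKr /=; congr pair.
by rewrite mxE; case: splitP => // j _; rewrite ord1 mxE.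
Qed.

Lemma measurable_rV_cons n : measurable_fun setT (@rV_cons n).
Proof.
apply: measurable_fun_rVP => i.
rewrite (_ : (fun p => _) = fun p : measurableTypeR R * 'rV[R]_n =>
    match fintype.split (i : 'I_(1 + n)) with inl _ => p.1 | inr k => p.2 0 k end).
  case: (fintype.split _) => [_|k]; first exact: measurable_fst.
  exact: (measurableT_comp (measurable_rV_coord k) measurable_snd).
apply/funext => p; rewrite mxE; case: (fintype.split _) => // j.
by rewrite ord1 mxE.
Qed.

Lemma measurable_rV_uncons n : measurable_fun setT (@rV_uncons n).
Proof.
apply: measurable_fun_pair; first exact: measurable_rV_coord.
apply: measurable_fun_rVP => i.
under eq_fun do rewrite mxE; exact: measurable_rV_coord.
Qed.

Section step.
Variable n : nat.
Variable mu : {sigma_finite_measure set 'rV[R]_n -> \bar R}.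

Definition lebesgue_rV_step : set 'rV[R]_n.+1 -> \bar R :=
  pushforward (@lebesgue_measure R \x mu)%E (@rV_cons n).

Let nu := lebesgue_rV_step.

Let m := (@lebesgue_measure R \x mu)%E.

Let preimage_measurable A :
  measurable A -> measurable (@rV_cons n @^-1` A).
Proof.
by move=> mA; rewrite -[X in measurable X]setTI; exact: measurable_rV_cons.
Qed.

Let nu0 : nu set0 = 0%E.
Proof. by rewrite /nu /lebesgue_rV_step /pushforward preimage_set0 measure0. Qed.

Let nu_ge0 A : (0 <= nu A)%E.
Proof. exact: (measure_ge0 m). Qed.

Let nu_sigma_additive : semi_sigma_additive nu.
Proof.
move=> F mF tF mUF; rewrite /nu /lebesgue_rV_step /pushforward preimage_bigcup.
apply: (measure_semi_sigma_additive (s := m)).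
- by move=> k; exact: preimage_measurable.
- apply/trivIsetP => /= i j _ _ ij; rewrite -preimage_setI.
  by move/trivIsetP : tF => /(_ _ _ _ _ ij) ->//; rewrite preimage_set0.
- by rewrite -preimage_bigcup; exact: preimage_measurable.
Qed.

HB.instance Definition _ :=
  isMeasure.Build _ _ _ nu nu0 nu_ge0 nu_sigma_additive.

Let nu_sigma_finite : sigma_finite setT nu.
Proof.
have [F TF Foo] : sigma_finite setT m.
  have /sigma_finiteP[F [TF ndF Foo]] := sigma_finiteT (@lebesgue_measure R).
  have /sigma_finiteP[G [TG ndG Goo]] := sigma_finiteT mu.
  exists (fun k => F k `*` G k).
    rewrite -setXTT TF TG predeqE => -[x y]; split.
      move=> [/= [a _ Fax] [b _ Gby]]; exists (maxn a b) => //; split.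
        by move: x Fax; exact/subsetPset/ndF/leq_maxl.
      by move: y Gby; exact/subsetPset/ndG/leq_maxr.
    by move=> [a _ []/= ? ?]; split; exists a.
  move=> k; have [? ?] := Foo k; have [? ?] := Goo k.
  split; first exact: measurableX.
  by rewrite /m product_measure1E// lte_mul_pinfty// ge0_fin_numE.
exists (fun k => @rV_uncons n @^-1` F k).
  by rewrite -preimage_bigcup -TF preimage_setT.
move=> k; have [mFk Fkoo] := Foo k; split.
  by rewrite -[X in measurable X]setTI; exact: measurable_rV_uncons.
rewrite /nu /lebesgue_rV_step /pushforward -comp_preimage.
by rewrite (_ : _ \o _ = id) //; apply/funext => p; exact: rV_consK.
Qed.

HB.instance Definition _ :=
  Measure_isSigmaFinite.Build _ _ _ nu nu_sigma_finite.

End step.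

(* n-dimensional Lebesgue measure on the Borel sets of R^n. *)
Fixpoint lebesgue_rV n : {sigma_finite_measure set 'rV[R]_n -> \bar R} :=
  if n is k.+1 return {sigma_finite_measure set 'rV[R]_n -> \bar R}
  then lebesgue_rV_step (lebesgue_rV k)
  else \d_(0 : 'rV[R]_0).

End lebesgue_rV.

Section star_bodies.
Variables (R : realType) (m : nat).
Implicit Types (K L : set 'rV[R]_m) (u x y : 'rV[R]_m) (p : R).

Definition vol K : R := fine (lebesgue_rV R m K).

Definition dot x y : R := (x *m y^T) 0 0.

(* The library norm of 'rV[R]_m is the sup norm, hence this definition. *)
Definition enorm x : R := Num.sqrt (dot x x).

Definition esphere : set 'rV[R]_m := [set u | enorm u = 1].

Definition eball : set 'rV[R]_m := [set x | enorm x <= 1].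

Definition radial K u : R := sup [set l : R | 0 <= l /\ K (l *: u)].

Definition star_body K : Prop :=
  [/\ compact K,
      (forall x (t : R), K x -> 0 <= t <= 1 -> K (t *: x)),
      (forall u, u != 0 -> 0 < radial K u) &
      {within [set u | u != 0], continuous (radial K)}].

Definition support L x : R := sup [set dot x y | y in L].

(* The star body whose radial function is rho on the unit sphere; only the
   values of rho there matter. *)
Definition star_of_radial (rho : 'rV[R]_m -> R) : set 'rV[R]_m :=
  [set x | exists u (l : R), [/\ esphere u, 0 <= l <= rho u & x = l *: u]].

(* The rows of hyperplane_frame u are some orthonormal basis of the hyperplane
   orthogonal to u (u != 0). *)
Definition hyperplane_frame u : 'M[R]_(m.-1, m) :=
  xget 0 [set B | B *m B^T = 1%:M /\ B *m u^T = 0].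

(* (m-1)-dimensional volume of the section of K by the hyperplane orthogonal to
   u, in the coordinates of an orthonormal basis; by rotation invariance of
   Lebesgue measure it does not depend on the basis. *)
Definition section_vol K u : R :=
  fine (lebesgue_rV R m.-1 [set y | K (y *m hyperplane_frame u)]).

(* The defining identity rho(u) ^ (-p) = I is solved as rho(u) = I ^ (-1/p).
   For p < 0 the library convention 0 `^ p = 0 only affects the integrand on a
   Lebesgue-null set. *)
Definition radial_of_moment p (I : R) : R := I `^ (- p^-1).

Definition intersection_body p K : set 'rV[R]_m :=
  star_of_radial (fun u =>
    if p == -1 then section_vol K u
    else radial_of_moment p
           (\int[lebesgue_rV R m]_(x in K) (`|dot x u| `^ p))).

End star_bodies.

Arguments eball : clear implicits.

Section complex_bodies.
Variables (R : realType) (n : nat).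
Implicit Types (x u : 'rV[R]_(n + n)) (C : set R[i]^o).

(* R^(2n) is identified with C^n through (a, b) |-> a + i b, a and b being the
   first and last n coordinates. *)
Definition to_complex x : 'rV[R[i]]_n :=
  \row_j (x 0 (lshift n j) +i* x 0 (rshift n j)).

Definition of_complex (z : 'rV[R[i]]_n) : 'rV[R]_(n + n) :=
  row_mx (map_mx (@complex.Re R) z) (map_mx (@complex.Im R) z).

Definition complex_orbit C u : set 'rV[R]_(n + n) :=
  [set of_complex (c *: to_complex u) | c in C].

Definition complex_intersection_body C p (K : set 'rV[R]_(n + n)) :
    set 'rV[R]_(n + n) :=
  star_of_radial (fun u =>
    radial_of_moment p
      (\int[lebesgue_rV R (n + n)]_(x in K)
         (support (complex_orbit C u) x `^ p))).

End complex_bodies.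

(* R[i]^o carries the topology of the modulus. In its order 0 <= t <= 1 forces t
   to be real, so convex_set over R[i] is ordinary convexity in the plane. *)
Definition convex_body0 (R : realType) (C : set R[i]^o) : Prop :=
  [/\ compact C, convex_set C & C° 0].

(* Main.v *)
Require Import Defs.
From HB Require Import structures.
From mathcomp Require Import all_boot all_order all_algebra.
From mathcomp Require Import complex.
From mathcomp Require Import all_classical all_reals all_analysis.
From mathcomp Require Import measurable_realfun.
From mathcomp Require Import ring lra.

Set Implicit Arguments.
Unset Strict Implicit.
Unset Printing Implicit Defensive.

Import Order.TTheory GRing.Theory Num.Theory numFieldNormedType.Exports.

Local Open Scope classical_set_scope.
Local Open Scope ring_scope.
Local Open Scope complex_scope.

(* With q = - 2n / p, the volumes of both bodies are, up to a common constant,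
   integrals over the annulus 1 <= |x| <= 2 of F ^ q and f ^ q, where
   f(u) = int_K |<x, u>|^p dx and F(u) = int_K N(<x, u>, <x, uJ>)^p dx; here J is
   the complex structure and N the support function of C, a norm on the plane
   because C = - C.  If F(u) is an average int W(y) f(u Q(y)) dy with Q(y)
   orthogonal and W, Q independent of K, Jensen's inequality for t |-> t ^ q and
   rotation invariance bound the integral of F ^ q by a constant times that of
   f ^ q, with equality for the ball, where f is constant on spheres.

   For p = -1 such a formula comes from integrating over the slope s of
   (<x, u>, <x, uJ>) in the plane: the fibres are the hyperplanes orthogonal to
   uJ - s u.  For -1 < p < 1, N is approximated within a factor 1 + e by
   zonotope norms sum_i |alpha_i s + beta_i t|, and the p-th power of such a sum
   is an average of powers |sum_i y_i (alpha_i s + beta_i t)|^p, the y_i being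
   independent Cauchy variables, by 1-stability of the Cauchy law. *)

(** Jensen's inequality needs t |-> t ^ q convex: q <= 0 for p > 0, and q >= 2n for -1 <= p < 0.
    Writing N ^ p as an average of p-th powers of linear forms is an embedding of the normed plane
    into L_p, in an extended sense if p < 0. Dimension two makes this possible: every norm of the
    plane is a limit of zonotope norms, these embed into l_1, and Cauchy variables embed l_1 into
    L_p as long as their p-th moment is finite, that is for -1 < p < 1. At p = -1 this moment
    diverges and sections take the place of |<x, u>| ^ p, hence the separate argument. No limit of
    these is taken: one constant bounds the ball from below and K from above, so it cancels in the
    quotient before lambda tends to 1. For this reason W and Q are always fixed before K. *)

(** * Integrals on the line under translation, reflection and dilation *)

Section change_of_variables.
Local Open Scope ereal_scope.

(** A change of variables only involves the image measure, so it reduces to an identity on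
    measurable sets, which uniqueness of Lebesgue measure supplies below. The constant [c] carries
    the Jacobian. *)
Lemma ge0_integral_comp_scale d1 d2 (X : measurableType d1)
    (Y : measurableType d2) (R : realType) (mu : {measure set X -> \bar R})
    (nu : {measure set Y -> \bar R}) (phi : X -> Y) (c : {nonneg R})
    (f : Y -> \bar R) :
  measurable_fun setT phi ->
  (forall A, measurable A -> mu (phi @^-1` A) = c%:num%:E * nu A) ->
  measurable_fun setT f -> (forall y, 0 <= f y) ->
  \int[mu]_x f (phi x) = c%:num%:E * \int[nu]_y f y.
Proof.
move=> mphi munu mf f0.
rewrite -(@ge0_integral_mscale _ _ _ nu setT _ c f)//.
transitivity (\int[pushforward mu phi]_y f y).
  by rewrite ge0_integral_pushforward// preimage_setT.
by apply: eq_measure_integral => A mA _; exact: munu.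
Qed.

Lemma ge0_integral_comp d1 d2 (X : measurableType d1)
    (Y : measurableType d2) (R : realType) (mu : {measure set X -> \bar R})
    (nu : {measure set Y -> \bar R}) (phi : X -> Y) (f : Y -> \bar R) :
  measurable_fun setT phi ->
  (forall A, measurable A -> mu (phi @^-1` A) = nu A) ->
  measurable_fun setT f -> (forall y, 0 <= f y) ->
  \int[mu]_x f (phi x) = \int[nu]_y f y.
Proof.
move=> mphi munu mf f0.
rewrite (@ge0_integral_comp_scale _ _ _ _ _ mu nu phi (1%R%:nng)%R) ?mul1e//.
by move=> A mA; rewrite mul1e munu.
Qed.

Context {R : realType}.
Local Notation mu := (@lebesgue_measure R).

Lemma ge0_integral_lebesgue_addr (f : R -> \bar R) (a : R) :
  measurable_fun setT f -> (forall x, 0 <= f x) ->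
  \int[mu]_x f (x + a)%R = \int[mu]_x f x.
Proof.
move=> mf f0.
have ma : measurable_fun setT (fun x : measurableTypeR R => (x + a)%R : measurableTypeR R).
  exact: measurable_funD.
apply: (@ge0_integral_comp _ _ _ _ _ mu mu _ f ma) => // A mA.
pose nu : {measure set (measurableTypeR R) -> \bar R} :=
  [the measure _ _ of pushforward mu (fun x : measurableTypeR R => (x + a)%R : measurableTypeR R)].
rewrite -[LHS]/(nu ma A).
apply/esym/lebesgue_measure_unique => //= _ [[x y]] _ <-.
rewrite /nu/= /pushforward.
rewrite (_ : _ @^-1` _ = `](x - a)%R, (y - a)%R]%classic); last first.
  by apply/seteqP; split => z /=; rewrite !in_itv/= ltrBlDr lerBrDr.
by rewrite !lebesgue_measure_itv/= !lte_fin ltrD2r -!EFinD opprB addrA subrK.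
Qed.

Lemma ge0_integral_lebesgue_opp (f : R -> \bar R) :
  measurable_fun setT f -> (forall x, 0 <= f x) ->
  \int[mu]_x f (- x)%R = \int[mu]_x f x.
Proof.
move=> mf f0; apply: (@ge0_integral_comp _ _ _ _ _ mu mu -%R f) => //.
exact: lebesgue_measureN.
Qed.

Lemma ge0_integral_lebesgue_mull_gt0 (f : R -> \bar R) (t : R) : (0 < t)%R ->
  measurable_fun setT f -> (forall x, 0 <= f x) ->
  \int[mu]_x f (t * x)%R = t^-1%:E * \int[mu]_x f x.
Proof.
move=> t0 mf f0.
have ti0 : (0 <= t^-1)%R by rewrite invr_ge0 ltW.
have mt : measurable_fun setT (fun x : measurableTypeR R => (t * x)%R : measurableTypeR R).
  exact: measurable_funM.
apply: (@ge0_integral_comp_scale _ _ _ _ _ mu mu _ (NngNum ti0) f mt) => // A mA.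
pose nu0 : {measure set (measurableTypeR R) -> \bar R} :=
  [the measure _ _ of pushforward mu (fun x : measurableTypeR R => (t * x)%R : measurableTypeR R)].
(* The image measure divides lengths by [t]; multiplied by [t] it agrees with Lebesgue measure on
   intervals. *)
pose nu : {measure set (measurableTypeR R) -> \bar R} :=
  mscale (NngNum (ltW t0)) (nu0 mt).
suff e : mu A = nu A.
  rewrite [X in _ = _ * X](_ : _ = nu A)// /nu/= /mscale/= /pushforward/= muleA -EFinM mulVf ?mul1e//.
  exact: lt0r_neq0.
apply: lebesgue_measure_unique => //= _ [[x y]] _ <-.
rewrite /nu/= /mscale /= /pushforward.
rewrite (_ : _ @^-1` _ = `](x / t)%R, (y / t)%R]%classic); last first.
  by apply/seteqP; split => z /=; rewrite !in_itv/= ltr_pdivrMr// ler_pdivlMr// mulrC.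
rewrite !lebesgue_measure_itv/= !lte_fin ltr_pM2r ?invr_gt0//.
case: ifP => _; last by rewrite mule0.
by rewrite -!EFinD -EFinM mulrBr !(mulrC t) !divfK ?lt0r_neq0.
Qed.

Lemma ge0_integral_lebesgue_mull (f : R -> \bar R) (t : R) : (t != 0)%R ->
  measurable_fun setT f -> (forall x, 0 <= f x) ->
  \int[mu]_x f (t * x)%R = `|t|%R^-1%:E * \int[mu]_x f x.
Proof.
move=> t0 mf f0; case: (ltrgt0P t) t0 => // tp _.
  exact: ge0_integral_lebesgue_mull_gt0.
rewrite -ge0_integral_lebesgue_mull_gt0 ?oppr_gt0//.
rewrite -(@ge0_integral_lebesgue_opp (fun x => f (t * x)%R)).
- by under [RHS]eq_integral do rewrite mulNr -mulrN.
- by apply: measurableT_comp => //; exact: measurable_funM.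
- by move=> x; exact: f0.
Qed.

End change_of_variables.

(** * Measurability of the vector operations *)

Section measurable_rV_operations.
Context {R : realType} {d} {T : measurableType d}.

Lemma measurable_rV_coordP n (f : T -> 'rV[R]_n) :
  measurable_fun setT f <-> forall i, measurable_fun setT (fun x => f x 0 i).
Proof.
split=> [mf i|]; last exact: measurable_fun_rVP.
exact: (measurableT_comp (measurable_rV_coord i) mf).
Qed.

Lemma measurable_rV_add n (f g : T -> 'rV[R]_n) :
  measurable_fun setT f -> measurable_fun setT g ->
  measurable_fun setT (fun x => f x + g x).
Proof.
move=> /measurable_rV_coordP mf /measurable_rV_coordP mg.
apply/measurable_rV_coordP => i; under eq_fun do rewrite mxE.
exact: measurable_funD.
Qed.

Lemma measurable_rV_scale n (a : T -> R) (f : T -> 'rV[R]_n) :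
  measurable_fun setT a -> measurable_fun setT f ->
  measurable_fun setT (fun x => a x *: f x).
Proof.
move=> ma /measurable_rV_coordP mf.
apply/measurable_rV_coordP => i; under eq_fun do rewrite mxE.
exact: measurable_funM.
Qed.

Lemma measurable_rV_opp n (f : T -> 'rV[R]_n) :
  measurable_fun setT f -> measurable_fun setT (fun x => - f x).
Proof.
move=> mf; under eq_fun do rewrite -scaleN1r.
exact: measurable_rV_scale.
Qed.

Lemma measurable_rV_mulmx k n (f : T -> 'rV[R]_k) (A : T -> 'M[R]_(k, n)) :
  measurable_fun setT f -> (forall i j, measurable_fun setT (fun x => A x i j)) ->
  measurable_fun setT (fun x => f x *m A x).
Proof.
move=> /measurable_rV_coordP mf mA.
apply/measurable_rV_coordP => i; under eq_fun do rewrite mxE.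
by apply: measurable_sum => j; exact: measurable_funM.
Qed.

Lemma measurable_rV_mulmx_cst k n (f : T -> 'rV[R]_k) (A : 'M[R]_(k, n)) :
  measurable_fun setT f -> measurable_fun setT (fun x => f x *m A).
Proof. by move=> mf; apply: measurable_rV_mulmx. Qed.

Lemma dotE n (x y : 'rV[R]_n) : dot x y = \sum_i x 0 i * y 0 i.
Proof. by rewrite /dot mxE; apply: eq_bigr => i _; rewrite mxE. Qed.

Lemma measurable_dot n (f g : T -> 'rV[R]_n) :
  measurable_fun setT f -> measurable_fun setT g ->
  measurable_fun setT (fun x => dot (f x) (g x)).
Proof.
move=> /measurable_rV_coordP mf /measurable_rV_coordP mg.
under eq_fun do rewrite dotE.
by apply: measurable_sum => j; exact: measurable_funM.
Qed.

Lemma measurable_sqrtr : measurable_fun setT (@Num.sqrt R).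
Proof.
apply: continuous_measurable_fun; exact: sqrt_continuous.
Qed.

Lemma measurable_enorm n (f : T -> 'rV[R]_n) :
  measurable_fun setT f -> measurable_fun setT (fun x => enorm (f x)).
Proof.
move=> mf; apply: (measurableT_comp measurable_sqrtr).
exact: measurable_dot.
Qed.

Lemma measurable_rV_cons_fun n (a : T -> R) (f : T -> 'rV[R]_n) :
  measurable_fun setT a -> measurable_fun setT f ->
  measurable_fun setT (fun x => rV_cons (a x, f x)).
Proof.
move=> ma mf; apply: (measurableT_comp (@measurable_rV_cons R n)).
exact: measurable_fun_pair.
Qed.

End measurable_rV_operations.

(** * Splitting off the first coordinate *)

Section rV_cons_theory.
Context {R : realType}.

Lemma rV_consD n (t s : R) (y z : 'rV[R]_n) :
  rV_cons (t, y) + rV_cons (s, z) = rV_cons ((t + s), (y + z)).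
Proof.
apply/rowP => i; rewrite !mxE /=; case: (fintype.split _) => j; rewrite !mxE //.
by rewrite mulrnDl.
Qed.

Lemma rV_consZ n (c t : R) (y : 'rV[R]_n) :
  c *: rV_cons (t, y) = rV_cons ((c * t), c *: y).
Proof.
apply/rowP => i; rewrite !mxE /=; case: (fintype.split _) => j; rewrite !mxE //.
by rewrite mulrnAr.
Qed.

Lemma rV_unconsK n : cancel (@rV_uncons R n) (@rV_cons R n).
Proof.
move=> x; apply/rowP => i; rewrite !mxE /=; case: splitP => j ij; rewrite !mxE.
  by rewrite ord1 eqxx mulr1n; congr (x _ _); apply/val_inj; rewrite /= ij ord1.
by congr (x _ _); apply/val_inj; rewrite /= ij.
Qed.

Lemma rV_consP n (x : 'rV[R]_n.+1) : exists t y, x = rV_cons (t, y).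
Proof. by exists (rV_uncons x).1, (rV_uncons x).2; rewrite -[LHS]rV_unconsK; case: rV_uncons. Qed.

Lemma rV_cons0 n (t : R) (y : 'rV[R]_n) : rV_cons (t, y) 0 0 = t.
Proof. by rewrite mxE; case: splitP => // j; rewrite ord1 !mxE. Qed.

Lemma rV_consS n (t : R) (y : 'rV[R]_n) i : rV_cons (t, y) 0 (lift 0 i) = y 0 i.
Proof.
rewrite mxE; case: splitP => [j|j /= [ij]]; first by rewrite ord1.
by congr (y _ _); apply/val_inj.
Qed.

Lemma dot_rV_cons n (t s : R) (y z : 'rV[R]_n) :
  dot (rV_cons (t, y)) (rV_cons (s, z)) = t * s + dot y z.
Proof.
rewrite !dotE big_ord_recl !rV_cons0; congr (_ + _).
by apply: eq_bigr => i _; rewrite !rV_consS.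
Qed.

End rV_cons_theory.

(** * Translations and dilations of n-dimensional Lebesgue measure *)

Section lebesgue_rV_theory.
Context {R : realType}.
Local Open Scope ereal_scope.
Local Notation mu := (@lebesgue_measure R).
Local Notation leb := (lebesgue_rV R).

Lemma ge0_integral_rV_cons n (f : 'rV[R]_n.+1 -> \bar R) :
  measurable_fun setT f -> (forall x, 0 <= f x) ->
  \int[leb n.+1]_x f x = \int[mu]_t \int[leb n]_y f (rV_cons (t, y)).
Proof.
move=> mf f0.
transitivity (\int[(mu \x leb n)%E]_p f (rV_cons p)).
  rewrite -[RHS](@ge0_integral_pushforward _ _ _ _ _ _ _ _ setT f) ?preimage_setT//.
  exact: measurable_rV_cons.
rewrite fubini_tonelli1//.
exact: (measurableT_comp mf (@measurable_rV_cons R n)).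
Qed.

Lemma ge0_integral_rV0 (f : 'rV[R]_0 -> \bar R) :
  measurable_fun setT f -> \int[leb 0]_x f x = f 0%R.
Proof. by move=> mf; rewrite integral_dirac// diracE in_setT mul1e. Qed.

Lemma ge0_integral_rV_addr n (f : 'rV[R]_n -> \bar R) (a : 'rV[R]_n) :
  measurable_fun setT f -> (forall x, 0 <= f x) ->
  \int[leb n]_x f (x + a)%R = \int[leb n]_x f x.
Proof.
elim: n => [|n IH] in f a * => mf f0.
  by apply: eq_integral => x _; congr f; apply/rowP => -[].
have mfa : measurable_fun setT (fun x : 'rV[R]_n.+1 => f (x + a)%R).
  by apply: measurableT_comp => //; exact: measurable_rV_add.
rewrite !ge0_integral_rV_cons//.
have [s [z ->]] := rV_consP a.
under eq_integral => t _.
  under eq_integral do rewrite rV_consD.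
  rewrite (IH (fun y => f (rV_cons ((t + s)%R, y)))); last 2 first.
  - by apply: (measurableT_comp mf); exact: measurable_rV_cons_fun.
  - by move=> y; exact: f0.
  over.
rewrite (@ge0_integral_lebesgue_addr _ (fun t => \int[leb n]_y f (rV_cons (t, y))))//.
- apply: (measurable_fun_fubini_tonelli_F (fun p => f (rV_cons p))) => //.
  exact: (measurableT_comp mf (@measurable_rV_cons R n)).
- by move=> t; exact: integral_ge0.
Qed.

Lemma ge0_integral_rV_scale n (f : 'rV[R]_n -> \bar R) (c : R) : (c != 0)%R ->
  measurable_fun setT f -> (forall x, 0 <= f x) ->
  \int[leb n]_x f (c *: x) = (`|c| ^- n)%R%:E * \int[leb n]_x f x.
Proof.
move=> c0; elim: n => [|n IH] in f * => mf f0.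
  rewrite expr0 invr1 mul1e.
  by apply: eq_integral => x _; congr f; apply/rowP => -[].
have mfa : measurable_fun setT (fun x : 'rV[R]_n.+1 => f (c *: x)%R).
  by apply: measurableT_comp => //; exact: measurable_rV_scale.
rewrite !ge0_integral_rV_cons//.
have mF : measurable_fun setT (fun t => \int[leb n]_y f (rV_cons (t, y))).
  apply: (measurable_fun_fubini_tonelli_F (fun p => f (rV_cons p))) => //.
  exact: (measurableT_comp mf (@measurable_rV_cons R n)).
have F0 (t : R) : 0 <= \int[leb n]_y f (rV_cons (t, y)) by exact: integral_ge0.
under eq_integral => t _.
  under eq_integral do rewrite rV_consZ.
  rewrite (IH (fun y => f (rV_cons ((c * t)%R, y)))); last 2 first.
  - by apply: (measurableT_comp mf); exact: measurable_rV_cons_fun.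
  - by move=> y; exact: f0.
  over.
pose F (t : R) := \int[leb n]_y f (rV_cons (t, y)).
have mFc : measurable_fun setT (fun t => F (c * t)%R).
  by apply: (measurableT_comp mF); exact: measurable_funM.
have k0 : (0 <= `|c| ^- n)%R by rewrite invr_ge0 exprn_ge0.
transitivity ((`|c| ^- n)%:E * \int[mu]_t F (c * t)%R).
  by apply: (@ge0_integralZl_EFin _ _ _ mu setT) => // t _; exact: F0.
rewrite (@ge0_integral_lebesgue_mull _ F)//.
by rewrite muleA -EFinM exprSr invfM mulrC.
Qed.

End lebesgue_rV_theory.

(** * Inner product and Euclidean norm *)

Section euclidean.
Context {R : realType} {n : nat}.
Implicit Types (x y : 'rV[R]_n) (a : R).

Lemma dotC x y : dot x y = dot y x.
Proof. by rewrite !dotE; apply: eq_bigr => i _; rewrite mulrC. Qed.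

Lemma dotZl a x y : dot (a *: x) y = a * dot x y.
Proof. by rewrite /dot -scalemxAl mxE. Qed.

Lemma dotZr a x y : dot x (a *: y) = a * dot x y.
Proof. by rewrite dotC dotZl dotC. Qed.

Lemma dotDl x y z : dot (x + y) z = dot x z + dot y z.
Proof. by rewrite /dot mulmxDl mxE. Qed.

Lemma dotDr x y z : dot x (y + z) = dot x y + dot x z.
Proof. by rewrite dotC dotDl !(dotC x). Qed.

Lemma dotNl x y : dot (- x) y = - dot x y.
Proof. by rewrite -scaleN1r dotZl mulN1r. Qed.

Lemma dotNr x y : dot x (- y) = - dot x y.
Proof. by rewrite dotC dotNl dotC. Qed.

Lemma dot0l y : dot 0 y = 0.
Proof. by rewrite /dot mul0mx mxE. Qed.

Lemma dotxx_ge0 x : 0 <= dot x x.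
Proof. by rewrite dotE sumr_ge0// => i _; rewrite -expr2 sqr_ge0. Qed.

Lemma dotxx_eq0 x : (dot x x == 0) = (x == 0).
Proof.
apply/idP/idP => [|/eqP->]; last by rewrite dot0l.
rewrite dotE psumr_eq0 => [/allP h|i _]; last by rewrite -expr2 sqr_ge0.
apply/eqP/rowP => i; rewrite mxE; apply/eqP.
by have := h i (mem_index_enum _); rewrite -expr2 sqrf_eq0.
Qed.

Lemma enorm_ge0 x : 0 <= enorm x.
Proof. exact: sqrtr_ge0. Qed.

Lemma sqr_enorm x : enorm x ^+ 2 = dot x x.
Proof. by rewrite sqr_sqrtr// dotxx_ge0. Qed.

Lemma enormZ a x : enorm (a *: x) = `|a| * enorm x.
Proof.
by rewrite /enorm dotZl dotZr mulrA -expr2 sqrtrM ?sqr_ge0// sqrtr_sqr.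
Qed.

Lemma enorm0 : enorm (0 : 'rV[R]_n) = 0.
Proof. by rewrite /enorm dot0l sqrtr0. Qed.

Lemma enorm_eq0 x : (enorm x == 0) = (x == 0).
Proof. by rewrite -[LHS](sqrf_eq0 (enorm x)) sqr_enorm dotxx_eq0. Qed.

Lemma enorm_gt0 x : (0 < enorm x) = (x != 0).
Proof. by rewrite lt_neqAle enorm_ge0 andbT eq_sym enorm_eq0. Qed.

Lemma enormN x : enorm (- x) = enorm x.
Proof. by rewrite -scaleN1r enormZ normrN1 mul1r. Qed.

Lemma enorm1_dot x : enorm x = 1 -> dot x x = 1.
Proof. by move=> x1; rewrite -sqr_enorm x1 expr1n. Qed.

Lemma dot_le_enorm x y : `|dot x y| <= enorm x * enorm y.
Proof.
have [->|y0] := eqVneq y 0; first by rewrite dotC dot0l normr0 mulr_ge0 ?enorm_ge0.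
rewrite -(@ler_pXn2r _ 2) ?nnegrE ?mulr_ge0 ?enorm_ge0//.
rewrite exprMn !sqr_enorm real_normK ?num_real//.
have yy : 0 < dot y y by rewrite lt_neqAle dotxx_ge0 eq_sym dotxx_eq0 y0.
have := dotxx_ge0 (dot y y *: x - dot x y *: y).
rewrite dotDl !dotDr !dotNl !dotNr !dotZl !dotZr (dotC y x) => h.
rewrite -(ler_pM2l yy); nra.
Qed.

Lemma ler_coord_enorm x i : `|x 0 i| <= enorm x.
Proof.
rewrite -(@ler_pXn2r _ 2) ?nnegrE ?enorm_ge0// sqr_enorm real_normK ?num_real//.
rewrite dotE (bigD1 i)//= -expr2 lerDl sumr_ge0// => j _.
by rewrite -expr2 sqr_ge0.
Qed.

Lemma ler_enorm_coord x a : 0 <= a -> (forall i, `|x 0 i| <= a) ->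
  enorm x <= n%:R * a.
Proof.
move=> a0 h.
have [n0|n0] := posnP n.
  suff -> : x = 0 by rewrite enorm0 mulr_ge0.
  by apply/rowP => i; have := ltn_ord i; rewrite {2}n0 ltn0.
rewrite -(@ler_pXn2r _ 2) ?nnegrE ?enorm_ge0 ?mulr_ge0// sqr_enorm dotE.
apply: (@le_trans _ _ (\sum_(i < n) a ^+ 2)).
  apply: ler_sum => i _; rewrite -expr2 -[leLHS]real_normK ?num_real//.
  by rewrite ler_pXn2r ?nnegrE.
rewrite sumr_const card_ord -[leLHS]mulr_natl exprMn; apply: ler_wpM2r; first exact: sqr_ge0.
by rewrite expr2 ler_peMl// ler1n.
Qed.

Lemma dot_mulmx k (x : 'rV[R]_k) (A : 'M[R]_(k, n)) y :
  dot (x *m A) y = dot x (y *m A^T).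
Proof. by rewrite /dot trmx_mul trmxK mulmxA. Qed.

Lemma dot_mulmx_orthonormal k (x y : 'rV[R]_k) (A : 'M[R]_(k, n)) :
  A *m A^T = 1%:M -> dot (x *m A) (y *m A) = dot x y.
Proof. by move=> AA; rewrite dot_mulmx -mulmxA AA mulmx1. Qed.

Lemma enorm_mulmx_orthonormal k (x : 'rV[R]_k) (A : 'M[R]_(k, n)) :
  A *m A^T = 1%:M -> enorm (x *m A) = enorm x.
Proof. by move=> AA; rewrite /enorm dot_mulmx_orthonormal. Qed.

End euclidean.

(** * Topology against the product sigma-algebra *)

Section borel_rV.
Context {R : realType}.

(** An open set is the union of the cubes with rational centre and half-side 1 / (k + 1) that it
    contains, a countable family of measurable sets. *)
Lemma open_measurable_rV n (U : set 'rV[R]_n) : open U -> measurable U.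
Proof.
move=> oU.
pose B (z : 'rV[rat]_n * nat) : set 'rV[R]_n :=
  [set x | forall i, `|x 0 i - ratr (z.1 0 i)| <= z.2.+1%:R^-1].
have mB z : measurable (B z).
  rewrite (_ : B z = \bigcap_(i in [set: 'I_n])
      [set x : 'rV[R]_n | `|x 0 i - ratr (z.1 0 i)| <= z.2.+1%:R^-1]).
    apply: fin_bigcap_measurable => // i _.
    rewrite -[X in measurable X]setTI; apply: measurable_fun_le => //.
    apply: measurableT_comp => //; apply: measurable_funD => //.
    exact: measurable_rV_coord.
  by apply/seteqP; split=> x /= h i; [move=> _|]; exact: h.
pose F z := if pselect (B z `<=` U) then B z else set0.
suff -> : U = \bigcup_z F z.
  apply: countable_bigcupT_measurable => [|z]; first exact: countableP.
  by rewrite /F; case: pselect => BU /=; [exact: mB|exact: measurable0].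
apply/seteqP; split => [x Ux|x [z _]]; last first.
  by rewrite /F; case: pselect => // BU /BU.
have /nbhs_ballP[e /= e0 xe] : nbhs x U by exact: open_nbhs_nbhs.
have [k ke] : exists k : nat, k.+1%:R^-1 < e / 2.
  exists (Num.truncn (e / 2)^-1); rewrite invf_plt ?posrE ?divr_gt0//.
  exact: truncnS_gt.
have k0 : 0 < k.+1%:R^-1 :> R by rewrite invr_gt0.
have /choice[q hq] : forall i : 'I_n, exists q : rat, `|x 0 i - ratr q| < k.+1%:R^-1.
  move=> i; have [|q] := @rat_in_itvoo R (x 0 i - k.+1%:R^-1) (x 0 i + k.+1%:R^-1).
    by rewrite ltrBlDr -addrA ltrDl addr_gt0.
  by rewrite in_itv/= => h; exists q; rewrite distrC ltr_distl.
exists (\row_i q i, k) => //; rewrite /F; case: pselect => [_ i /=|]; first by rewrite mxE ltW.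
case=> y By; apply: xe => /=; split=> // i j; rewrite /ball/= ord1.
have := hq j; have := By j; rewrite /= mxE distrC => yq xq.
rewrite -(subrK (ratr (q j)) (x 0 j)) -addrA.
apply: (le_lt_trans (ler_normD _ _)); rewrite (splitr e).
by apply: ltrD; [exact: lt_trans xq ke|exact: le_lt_trans yq ke].
Qed.

Lemma closed_measurable_rV n (A : set 'rV[R]_n) : closed A -> measurable A.
Proof.
by move=> /closed_openC/open_measurable_rV/measurableC; rewrite setCK.
Qed.

Lemma compact_measurable_rV n (A : set 'rV[R]_n) : compact A -> measurable A.
Proof.
move=> cA; apply: closed_measurable_rV.
have h : hausdorff_space 'rV[R]_n by exact: norm_hausdorff.
exact: compact_closed h cA.
Qed.

End borel_rV.

(** * Balls have positive finite measure *)

Section boxes.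
Context {R : realType}.
Local Notation leb := (lebesgue_rV R).

Definition eballr n (r : R) : set 'rV[R]_n := [set x | enorm x <= r].

Lemma measurable_eballr n (r : R) : measurable (@eballr n r).
Proof.
rewrite -[X in measurable X]setTI; apply: measurable_fun_le => //.
exact: measurable_enorm.
Qed.

Definition box n (r : R) : set 'rV[R]_n := [set x | forall i, `|x 0 i| <= r].

Lemma measurable_box n (r : R) : measurable (@box n r).
Proof.
rewrite (_ : @box n r = \bigcap_(i in [set: 'I_n]) [set x : 'rV[R]_n | `|x 0 i| <= r]).
  apply: fin_bigcap_measurable => // i _.
  rewrite -[X in measurable X]setTI; apply: measurable_fun_le => //.
  by apply: measurableT_comp => //; exact: measurable_rV_coord.
by apply/seteqP; split=> x /= h i; [move=> _|]; exact: h.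
Qed.

Lemma rV_cons_forall n (P : R -> Prop) t (y : 'rV[R]_n) :
  (forall i, P (rV_cons (t, y) 0 i)) <-> P t /\ forall i, P (y 0 i).
Proof.
split=> [h|[Pt Py] i]; last first.
  by case: (unliftP 0 i) => [j ->|->]; rewrite ?rV_consS ?rV_cons0.
split; first by have := h 0; rewrite rV_cons0.
by move=> i; have := h (lift 0 i); rewrite rV_consS.
Qed.

(** Boxes are what the recursive definition of [lebesgue_rV] measures exactly; balls are then
    compared with them. *)
Lemma lebesgue_rV_box n (r : R) : 0 <= r -> leb n (@box n r) = ((2 * r) ^+ n)%:E.
Proof.
move=> r0; elim: n => [|n IH].
  by rewrite expr0 /= diracE mem_set// => -[].
have mb k : measurable_fun setT (fun x : 'rV[R]_k => (\1_(@box k r) x)%:E : \bar R).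
  by apply/measurable_EFinP/measurable_indic; exact: measurable_box.
transitivity (\int[leb n.+1]_x (\1_(@box n.+1 r) x)%:E)%E.
  by rewrite integral_indic ?setIT//; exact: measurable_box.
rewrite (@ge0_integral_rV_cons _ _ (fun x => (\1_(@box n.+1 r) x)%:E))//.
transitivity (\int[@lebesgue_measure R]_t (((2 * r) ^+ n)%:E * (\1_`[- r, r]%classic t)%:E)%E)%E.
  apply: eq_integral => t _; rewrite -IH.
  have e y : (\1_(@box n.+1 r) (rV_cons (t, y)))%:E =
      ((\1_`[- r, r]%classic t)%:E * (\1_(@box n r) y)%:E)%E :> \bar R.
    rewrite -EFinM; congr EFin.
    rewrite !indicE -natrM mulnb; congr (nat_of_bool _)%:R.
    apply/idP/andP => [|[]]; rewrite !inE /= in_itv/= -ler_norml.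
      by move/(rV_cons_forall (fun z => `|z| <= r)).
    by move=> h1 h2; apply/(rV_cons_forall (fun z => `|z| <= r)).
  under eq_integral do rewrite e.
  rewrite ge0_integralZl_EFin//.
    by rewrite integral_indic ?setIT 1?muleC//; exact: measurable_box.
  exact: mb.
transitivity (((2 * r) ^+ n)%:E * \int[@lebesgue_measure R]_t (\1_`[- r, r]%classic t)%:E)%E.
  apply: (@ge0_integralZl_EFin _ _ _ (@lebesgue_measure R) setT) => //.
  - exact/measurable_EFinP.
  - by rewrite exprn_ge0// mulr_ge0.
rewrite [X in (_ * X)%E](_ : _ = lebesgue_measure `[- r, r]%classic); last first.
  by rewrite integral_indic// setIT.
rewrite lebesgue_measure_itv/= lte_fin.
rewrite exprSr EFinM; congr (_ * _)%E.
case: ltrP => h; first by rewrite -EFinD opprK mulrDl mul1r.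
have r00 : r = 0 by lra.
by rewrite r00 mulr0.
Qed.

Lemma lebesgue_eballr_lty n (r : R) : 0 <= r -> (leb n (@eballr n r) < +oo)%E.
Proof.
move=> r0; apply: (@le_lt_trans _ _ (leb n (@box n r))); last first.
  by rewrite lebesgue_rV_box// ltry.
apply: le_measure; rewrite ?inE.
- exact: measurable_eballr.
- exact: measurable_box.
- by move=> x /= xr i; exact: le_trans (ler_coord_enorm _ _) xr.
Qed.

Lemma lebesgue_eballr_gt0 n (r : R) : 0 < r -> (0 < leb n (@eballr n r))%E.
Proof.
move=> r0; apply: (@lt_le_trans _ _ (leb n (@box n (r / n.+1%:R)))).
  rewrite lebesgue_rV_box ?divr_ge0 ?ltW// lte_fin exprn_gt0// mulr_gt0//.
  by rewrite divr_gt0.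
apply: le_measure; rewrite ?inE.
- exact: measurable_box.
- exact: measurable_eballr.
move=> x /= /(ler_enorm_coord _) xr; rewrite /eballr/=.
apply: le_trans (xr _) _; first by rewrite divr_ge0 ?ltW.
rewrite mulrCA; apply: ler_piMr; first exact: ltW.
by rewrite ler_pdivrMr ?ltr0n// mul1r ler_nat.
Qed.

End boxes.

(** * Rotation invariance of Lebesgue measure *)

Section rotation.
Context {R : realType} {n : nat}.
Local Open Scope ereal_scope.
Local Notation leb := (lebesgue_rV R n).
Variables (Q : 'M[R]_n) (QQ : Q *m Q^T = 1%:M).

Let mQ d (T : measurableType d) (g : T -> 'rV[R]_n) :
  measurable_fun setT g -> measurable_fun setT (fun x => g x *m Q).
Proof. exact: measurable_rV_mulmx_cst. Qed.

(* Uniqueness of Haar measure: both f |-> int f and f |-> int f(xQ) are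
   translation invariant, and integrating f(x + yQ) g(yQ) in two ways compares
   them; they agree on the indicator of the ball. *)
Lemma ge0_integral_rV_orthogonal (f : 'rV[R]_n -> \bar R) :
  measurable_fun setT f -> (forall x, 0 <= f x) ->
  \int[leb]_x f (x *m Q) = \int[leb]_x f x.
Proof.
move=> mf f0; pose g (x : 'rV[R]_n) : \bar R := (\1_(@eballr R n 1) x)%:E.
have mg : measurable_fun setT g.
  by apply/measurable_EFinP/measurable_indic; exact: measurable_eballr.
have g0 x : 0 <= g x by rewrite lee_fin.
have gN x : g (- x)%R = g x by rewrite /g !indicE; congr (nat_of_bool _)%:R%:E; apply/idP/idP; rewrite !inE/= /eballr/= enormN.
have gQ x : g (x *m Q) = g x.
  by rewrite /g !indicE /eballr; congr (nat_of_bool _)%:R%:E; apply/idP/idP; rewrite !inE/= enorm_mulmx_orthonormal.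
have Ig : \int[leb]_x g x = leb (@eballr R n 1).
  by rewrite /g integral_indic ?setIT//; exact: measurable_eballr.
pose H (p : 'rV[R]_n * 'rV[R]_n) := f (p.1 + p.2 *m Q)%R * g (p.2 *m Q).
have mH : measurable_fun setT H.
  apply: emeasurable_funM; apply: measurableT_comp => //; last exact: mQ.
  by apply: measurable_rV_add => //; exact: mQ.
have H0 p : 0 <= H p by rewrite mule_ge0.
have mfa a : measurable_fun setT (fun x : 'rV[R]_n => f (x + a)%R).
  by apply: measurableT_comp => //; exact: measurable_rV_add.
have mga a : measurable_fun setT (fun x : 'rV[R]_n => g (x + a)%R).
  by apply: measurableT_comp => //; exact: measurable_rV_add.
have mfQ : measurable_fun setT (fun x : 'rV[R]_n => f (x *m Q)).
  by apply: measurableT_comp => //; exact: mQ.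
have If0 : 0 <= \int[leb]_x f x by exact: integral_ge0.
have Ig0 : 0 <= \int[leb]_x g x by exact: integral_ge0.
have e1 : \int[leb]_y \int[leb]_x H (x, y) = (\int[leb]_x f x) * \int[leb]_x g x.
  transitivity (\int[leb]_y ((\int[leb]_x f x) * g y)); last exact: ge0_integralZl.
  apply: eq_integral => y _.
  transitivity (\int[leb]_x (f (x + y *m Q)%R * g y)).
    by apply: eq_integral => x _; rewrite /H/= gQ.
  transitivity ((\int[leb]_x f (x + y *m Q)%R) * g y); first exact: ge0_integralZr.
  by congr (_ * _); exact: ge0_integral_rV_addr.
have e2 : \int[leb]_x \int[leb]_y H (x, y) =
    (\int[leb]_x f (x *m Q)) * \int[leb]_x g x.
  (* Replacing y by y + x Q^T turns [H'] into [H]. In [H'] the variable x occurs only in [g], which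
     is even and is integrated by translation. *)
  pose H' (p : 'rV[R]_n * 'rV[R]_n) := f (p.2 *m Q) * g (p.2 *m Q - p.1)%R.
  have mH' : measurable_fun setT H'.
    apply: emeasurable_funM; apply: measurableT_comp => //; first exact: mQ.
    by apply: measurable_rV_add => //; [exact: mQ|exact: measurable_rV_opp].
  have H'0 p : 0 <= H' p by rewrite mule_ge0.
  transitivity (\int[leb]_x \int[leb]_y H' (x, y)).
    apply: eq_integral => x _.
    transitivity (\int[leb]_y H' (x, (y + x *m Q^T)%R)).
      apply: eq_integral => y _; rewrite /H' /H/=.
      have -> : ((y + x *m Q^T) *m Q = x + y *m Q)%R.
        by rewrite mulmxDl -mulmxA (mulmx1C QQ) mulmx1 addrC.
      by congr (f _ * g _); rewrite addrC addKr.
    apply: (@ge0_integral_rV_addr _ _ (fun y => H' (x, y))) => //.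
    by apply: (measurableT_comp mH'); exact: measurable_pair1.
  transitivity (\int[leb]_y \int[leb]_x H' (x, y)); first exact: fubini_tonelli.
  transitivity (\int[leb]_y (f (y *m Q) * \int[leb]_x g x)).
    apply: eq_integral => y _.
    transitivity (\int[leb]_x (f (y *m Q) * g (x - y *m Q)%R)).
      by apply: eq_integral => x _; rewrite /H'/= -gN opprB.
    transitivity (f (y *m Q) * \int[leb]_x g (x - y *m Q)%R).
      by apply: ge0_integralZl => //; exact: mga.
    by congr (_ * _); exact: ge0_integral_rV_addr.
  by apply: ge0_integralZr.
have e : (\int[leb]_x f (x *m Q)) * \int[leb]_x g x = (\int[leb]_x f x) * \int[leb]_x g x.
  by rewrite -e1 -e2; exact: (fubini_tonelli H mH H0).
move: e; rewrite Ig.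
have b0 := lebesgue_eballr_gt0 n (@ltr01 R); have boo := lebesgue_eballr_lty n (@ler01 R).
set b := leb _ in b0 boo *.
have bf : b \is a fin_num by rewrite ge0_fin_numE// ltW.
rewrite -(fineK bf) => /(congr1 (fun z => z * (fine b)^-1%:E)).
by rewrite -!muleA -!EFinM mulfV ?mule1// gt_eqF// fine_gt0// b0 boo.
Qed.

Lemma lebesgue_rV_orthogonal (A : set 'rV[R]_n) : measurable A ->
  leb [set x | A (x *m Q)] = leb A.
Proof.
move=> mA.
have mA' : measurable [set x | A (x *m Q)].
  by rewrite -[X in measurable X]setTI; apply: mQ.
rewrite -[X in _ = leb X]setIT -integral_indic//.
rewrite -ge0_integral_rV_orthogonal//; last exact/measurable_EFinP.
by rewrite -[X in leb X = _]setIT -integral_indic.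
Qed.

End rotation.

(** * Volumes in polar coordinates *)

Section polar.
Context {R : realType}.
Local Notation mu := (@lebesgue_measure R).
Local Notation leb := (lebesgue_rV R).

Lemma lebesgue_rV_set0 n : (0 < n)%N -> leb n [set 0] = 0%E.
Proof.
move=> n0; rewrite (_ : [set 0] = box (0 : R)).
  by rewrite lebesgue_rV_box// mulr0 expr0n gtn_eqF.
apply/seteqP; split => [x /= -> i|x /= h]; first by rewrite mxE normr0.
by apply/rowP => i; apply/eqP; rewrite mxE -normr_le0.
Qed.

(** Stands in for the sphere: for a function of degree -n the integral over this shell is ln 2 times
    the spherical integral, and no surface measure has to be built. The ratio 2 of the radii is
    arbitrary. *)
Definition annulus n : set 'rV[R]_n := [set x | 1 <= enorm x <= 2].

Lemma measurable_annulus n : measurable (@annulus n).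
Proof.
rewrite (_ : @annulus n = (setT `&` [set x | 1 <= enorm x]) `&` (setT `&` [set x | enorm x <= 2])).
  by apply: measurableI; apply: measurable_fun_le => //; exact: measurable_enorm.
by rewrite !setTI; apply/seteqP; split => x /= /andP.
Qed.

Lemma annulus_neq0 n (x : 'rV[R]_n) : annulus x -> x != 0.
Proof. by move=> /andP[x1 _]; rewrite -enorm_gt0 (lt_le_trans _ x1). Qed.

Lemma measurable_indic_comp d1 d2 (T1 : measurableType d1) (T2 : measurableType d2)
    (f : T1 -> T2) (A : set T2) : measurable A -> measurable_fun setT f ->
  measurable_fun setT (fun x => \1_A (f x) : R).
Proof. by move=> mA mf; apply: measurableT_comp => //; exact: measurable_indic. Qed.

(** In the logarithmic variable s + ln |x| the shell is an interval of length ln 2, wherever x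
    lies. *)
Lemma integral_annulus_dilation n (x : 'rV[R]_n) : x != 0 ->
  (\int[mu]_s (\1_(@annulus n) (expR s *: x))%:E = (ln 2)%:E)%E.
Proof.
rewrite -enorm_gt0 => x0.
transitivity (\int[mu]_s (\1_`[- ln (enorm x), ln 2 - ln (enorm x)]%classic s)%:E)%E.
  apply: eq_integral => s _; congr (_%:E); rewrite !indicE; congr (nat_of_bool _)%:R.
  have e2 : expR s * enorm x = expR (s + ln (enorm x)) by rewrite expRD lnK ?posrE.
  apply/idP/idP; rewrite !inE /annulus/= in_itv/= enormZ ger0_norm ?expR_ge0// e2;
    rewrite -[X in X <= expR _]expR0 ler_expR -[X in expR _ <= X]lnK ?posrE ?ltr0n// ler_expR;
    by rewrite lerBrDr -lerBlDr sub0r.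
rewrite [LHS](_ : _ = mu `[- ln (enorm x), ln 2 - ln (enorm x)]%classic); last first.
  by rewrite integral_indic// setIT.
rewrite lebesgue_measure_itv/= lte_fin.
rewrite -[X in X < _]add0r ltrD2r ln_gt0 ?ltr1n//.
by rewrite -EFinD opprK subrK.
Qed.

Variables (n : nat) (n_gt0 : (0 < n)%N) (r : 'rV[R]_n -> R).
Hypothesis mr : measurable_fun setT r.
Hypothesis r_gt0 : forall x : 'rV[R]_n, x != 0 -> 0 < r x.
Hypothesis r_homog : forall (t : R) (x : 'rV[R]_n), 0 < t -> x != 0 -> r (t *: x) = t^-1 * r x.

(* Fubini for the function 1[r(x) >= 1] 1[1 <= |e^s x| <= 2] of (s, x), scaling
   x by e^-s for fixed s. *)
Lemma lebesgue_rV_radial :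
  ((n%:R * ln 2)%:E * leb n [set x : 'rV[R]_n | x != 0%R /\ (1 <= r x)%R] =
   \int[leb n]_(x in @annulus n) (r x ^+ n)%:E)%E.
Proof.
have mA := @measurable_annulus n.
pose S := [set x : 'rV[R]_n | x != 0 /\ 1 <= r x].
have mS : measurable S.
  rewrite (_ : S = ~` [set 0] `&` (setT `&` [set x | 1 <= r x])).
    apply: measurableI; last exact: measurable_fun_le.
    by apply: measurableC; apply: compact_measurable_rV; exact: compact_set1.
  rewrite setTI; apply/seteqP; split => x /= [x0 h]; split => //.
    by apply/eqP.
  by apply/eqP.
pose e (s : R) := expR s.
have me d (T : measurableType d) (f : T -> R) : measurable_fun setT f ->
    measurable_fun setT (fun x => e (f x)).
  by move=> mf; apply: measurableT_comp => //; exact: measurable_expR.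
pose H (p : measurableTypeR R * 'rV[R]_n) : \bar R :=
  (n%:R * \1_S p.2 * \1_(@annulus n) (e p.1 *: p.2))%:E.
have mH : measurable_fun setT H.
  apply/measurable_EFinP/measurable_funM.
    by apply: measurable_funM => //; exact: measurable_indic_comp.
  apply: measurable_indic_comp => //; apply: measurable_rV_scale => //.
  exact: me.
have H0 p : (0 <= H p)%E by rewrite lee_fin !mulr_ge0.
pose K (p : measurableTypeR R * 'rV[R]_n) : \bar R :=
  (n%:R * \1_S (e (- p.1) *: p.2) * \1_(@annulus n) p.2)%:E.
have mK : measurable_fun setT K.
  apply/measurable_EFinP/measurable_funM; last exact: measurable_indic_comp.
  apply: measurable_funM => //.
  apply: measurable_indic_comp => //; apply: measurable_rV_scale => //.
  by apply: me; exact: measurable_funN.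
have K0 p : (0 <= K p)%E by rewrite lee_fin !mulr_ge0.
pose L (p : measurableTypeR R * 'rV[R]_n) : \bar R :=
  ((e (- p.1) ^+ n)%:E * K p)%E.
have mL : measurable_fun setT L.
  apply: emeasurable_funM => //; apply/measurable_EFinP/measurable_funX.
  by apply: me; exact: measurable_funN.
have L0 p : (0 <= L p)%E by rewrite mule_ge0// lee_fin exprn_ge0// expR_ge0.
transitivity (\int[leb n]_x \int[mu]_s H (s, x))%E.
  rewrite -[leb n _](_ : \int[leb n]_x (\1_S x)%:E = _)%E; last first.
    by rewrite integral_indic// setIT.
  rewrite -ge0_integralZl_EFin//; last 2 first.
  - exact/measurable_EFinP/measurable_indic.
  - by rewrite mulr_ge0// ln_ge0// ler1n.
  apply: eq_integral => x _; rewrite [in LHS]indicE.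
  have [/set_mem Sx|nSx] := boolP (x \in S); last first.
    rewrite mule0 integral0_eq// => s _.
    by rewrite /H/= [\1_S x]indicE (negbTE nSx) mulr0 mul0r.
  transitivity (\int[mu]_s (n%:R%:E * (\1_(@annulus n) (expR s *: x))%:E))%E.
    rewrite ge0_integralZl_EFin//; last first.
      apply/measurable_EFinP/measurable_indic_comp => //.
      by apply: measurable_rV_scale => //; exact: me.
    by rewrite integral_annulus_dilation ?mule1//; case: Sx.
  by apply: eq_integral => s _; rewrite /H/= [\1_S x]indicE mem_set// mulr1 EFinM.
transitivity (\int[mu]_s \int[leb n]_x H (s, x))%E.
  by rewrite (fubini_tonelli H).
transitivity (\int[mu]_s \int[leb n]_x L (s, x))%E.
  apply: eq_integral => s _.
  transitivity (\int[leb n]_x K (s, e s *: x))%E.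
    apply: eq_integral => x _; rewrite /H /K/= scalerA.
    by rewrite /e expRN mulVf ?gt_eqF ?expR_gt0// scale1r.
  have mKs : measurable_fun setT (fun x => K (s, x)) by apply: (measurableT_comp mK); exact: measurable_pair1.
  transitivity ((`|e s| ^- n)%:E * \int[leb n]_x K (s, x))%E.
    by apply: (@ge0_integral_rV_scale _ _ (fun x => K (s, x))) => //; rewrite gt_eqF ?expR_gt0.
  transitivity (\int[leb n]_x ((`|e s| ^- n)%:E * K (s, x)))%E.
    apply/esym; apply: (@ge0_integralZl_EFin _ _ _ (leb n) setT) => //.
  apply: eq_integral => x _; rewrite /L /=; congr (_%:E * _)%E.
  by rewrite ger0_norm ?expR_ge0// /e expRN exprVn.
transitivity (\int[leb n]_x \int[mu]_s L (s, x))%E.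
  by rewrite (fubini_tonelli L).
rewrite [RHS]integral_mkcond; apply: eq_integral => x _; rewrite patchE.
case: ifPn => [/set_mem Ax|nAx]; last first.
  rewrite integral0_eq// => s _.
  by rewrite /L /K /= [\1_(@annulus n) x]indicE (negbTE nAx) !mulr0 mule0.
have x0 := annulus_neq0 Ax; have rx0 := r_gt0 x0.
have n0 : 0 < n%:R :> R by rewrite ltr0n.
(* The condition r (e^-s x) >= 1 reads s + ln (r x) >= 0, so the s-integral of n e^(- n s) is (r
   x)^n times the total mass of the exponential law of rate n. *)
pose P (s : R) : \bar R := (exponential_pdf n%:R s)%:E.
have mP : measurable_fun setT P by apply/measurable_EFinP; exact: measurable_exponential_pdf.
have P0 s : (0 <= P s)%E by rewrite lee_fin exponential_pdf_ge0// ltW.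
transitivity (\int[mu]_s ((r x ^+ n)%:E * P (s + ln (r x))%R))%E; last first.
  rewrite ge0_integralZl_EFin//; last 2 first.
  - by apply: measurableT_comp => //; exact: measurable_funD.
  - by rewrite exprn_ge0// ltW.
  by rewrite ge0_integral_lebesgue_addr// integral_exponential_pdf// mule1.
apply: eq_integral => s _; rewrite /L /K /P /= -!EFinM; congr (_%:E).
rewrite [\1_(@annulus n) x]indicE mem_set// mulr1 indicE.
have [h|h] := leP 0 (s + ln (r x)).
  rewrite mem_set; last first.
    split; first by rewrite scaler_eq0 negb_or x0 gt_eqF ?expR_gt0.
    rewrite r_homog ?expR_gt0// /e expRN invrK.
    by rewrite -[X in _ * X]lnK ?posrE// -expRD -[leLHS]expR0 ler_expR.
  rewrite mulr1 exponential_pdfE//=.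
  have E : expR (- n%:R * (s + ln (r x))) * r x ^+ n = e (- s) ^+ n.
    rewrite -[X in X ^+ n]lnK ?posrE// /e -!expRM_natl -expRD; congr expR; ring.
  rewrite -E; ring.
rewrite memNset; last first.
  case => _; rewrite r_homog ?expR_gt0// /e expRN invrK.
  by rewrite -[X in _ * X]lnK ?posrE// -expRD -[X in X <= _]expR0 ler_expR leNgt h.
by rewrite !mulr0 lt0_exponential_pdf// mulr0.
Qed.

End polar.

(** * Volume of a star body from its radial function *)

Section star_of_radial.
Context {R : realType} {n : nat} (n_gt0 : (0 < n)%N).
Local Notation leb := (lebesgue_rV R).
Variables (rho r : 'rV[R]_n -> R).
Hypothesis mr : measurable_fun setT r.
Hypothesis r_gt0 : forall x : 'rV[R]_n, x != 0 -> 0 < r x.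
Hypothesis r_homog :
  forall (t : R) (x : 'rV[R]_n), 0 < t -> x != 0 -> r (t *: x) = t^-1 * r x.
Hypothesis r_rho : forall u, esphere u -> rho u = r u.

Lemma enorm_normalize (x : 'rV[R]_n) : x != 0 -> enorm ((enorm x)^-1 *: x) = 1.
Proof.
rewrite -enorm_gt0 => x0.
by rewrite enormZ ger0_norm ?invr_ge0 ?ltW// mulVf// gt_eqF.
Qed.

Lemma esphere_neq0 : (@esphere R n) !=set0.
Proof.
pose v : 'rV[R]_n := const_mx 1.
exists ((enorm v)^-1 *: v); apply: enorm_normalize.
by apply/eqP => /rowP/(_ (Ordinal n_gt0)); rewrite !mxE => /eqP; rewrite oner_eq0.
Qed.

(** [rho] is known on the sphere only and [r] is its extension of degree -1, so membership of x on a
    ray becomes r x >= 1. The origin is separate because [r 0] is unconstrained. *)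
Lemma star_of_radialE :
  star_of_radial rho = [set 0] `|` [set x : 'rV[R]_n | x != 0 /\ 1 <= r x].
Proof.
apply/seteqP; split => x /=.
  move=> [u [l [u1 /andP[l0 lu] xlu]]].
  have un0 : u != 0 by rewrite -enorm_gt0 u1.
  have [l00|l00] := eqVneq l 0; first by left; rewrite xlu l00 scale0r.
  have lp : 0 < l by rewrite lt_neqAle eq_sym l00.
  right; split; first by rewrite xlu scaler_eq0 negb_or l00.
  by rewrite xlu r_homog// -r_rho// mulrC ler_pdivlMr// mul1r.
case=> [->|[x0 rx]].
  (* The origin enters the body as the multiple 0 of some unit vector, so one has to exist. *)
  have [v v1] := esphere_neq0.
  exists v, 0; split; [exact: v1| |by rewrite scale0r].
  by rewrite lexx/= r_rho// ltW// r_gt0// -enorm_gt0 v1.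
have ex0 : 0 < enorm x by rewrite enorm_gt0.
exists ((enorm x)^-1 *: x), (enorm x); split; first exact: enorm_normalize.
  rewrite ltW//= r_rho; last exact: enorm_normalize.
  by rewrite r_homog ?invr_gt0// invrK ler_peMr// ltW.
by rewrite scalerA mulfV ?gt_eqF// scale1r.
Qed.

(** Also true at the infinities: a positive factor preserves them and [fine] sends them to 0. *)
Lemma fine_mule_EFin (c : R) (x : \bar R) : 0 < c -> fine (c%:E * x)%E = c * fine x.
Proof.
move=> c0; case: x => [x| |] //=.
  by rewrite gt0_muley ?lte_fin//= mulr0.
by rewrite gt0_muleNy ?lte_fin//= mulr0.
Qed.

Lemma vol_star_of_radial :
  vol (star_of_radial rho) =
  (n%:R * ln 2)^-1 * fine (\int[leb n]_(x in @annulus R n) (r x ^+ n)%:E)%E.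
Proof.
have c0 : 0 < n%:R * ln 2 :> R by rewrite mulr_gt0 ?ltr0n// ln_gt0// ltr1n.
have mS1 : measurable [set 0 : 'rV[R]_n].
  by apply: compact_measurable_rV; exact: compact_set1.
have mS : measurable [set x : 'rV[R]_n | x != 0 /\ 1 <= r x].
  rewrite (_ : mkset _ = ~` [set 0] `&` (setT `&` [set x | 1 <= r x])).
    by apply: measurableI; [exact: measurableC|exact: measurable_fun_le].
  rewrite setTI; apply/seteqP; split => x /= [x0 h]; split => //; exact/eqP.
rewrite -lebesgue_rV_radial// fine_mule_EFin// mulrA mulVf ?gt_eqF// mul1r.
rewrite /vol star_of_radialE measureU//; last first.
  by apply/seteqP; split => x //= [-> []]; rewrite eqxx.
by rewrite [X in (X + _)%E]lebesgue_rV_set0// add0e.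
Qed.

End star_of_radial.

(** * Supporting lines of power functions *)

Section tangent.
Context {R : realType}.

Lemma ln_le_subr1 (x : R) : 0 < x -> ln x <= x - 1.
Proof.
by move=> x0; rewrite lerBrDl -[leRHS]lnK ?posrE// expR_ge1Dx.
Qed.

(** Both ranges follow from e^x >= 1 + x. For q <= 0 it is combined with ln s <= s - 1. For q >= 1
    it is applied to s^(q - 1) with ln s >= 1 - 1 / s, and the remaining factor s restores the
    tangent exactly. *)
Lemma powR_ge_tangent1 (q s : R) : 0 < s -> q <= 0 \/ 1 <= q ->
  1 + q * (s - 1) <= s `^ q.
Proof.
move=> s0 [q0|q1].
  rewrite /powR gt_eqF//; apply: le_trans (expR_ge1Dx _).
  by rewrite lerD2l ler_wnM2l// ln_le_subr1.
have e : s `^ q = s * s `^ (q - 1).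
  by rewrite -[X in X * _]powRr1 ?ltW// -powRD ?subrKC//; apply/implyP => _; rewrite gt_eqF.
have h : 1 + (q - 1) * (1 - s^-1) <= s `^ (q - 1).
  rewrite [leRHS]/powR gt_eqF//; apply: le_trans (expR_ge1Dx _).
  rewrite lerD2l ler_wpM2l ?subr_ge0// -lerN2 opprB -lnV ?posrE//.
  by rewrite ln_le_subr1// invr_gt0.
rewrite e; apply: le_trans (ler_wpM2l (ltW s0) h).
rewrite le_eqVlt; apply/orP; left; apply/eqP; field.
by rewrite gt_eqF.
Qed.

(** Scaling by [a] reduces to the tangent at 1. This supporting line is the form in which convexity
    enters Jensen's inequality. *)
Lemma powR_ge_tangent (q a t : R) : 0 < a -> 0 < t -> q <= 0 \/ 1 <= q ->
  a `^ q * (1 - q) + q * a `^ (q - 1) * t <= t `^ q.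
Proof.
move=> a0 t0 hq.
have ta : 0 < t / a by rewrite divr_gt0.
have e : t `^ q = a `^ q * (t / a) `^ q.
  by rewrite -powRM ?ltW// mulrCA mulfV ?mulr1// gt_eqF.
have e1 : a `^ q = a * a `^ (q - 1).
  by rewrite -[X in X * _]powRr1 ?ltW// -powRD ?subrKC//; apply/implyP => _; rewrite gt_eqF.
rewrite e; apply: le_trans (ler_wpM2l (powR_ge0 _ _) (powR_ge_tangent1 ta hq)).
rewrite le_eqVlt; apply/orP; left; apply/eqP; rewrite e1; field.
by rewrite gt_eqF.
Qed.

End tangent.

(** * Orthonormal frames of hyperplanes *)

Section householder.
Context {R : realType} {k : nat}.
Implicit Types (u x : 'rV[R]_k.+1) (B : 'M[R]_(k, k.+1)).
Local Notation leb := (lebesgue_rV R).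

Definition is_frame u B := B *m B^T = 1%:M /\ B *m u^T = 0.

Definition frame_mx u B : 'M[R]_k.+1 := col_mx (u : 'M[R]_(1, k.+1)) B.

Lemma rV_cons_frame u B t (y : 'rV[R]_k) :
  rV_cons (t, y) *m frame_mx u B = t *: u + y *m B.
Proof.
by rewrite -mul_scalar_mx; exact: (@mul_row_col R 1 1 k k.+1 t%:M y u B).
Qed.

Lemma mulmx_tr11 u v : u *m v^T = (dot u v)%:M.
Proof. by rewrite [LHS]mx11_scalar. Qed.

Lemma frame_mxP u B : enorm u = 1 -> is_frame u B ->
  frame_mx u B *m (frame_mx u B)^T = 1%:M.
Proof.
move=> u1 [BB Bu]; rewrite /frame_mx.
transitivity (col_mx (u : 'M[R]_(1, k.+1)) B *m row_mx u^T B^T).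
  by congr (_ *m _); exact: (@tr_col_mx R 1 k k.+1 u B).
rewrite mul_col_row BB Bu mulmx_tr11 enorm1_dot//.
have -> : u *m B^T = 0 by apply: trmx_inj; rewrite trmx_mul trmxK Bu trmx0.
exact: esym (scalar_mx_block 1 k 1).
Qed.

Lemma frame_tr_mul u B : enorm u = 1 -> is_frame u B ->
  B^T *m B = 1%:M - u^T *m u.
Proof.
move=> u1 uB; have := mulmx1C (frame_mxP u1 uB) => h.
rewrite -h (_ : (frame_mx u B)^T = row_mx u^T B^T); last exact: (@tr_col_mx R 1 k k.+1 u B).
have -> : row_mx u^T B^T *m frame_mx u B = u^T *m u + B^T *m B.
  exact: (@mul_row_col R k.+1 1 k k.+1 u^T B^T u B).
by rewrite addrC addKr.
Qed.

(** B^T B is the projection onto the hyperplane orthogonal to u, so the two frames differ by the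
    orthogonal matrix B' B^T and rotation invariance in dimension k applies. *)
Lemma frame_indep u B B' (K : set 'rV[R]_k.+1) : enorm u = 1 ->
  is_frame u B -> is_frame u B' -> measurable K ->
  leb k [set y | K (y *m B')] = leb k [set y | K (y *m B)].
Proof.
move=> u1 uB [BB Bu] mK.
have e : B' *m B^T *m B = B'.
  by rewrite -mulmxA (frame_tr_mul u1 uB) mulmxBr mulmx1 mulmxA Bu mul0mx subr0.
rewrite -[RHS](@lebesgue_rV_orthogonal _ _ (B' *m B^T)).
- congr (leb k _); apply/seteqP; split => y /=.
    by rewrite -(mulmxA y) e.
  by rewrite -(mulmxA y) e.
- by rewrite trmx_mul trmxK mulmxA e BB.
- rewrite -[X in measurable X]setTI.
  by apply: (@measurable_rV_mulmx_cst _ _ _ _ _ _ B) => //; exact: measurable_id.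
Qed.

(** For a unit vector u, the reflection that exchanges u and the first basis vector; if they
    coincide, division by 0 giving 0 makes it the identity. Unlike a frame obtained by choice, its
    entries are measurable in u. *)
Definition householder u : 'M[R]_k.+1 :=
  let w := delta_mx 0 0 - u in 1%:M - (2 / dot w w) *: (w^T *m w).

Definition householder_frame u : 'M[R]_(k, k.+1) := rowsub (lift 0) (householder u).

Lemma trmx_householder u : (householder u)^T = householder u.
Proof.
rewrite /householder raddfB/= trmx1; congr (_ - _).
by rewrite linearZ/= trmx_mul trmxK.
Qed.

Lemma householderK u : householder u *m householder u = 1%:M.
Proof.
rewrite /householder; set w := delta_mx 0 0 - u.
set P := w^T *m w; set c := 2 / dot w w.
have PP : P *m P = dot w w *: P.
  by rewrite /P mulmxA -(mulmxA w^T) mulmx_tr11 mul_mx_scalar -scalemxAl.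
rewrite mulmxBl mul1mx mulmxBr mulmx1 -scalemxAl -scalemxAr PP.
rewrite opprB addrA !scalerA.
have [w0|w0] := eqVneq (dot w w) 0.
  by rewrite /c w0 invr0 !mulr0 ?mul0r !scale0r !subr0 ?addr0.
have -> : c * c * dot w w = c + c by rewrite /c -mulrA divfK//; lra.
by rewrite scalerDl addrA subrK addrK.
Qed.

Lemma householder_row0 u : enorm u = 1 -> delta_mx 0 0 *m householder u = u.
Proof.
move=> u1; rewrite /householder; set e0 : 'rV[R]_k.+1 := delta_mx 0 0.
set w := e0 - u; have e01 : dot e0 e0 = 1.
  by rewrite dotE big_ord_recl big1 ?addr0 => [|i _]; rewrite !mxE ?eqxx ?mulr1 ?mul0r.
have ww : dot w w = 2 * dot e0 w.
  rewrite /w dotDl !dotDr !dotNl !dotNr (dotC u e0) e01 (enorm1_dot u1); lra.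
rewrite mulmxBr mulmx1 -scalemxAr mulmxA mulmx_tr11 mul_scalar_mx scalerA.
have [w0|w0] := eqVneq (dot w w) 0.
  have : w = 0 by apply/eqP; rewrite -dotxx_eq0 w0.
  by move=> /eqP; rewrite subr_eq0 => /eqP <-; rewrite /w0 ww; move: w0; rewrite ww => ->; rewrite invr0 mulr0 mul0r scale0r subr0.
have -> : 2 / dot w w * dot e0 w = 1 by rewrite mulrAC -ww mulfV.
by rewrite scale1r /w opprB addrC subrK.
Qed.

Lemma householder_is_frame u : enorm u = 1 -> is_frame u (householder_frame u).
Proof.
move=> u1.
have HH : householder u *m (householder u)^T = 1%:M.
  by rewrite trmx_householder householderK.
split.
  apply/matrixP => i j; rewrite !mxE.
  have /matrixP/(_ (lift 0 i) (lift 0 j)) := HH; rewrite !mxE (inj_eq (@lift_inj _ 0)) => <-.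
  by apply: eq_bigr => l _; rewrite !mxE.
apply/matrixP => i j; rewrite !mxE ord1.
have uH : u = row 0 (householder u) by rewrite rowE householder_row0.
have /matrixP/(_ (lift 0 i) 0) := HH; rewrite !mxE eq_sym (negbTE (neq_lift _ _)) => h; rewrite -[RHS]h.
by apply: eq_bigr => l _; rewrite [householder_frame _ _ _]mxE [u^T _ _]mxE [(householder u)^T _ _]mxE; congr (_ * _); rewrite [in LHS]uH mxE.
Qed.

Lemma measurable_householder_frame i j :
  measurable_fun setT (fun u => householder_frame u i j).
Proof.
have mw : measurable_fun setT (fun u : 'rV[R]_k.+1 => delta_mx 0 0 - u : 'rV[R]_k.+1).
  by apply: measurable_rV_add => //; exact: measurable_rV_opp.
have mww : measurable_fun setT (fun u : 'rV[R]_k.+1 =>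
    dot (delta_mx 0 0 - u) (delta_mx 0 0 - u) `^ (-1)).
  by apply: (measurableT_comp (measurable_powR _)); exact: measurable_dot.
under eq_fun => u.
  rewrite !mxE big_ord1 !mxE.
  (* The inverse is written as a power to be a composition with the measurable [powR]. *)
  rewrite -(powR_inv1 (dotxx_ge0 (delta_mx 0 0 - u))).
  over.
apply: measurable_funB => //; apply: measurable_funM; first exact: measurable_funM.
by apply: measurable_funM; apply: measurable_funB => //; exact: measurable_rV_coord.
Qed.

(** [B] witnesses that the frame chosen by [xget] is an actual frame, and [frame_indep] trades one
    for the other. *)
Lemma section_volE u B (K : set 'rV[R]_k.+1) : enorm u = 1 -> is_frame u B ->
  measurable K -> section_vol K u = fine (leb k [set y | K (y *m B)]).
Proof.
move=> u1 uB mK; rewrite /section_vol; congr fine.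
apply: (frame_indep u1 uB) => //.
exact: (@xgetPex _ _ [set B0 : 'M[R]_(k, k.+1) | is_frame u B0] (ex_intro _ B uB)).
Qed.

Lemma ge0_integral_frame u B (f : 'rV[R]_k.+1 -> \bar R) : enorm u = 1 ->
  is_frame u B -> measurable_fun setT f -> (forall x, 0 <= f x)%E ->
  (\int[leb k.+1]_x f x =
   \int[@lebesgue_measure R]_t \int[leb k]_y f (t *: u + y *m B)%R)%E.
Proof.
move=> u1 uB mf f0.
have mfQ : measurable_fun setT (fun x : 'rV[R]_k.+1 => f (x *m frame_mx u B)).
  by apply: measurableT_comp => //; exact: measurable_rV_mulmx_cst.
transitivity (\int[leb k.+1]_x f (x *m frame_mx u B))%E.
  by apply/esym/ge0_integral_rV_orthogonal => //; exact: frame_mxP.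
transitivity (\int[@lebesgue_measure R]_t \int[leb k]_y
    f (rV_cons (t, y) *m frame_mx u B)%R)%E.
  exact: (@ge0_integral_rV_cons _ _ (fun x => f (x *m frame_mx u B))).
by apply: eq_integral => t _; apply: eq_integral => y _; rewrite rV_cons_frame.
Qed.

End householder.

(** * Jensen's inequality for averages over rotations *)

Section jensen.
Context {R : realType} {n : nat} {d} {Y : measurableType d}.
Local Notation leb := (lebesgue_rV R n).
Variables (nu : {sigma_finite_measure set Y -> \bar R}) (W : Y -> R).
Variables (Q : Y -> 'M[R]_n) (f F : 'rV[R]_n -> R) (M c1 c2 q : R).
Hypothesis mW : measurable_fun setT W.
Hypothesis W_ge0 : forall y, 0 <= W y.
Hypothesis mQ : forall i j, measurable_fun setT (fun y => Q y i j).
Hypothesis QQ : forall y, Q y *m (Q y)^T = 1%:M.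
Hypothesis mf : measurable_fun setT f.
Hypothesis c1_gt0 : 0 < c1.
Hypothesis f_bound : forall x, annulus x -> c1 <= f x <= c2.
Hypothesis M_gt0 : 0 < M.
Hypothesis intW : (\int[nu]_y (W y)%:E = M%:E)%E.
Hypothesis FE : forall x, annulus x ->
  (\int[nu]_y (W y * f (x *m Q y))%:E = (F x)%:E)%E.
Hypothesis q_range : q <= 0 \/ 1 <= q.

Lemma integral_mulindic d' (T : measurableType d') (mu : {measure set T -> \bar R})
    (D : set T) (g : T -> R) :
  (\int[mu]_(x in D) (g x)%:E = \int[mu]_x (\1_D x * g x)%:E)%E.
Proof.
rewrite integral_mkcond; apply: eq_integral => x _.
by rewrite patchE indicE; case: ifP => _; rewrite ?mul1r ?mul0r.
Qed.

Lemma annulus_orthogonal (P : 'M[R]_n) x : P *m P^T = 1%:M ->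
  annulus (x *m P) = annulus x.
Proof. by move=> PP; rewrite /annulus /mkset enorm_mulmx_orthonormal. Qed.

Let integrableW : nu.-integrable setT (EFin \o W).
Proof.
apply/integrableP; split; first exact/measurable_EFinP.
under eq_integral do rewrite /= ger0_norm//.
by rewrite intW ltry.
Qed.

Let integrable_mulW (h : Y -> R) (c : R) : measurable_fun setT h ->
  (forall y, `|h y| <= c) -> nu.-integrable setT (fun y => (W y * h y)%:E).
Proof.
move=> mh hc; apply: (@le_integrable _ _ _ nu setT measurableT _
    (fun y => (c%:E * (W y)%:E)%E)).
- exact/measurable_EFinP/measurable_funM.
- move=> y _ /=; have c0 : 0 <= c by exact: le_trans (normr_ge0 _) (hc y).
  rewrite lee_fin !normrM (ger0_norm c0) (ger0_norm (W_ge0 y)) mulrC.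
  by rewrite ler_wpM2r.
- exact: (integrableZl measurableT c integrableW).
Qed.

Let mfQ x : measurable_fun setT (fun y => f (x *m Q y)).
Proof. by apply: (measurableT_comp mf); exact: measurable_rV_mulmx. Qed.

Let f_gt0 x : annulus x -> 0 < f x.
Proof. by move=> /f_bound/andP[h _]; exact: lt_le_trans h. Qed.

(** The power is monotone, so one endpoint dominates; the sum covers both ranges of q. *)
Lemma powR_le_bounds (x : R) : c1 <= x <= c2 -> x `^ q <= c1 `^ q + c2 `^ q.
Proof.
move=> /andP[h1 h2]; have x0 : 0 < x by exact: lt_le_trans h1.
have c20 : 0 < c2 by exact: lt_le_trans h2.
case: q_range => q0.
  apply: (@le_trans _ _ (c1 `^ q)); last by rewrite lerDl powR_ge0.
  rewrite -[q]opprK powRN [leRHS]powRN lef_pV2 ?posrE ?powR_gt0//.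
  by apply: ge0_ler_powR; rewrite ?nnegrE ?oppr_ge0//; exact: ltW.
apply: (@le_trans _ _ (c2 `^ q)); last by rewrite lerDr powR_ge0.
by apply: ge0_ler_powR; rewrite ?nnegrE//; [exact: le_trans q0|exact: ltW|exact: ltW].
Qed.

(** Jensen's inequality for the probability density W / M, under which M f(x Q(y)) has mean F x. *)
Lemma jensen_powR x : annulus x ->
  (M%:E * (F x `^ q)%:E <= (M `^ q)%:E * \int[nu]_y (W y * f (x *m Q y) `^ q)%:E)%E.
Proof.
move=> Ax; have AQ y : annulus (x *m Q y) by rewrite annulus_orthogonal.
set a := F x; pose t y := f (x *m Q y).
have t0 y : 0 < t y by exact: f_gt0.
have tb y : c1 <= t y <= c2 by exact: f_bound.
have it : nu.-integrable setT (fun y => (W y * t y)%:E).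
  apply: (@integrable_mulW t c2); first exact: mfQ.
  by move=> y; rewrite gtr0_norm//; have /andP[] := tb y.
have itq : nu.-integrable setT (fun y => (W y * t y `^ q)%:E).
  apply: (@integrable_mulW _ (c1 `^ q + c2 `^ q)).
    exact: (measurableT_comp (measurable_powR q) (mfQ x)).
  by move=> y; rewrite ger0_norm ?powR_ge0// powR_le_bounds.
have a0 : 0 < a.
  apply: (@lt_le_trans _ _ (c1 * M)); first by rewrite mulr_gt0.
  rewrite -lee_fin -FE// EFinM -intW -ge0_integralZl_EFin//; last 3 first.
  - by move=> y _; rewrite lee_fin.
  - exact/measurable_EFinP.
  - exact: ltW.
  apply: le_integral => //; first exact: (integrableZl measurableT c1 integrableW).
  move=> y _; rewrite lee_fin mulrC ler_wpM2l//.
  by have /andP[] := tb y.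
(* alpha + beta t is the tangent to (M t)^q at the point where M t = a. Against W it integrates to M
   a^q because W t has integral a. *)
pose alpha := a `^ q * (1 - q); pose beta := q * a `^ (q - 1) * M.
have i1 : nu.-integrable setT (fun y => (alpha%:E * (W y)%:E)%E).
  exact: (integrableZl measurableT alpha integrableW).
have i2 : nu.-integrable setT (fun y => (beta%:E * (W y * t y)%:E)%E).
  exact: (integrableZl measurableT beta it).
have e : (\int[nu]_y (alpha%:E * (W y)%:E + beta%:E * (W y * t y)%:E) =
    (M * a `^ q)%:E)%E.
  transitivity (\int[nu]_y (alpha%:E * (W y)%:E) +
    \int[nu]_y (beta%:E * (W y * t y)%:E))%E; first exact: integralD.
  transitivity (alpha%:E * \int[nu]_y (W y)%:E +
    beta%:E * \int[nu]_y (W y * t y)%:E)%E.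
    by congr (_ + _)%E; exact: integralZl.
  rewrite intW FE// -/a -!EFinM -EFinD /alpha /beta; congr EFin.
  have -> : a `^ q = a * a `^ (q - 1); last by ring.
  rewrite -[X in X * _]powRr1 ?ltW// -powRD ?subrKC//.
  by apply/implyP => _; rewrite gt_eqF.
rewrite -EFinM -e.
have -> : ((M `^ q)%:E * \int[nu]_y (W y * t y `^ q)%:E =
    \int[nu]_y ((M `^ q)%:E * (W y * t y `^ q)%:E))%E.
  by apply/esym; exact: integralZl.
apply: le_integral => //.
- exact: integrableD.
- exact: (integrableZl measurableT (M `^ q) itq).
move=> y _; rewrite -!EFinM -EFinD lee_fin.
have -> : alpha * W y + beta * (W y * t y) =
    W y * (a `^ q * (1 - q) + q * a `^ (q - 1) * (M * t y)).
  by rewrite /alpha /beta; ring.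
rewrite [leRHS]mulrCA.
rewrite -powRM ?(ltW M_gt0) ?(ltW (t0 y))//.
apply: ler_wpM2l => //.
by apply: powR_ge_tangent => //; rewrite mulr_gt0.
Qed.

(* Integrate jensen_powR over the annulus, which every Q(y) preserves. *)
Lemma jensen_annulus : measurable_fun setT F ->
  (\int[leb]_(x in @annulus R n) (F x `^ q)%:E <=
   (M `^ q)%:E * \int[leb]_(x in @annulus R n) (f x `^ q)%:E)%E.
Proof.
move=> mF; have mA := @measurable_annulus R n.
have mpow (g : 'rV[R]_n -> R) : measurable_fun setT g ->
    measurable_fun setT (fun x => g x `^ q).
  by move=> mg; exact: (measurableT_comp (measurable_powR q) mg).
have mI : measurable_fun setT (fun x : 'rV[R]_n => \1_(@annulus R n) x : R).
  exact: measurable_indic.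
pose g (x : 'rV[R]_n) : \bar R := (\1_(@annulus R n) x * f x `^ q)%:E.
have mg : measurable_fun setT g.
  by apply/measurable_EFinP/measurable_funM => //; exact: mpow.
have g0 x : (0 <= g x)%E by rewrite lee_fin mulr_ge0// powR_ge0.
have Ig0 : (0 <= \int[leb]_x g x)%E by exact: integral_ge0.
pose P (p : 'rV[R]_n * Y) : \bar R := ((W p.2)%:E * g (p.1 *m Q p.2))%E.
have mP : measurable_fun setT P.
  apply: emeasurable_funM; first exact/measurable_EFinP/measurableT_comp.
  apply: (measurableT_comp mg); apply: measurable_rV_mulmx => // i j.
  exact: (measurableT_comp (mQ i j)).
have P0 p : (0 <= P p)%E by rewrite mule_ge0// lee_fin.
have key : (M%:E * \int[leb]_x (\1_(@annulus R n) x * F x `^ q)%:E <=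
    (M `^ q)%:E * (M%:E * \int[leb]_x g x))%E.
  have <- : (\int[leb]_x \int[nu]_y P (x, y) = M%:E * \int[leb]_x g x)%E.
    transitivity (\int[nu]_y \int[leb]_x P (x, y))%E.
      exact: (fubini_tonelli P).
    transitivity (\int[nu]_y ((W y)%:E * \int[leb]_x g x))%E.
      apply: eq_integral => y _.
      transitivity (\int[leb]_x ((W y)%:E * g (x *m Q y)))%E.
        by apply: eq_integral.
      transitivity ((W y)%:E * \int[leb]_x g (x *m Q y))%E.
        apply: (@ge0_integralZl_EFin _ _ _ leb setT measurableT (fun x => g (x *m Q y))) => //.
        apply: (measurableT_comp mg); exact: measurable_rV_mulmx_cst.
      by congr (_ * _)%E; exact: (ge0_integral_rV_orthogonal (QQ y) mg g0).
    rewrite -intW; apply: ge0_integralZr => //; first exact/measurable_EFinP.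
    by move=> y _; rewrite lee_fin.
  have IP0 x : (0 <= \int[nu]_y P (x, y))%E by exact: integral_ge0.
  have mIP : measurable_fun setT (fun x => \int[nu]_y P (x, y))%E.
    exact: (measurable_fun_fubini_tonelli_F P).
  have -> : ((M `^ q)%:E * \int[leb]_x \int[nu]_y P (x, y) =
      \int[leb]_x ((M `^ q)%:E * \int[nu]_y P (x, y)))%E.
    by apply/esym; apply: (@ge0_integralZl_EFin _ _ _ leb setT measurableT (fun x => \int[nu]_y P (x, y))%E) => //; exact: powR_ge0.
  have -> : (M%:E * \int[leb]_x (\1_(@annulus R n) x * F x `^ q)%:E =
      \int[leb]_x (M%:E * (\1_(@annulus R n) x * F x `^ q)%:E))%E.
    apply/esym; apply: (@ge0_integralZl_EFin _ _ _ leb setT measurableT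
      (fun x => (\1_(@annulus R n) x * F x `^ q)%:E)) => //; last exact: ltW.
    - by move=> x _; rewrite lee_fin mulr_ge0// powR_ge0.
    - by apply/measurable_EFinP/measurable_funM => //; exact: mpow.
  apply: ge0_le_integral => //.
  - by move=> x _; rewrite -EFinM lee_fin !mulr_ge0 ?powR_ge0// ltW.
  - apply: measurable_funeM; apply/measurable_EFinP/measurable_funM => //.
    exact: mpow.
  - exact: measurable_funeM.
  move=> x _; rewrite indicE.
  have [/set_mem Ax|nAx] := boolP (x \in @annulus R n); last first.
    by rewrite mul0r mule0 mule_ge0// lee_fin powR_ge0.
  rewrite mul1r; apply: le_trans (jensen_powR Ax) _.
  rewrite le_eqVlt; apply/orP; left; apply/eqP; congr (_ * _)%E.
  apply: eq_integral => y _; rewrite /P /g /= indicE mem_set ?annulus_orthogonal//.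
  by rewrite mul1r EFinM.
rewrite (integral_mulindic leb _ (fun x => F x `^ q)).
rewrite (integral_mulindic leb _ (fun x => f x `^ q)).
by move: key; rewrite muleCA lee_pmul2l// lte_fin.
Qed.

End jensen.

(** * Absolute moments of the Cauchy law *)

Section power_integrals.
Context {R : realType}.
Local Notation mu := (@lebesgue_measure R).

Lemma integral_powR_itv (e a b : R) : 0 < a -> a < b -> e + 1 != 0 ->
  (\int[mu]_(x in `[a, b]) (x `^ e)%:E =
   ((b `^ (e + 1) - a `^ (e + 1)) / (e + 1))%:E)%E.
Proof.
move=> a0 ab e1.
have dpow (c x : R) : 0 < x -> derivable (fun y : R => y `^ c) x 1.
  by move=> x0; have h := @is_derive1_powR R c x x0; apply: ex_derive.
have b0 := lt_trans a0 ab.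
pose F (x : R) := x `^ (e + 1) * (e + 1)^-1.
have dF x : 0 < x -> derivable F x 1.
  by move=> x0; apply: derivableM; [exact: dpow|exact: derivable_cst].
have cF x : 0 < x -> {for x, continuous F}.
  by move=> x0; apply: differentiable_continuous; apply/derivable1_diffP; exact: dF.
rewrite (@continuous_FTC2 _ _ F)//.
- by rewrite -EFinD -mulrBl.
- apply: derivable_within_continuous => x; rewrite in_itv/= => /andP[ax _].
  by apply: dpow; exact: lt_le_trans ax.
- split.
  + by move=> x; rewrite in_itv/= => /andP[ax _]; apply: dF; exact: lt_trans ax.
  + by apply: cvg_at_right_filter; exact: cF.
  + by apply: cvg_at_left_filter; exact: cF.
- move=> x; rewrite in_itv/= => /andP[ax _]; have x0 := lt_trans a0 ax.
  rewrite derive1E /F; have h := @is_derive1_powR R (e + 1) x x0.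
  have -> : (fun x => x `^ (e + 1) * (e + 1)^-1) = (e + 1)^-1 \*: (fun y : R => y `^ (e + 1)).
    by apply/funext => y /=; rewrite mulrC.
  rewrite deriveZ ?derive_val; last exact: dpow.
  by rewrite /GRing.scale/= mulrA mulVf// mul1r addrK.
Qed.

Lemma ge0_integral_bigcup_le d (T : measurableType d) (m : {measure set T -> \bar R})
    (F : (set T)^nat) (f : T -> \bar R) (C : \bar R) :
  nondecreasing_seq F -> (forall i, measurable (F i)) ->
  measurable_fun setT f -> (forall x, 0 <= f x)%E ->
  (forall i, \int[m]_(x in F i) f x <= C)%E ->
  (\int[m]_(x in \bigcup_i F i) f x <= C)%E.
Proof.
move=> ndF mF mf f0 fC.
have h := @ge0_nondecreasing_set_cvg_integral _ _ _ F f m ndF mF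
  (fun i => measurable_funS measurableT (@subsetT _ _) mf) (fun i x _ => f0 x).
rewrite -(cvg_lim _ h)//; apply: lime_le; first by apply/cvg_ex; eexists; exact: h.
by apply: nearW => i; exact: fC.
Qed.

Lemma measurable_powR_EFin (e : R) : measurable_fun setT (fun x : R => (x `^ e)%:E).
Proof. by apply/measurable_EFinP; exact: measurable_powR. Qed.

Lemma integral_powR01_lty (e : R) : -1 < e ->
  (\int[mu]_(x in `]0%R, 1%R]) (x `^ e)%:E < +oo)%E.
Proof.
move=> e1; have e0 : 0 < e + 1 by lra.
(* The offset 2 keeps the left endpoint strictly below 1, as [integral_powR_itv] requires. *)
pose F (k : nat) := `[k.+2%:R^-1 : R, 1]%classic.
apply: (@le_lt_trans _ _ (e + 1)^-1%:E); last exact: ltry.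
have -> : `]0, 1]%classic = \bigcup_k F k.
  apply/seteqP; split => x /=; last first.
    move=> [k _]; rewrite /F/= !in_itv/= => /andP[h ->]; rewrite andbT.
    by apply: lt_le_trans h; rewrite invr_gt0.
  rewrite in_itv/= => /andP[x0 x1]; exists (Num.truncn x^-1) => //.
  rewrite /F/= in_itv/= x1 andbT invf_ple ?posrE//.
  by apply: (le_trans (ltW (truncnS_gt _))); rewrite ler_nat.
apply: ge0_integral_bigcup_le => //.
- apply/nondecreasing_seqP => k; rewrite subsetEset => x /=.
  rewrite /F/= !in_itv/= => /andP[h ->]; rewrite andbT; apply: le_trans h.
  by rewrite lef_pV2 ?posrE// ler_nat.
- by move=> i; exact: measurable_itv.
- exact: (measurable_powR_EFin e).
- by move=> x; rewrite lee_fin powR_ge0.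
move=> k; rewrite /F integral_powR_itv ?invr_gt0//; last 2 first.
- by rewrite invf_plt ?posrE// invr1 ltr1n.
- exact: lt0r_neq0.
rewrite lee_fin powR1 ler_pdivrMr// mulVf ?lt0r_neq0//.
Qed.

Lemma integral_powR1y_lty (e : R) : e < -1 ->
  (\int[mu]_(x in `[1%R, +oo[) (x `^ e)%:E < +oo)%E.
Proof.
move=> e1; have e0 : e + 1 < 0 by lra.
pose F (k : nat) := `[1 : R, k.+2%:R]%classic.
apply: (@le_lt_trans _ _ (- (e + 1)^-1)%:E); last exact: ltry.
have -> : `[1, +oo[%classic = \bigcup_k F k.
  apply/seteqP; split => x /=; last first.
    by move=> [k _]; rewrite /F/= !in_itv/= => /andP[->].
  rewrite in_itv/= andbT => x1; exists (Num.truncn x) => //.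
  rewrite /F/= in_itv/= x1/=.
  by apply: (le_trans (ltW (truncnS_gt _))); rewrite ler_nat.
apply: ge0_integral_bigcup_le => //.
- apply/nondecreasing_seqP => k; rewrite subsetEset => x /=.
  rewrite /F/= !in_itv/= => /andP[-> h]; apply: le_trans h _.
  by rewrite ler_nat.
- by move=> i; exact: measurable_itv.
- exact: (measurable_powR_EFin e).
- by move=> x; rewrite lee_fin powR_ge0.
move=> k; rewrite /F integral_powR_itv ?ltr1n//; last exact: ltr0_neq0.
rewrite lee_fin powR1 mulrBl mul1r lerBlDr addNr.
by rewrite nmulr_lle0 ?invr_lt0// powR_ge0.
Qed.

(** Evenness folds the line onto the half-line. The point 1 lies in both intervals, whence an
    inequality, which is what finiteness asks for. *)
Lemma ge0_integralT_split (f : R -> \bar R) : measurable_fun setT f ->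
  (forall x, 0 <= f x)%E -> (forall x, f (- x) = f x) ->
  (\int[mu]_x f x <= (\int[mu]_(x in `]0%R, 1%R]) f x + \int[mu]_(x in `[1%R, +oo[) f x) +
     (\int[mu]_(x in `]0%R, 1%R]) f x + \int[mu]_(x in `[1%R, +oo[) f x))%E.
Proof.
move=> mf f0 fN.
have mpos (D : set R) : measurable D -> measurable_fun setT (fun x => (\1_D x)%:E * f x)%E.
  move=> mD; apply: emeasurable_funM => //.
  by apply/measurable_EFinP; exact: measurable_indic.
have ipos (D : set R) : measurable D ->
    (\int[mu]_(x in D) f x = \int[mu]_x ((\1_D x)%:E * f x))%E.
  move=> mD; rewrite integral_mkcond; apply: eq_integral => x _.
  by rewrite patchE indicE; case: ifP; rewrite ?mul1e ?mul0e.
have ind0 (D : set R) x : (0 <= (\1_D x)%:E * f x)%E by rewrite mule_ge0// lee_fin.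
pose g (x : R) := ((\1_(`]0%R, 1%R] : set R) x)%:E * f x + (\1_(`[1%R, +oo[ : set R) x)%:E * f x)%E.
have g0 x : (0 <= g x)%E by rewrite adde_ge0.
have mg : measurable_fun setT g by apply: emeasurable_funD; exact: mpos.
have Ig : (\int[mu]_x g x = \int[mu]_(x in `]0%R, 1%R]) f x + \int[mu]_(x in `[1%R, +oo[) f x)%E.
  rewrite !ipos//; apply: ge0_integralD => //; exact: mpos.
have mgN : measurable_fun setT (fun x : R => g (- x)%R) by exact: measurableT_comp.
rewrite -Ig.
have -> : (\int[mu]_x g x + \int[mu]_x g x = \int[mu]_x (g x + g (- x)%R))%E.
  transitivity (\int[mu]_x g x + \int[mu]_x g (- x)%R)%E.
    by congr (_ + _)%E; rewrite ge0_integral_lebesgue_opp.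
  by apply/esym; apply: ge0_integralD.
(* The two intervals and their reflections miss 0, a null set that is removed first. *)
have -> : (\int[mu]_x f x = \int[mu]_(x in ~` [set 0%R]) f x)%E.
  rewrite -(@integral_setD1 _ f 0%R setT).
  - by rewrite setTD.
  - exact: measurableD.
  - by apply: measurable_funS mf.
rewrite integral_mkcond; apply: ge0_le_integral => //.
- by move=> x _; rewrite patchE; case: ifP.
- have mC : measurable (~` [set 0 : R]) by exact: measurableC.
  exact: ((measurable_restrictT f mC).1 (measurable_funS measurableT (@subsetT _ _) mf)).
- exact: emeasurable_funD.
move=> x _; rewrite patchE; case: ifPn => [|_]; last by rewrite adde_ge0.
rewrite inE/= => /eqP x0.
have pos (y : R) : 0 < y -> (f y <= g y)%E.
  move=> y0; rewrite /g !indicE; have [y1|y1] := leP y 1.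
    rewrite mem_set ?mul1e ?leeDl//; last by rewrite /= in_itv/= y0.
    by rewrite mule_ge0// lee_fin.
  rewrite [X in (_ <= _ + X)%E](_ : _ = f y) ?leeDr//.
    by rewrite mule_ge0// lee_fin.
  by rewrite mem_set ?mul1e//= in_itv/= andbT ltW.
case: (ltrgt0P x) x0 => // x0 _.
  by apply: (le_trans (pos _ x0)); rewrite leeDl.
rewrite -fN; apply: (@le_trans _ _ (g (- x)%R)); last by rewrite leeDr.
by apply: pos; rewrite oppr_gt0.
Qed.

Lemma oneDsqr_gt0 (x : R) : 0 < oneDsqr x.
Proof. exact: lt_le_trans ltr01 (oneDsqr_ge1 x). Qed.

(** The Cauchy density without its factor 1 / pi, hence the powers of [pi] below. *)
Definition cauchy_kernel (x : R) : R := (oneDsqr x)^-1.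

Lemma cauchy_kernel_gt0 x : 0 < cauchy_kernel x.
Proof. by rewrite invr_gt0 oneDsqr_gt0. Qed.

Lemma cauchy_kernelN x : cauchy_kernel (- x) = cauchy_kernel x.
Proof. by rewrite /cauchy_kernel /oneDsqr sqrrN. Qed.

Lemma measurable_cauchy_kernel : measurable_fun setT cauchy_kernel.
Proof. apply: continuous_measurable_fun; exact: continuous_oneDsqrV. Qed.

Definition cauchy_moment (p : R) : \bar R :=
  \int[mu]_x (cauchy_kernel x * `|x| `^ p)%:E.

Lemma measurable_cauchy_moment p :
  measurable_fun setT (fun x => (cauchy_kernel x * `|x| `^ p)%:E).
Proof.
apply/measurable_EFinP/measurable_funM; first exact: measurable_cauchy_kernel.
exact: (measurableT_comp (measurable_powR p) (@normr_measurable R setT)).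
Qed.

(** Near 0 the integrand is at most x^p, integrable because p > -1; at infinity it is at most x^(p -
    2), integrable because p < 1. *)
Lemma cauchy_moment_lty (p : R) : -1 < p < 1 -> (cauchy_moment p < +oo)%E.
Proof.
move=> /andP[p1 p2].
have h0 x : (0 <= (cauchy_kernel x * `|x| `^ p)%:E)%E.
  by rewrite lee_fin mulr_ge0 ?powR_ge0// ltW ?cauchy_kernel_gt0.
apply: le_lt_trans (ge0_integralT_split (measurable_cauchy_moment p) h0 _) _.
  by move=> x; rewrite cauchy_kernelN normrN.
set I1 := (\int[mu]_(x in `]0%R, 1%R]) _)%E; set I2 := (\int[mu]_(x in `[1%R, +oo[) _)%E.
have i1 : (I1 < +oo)%E.
  apply: le_lt_trans (integral_powR01_lty p1).
  apply: ge0_le_integral => //.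
  - exact: measurable_funTS (measurable_cauchy_moment p).
  - exact: measurable_funTS (measurable_powR_EFin p).
  move=> x; rewrite /= in_itv/= => /andP[x0 _]; rewrite lee_fin gtr0_norm//.
  by rewrite ler_piMl ?powR_ge0// invf_le1 ?oneDsqr_gt0 ?oneDsqr_ge1.
have i2 : (I2 < +oo)%E.
  have e : p - 2 < -1 by lra.
  apply: le_lt_trans (integral_powR1y_lty e).
  apply: ge0_le_integral => //.
  - exact: measurable_funTS (measurable_cauchy_moment p).
  - exact: measurable_funTS (measurable_powR_EFin _).
  move=> x; rewrite /= in_itv/= andbT => x1; have x0 : 0 < x by lra.
  rewrite lee_fin gtr0_norm// powRD; last by apply/implyP => _; rewrite gt_eqF.
  rewrite mulrC ler_wpM2l ?powR_ge0// powRN lef_pV2 ?posrE ?powR_gt0 ?oneDsqr_gt0//.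
  by rewrite (powR_mulrn _ (ltW x0)) lerDr.
by apply: lte_add_pinfty; apply: lte_add_pinfty.
Qed.

Lemma cauchy_moment_gt0 (p : R) : (0 < cauchy_moment p)%E.
Proof.
have h0 x : (0 <= (cauchy_kernel x * `|x| `^ p)%:E)%E.
  by rewrite lee_fin mulr_ge0 ?powR_ge0// ltW ?cauchy_kernel_gt0.
(* On [1, 2] the kernel is at least 1 / (1 + 2^2) and x^p at least the smaller of its endpoint
   values. *)
pose c := 5^-1 * Num.min 1 (2 `^ p) : R.
have c0 : 0 < c by rewrite mulr_gt0 ?invr_gt0// lt_min ltr01 powR_gt0.
apply: (@lt_le_trans _ _ (\int[mu]_(x in `[1%R, 2%R]) (cst c%:E x))%E).
  rewrite integral_cst//= lebesgue_measure_itv/= lte_fin ltr1n.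
  by rewrite -EFinD -EFinM lte_fin mulr_gt0//; lra.
rewrite /cauchy_moment.
apply: (@le_trans _ _ (\int[mu]_(x in `[1%R, 2%R]) (cauchy_kernel x * `|x| `^ p)%:E)%E).
  apply: ge0_le_integral => //.
  - by move=> x _; rewrite lee_fin ltW.
  - exact: measurable_funTS (measurable_cauchy_moment p).
  move=> x; rewrite /= in_itv/= => /andP[x1 x2]; have x0 : 0 < x by lra.
  rewrite lee_fin gtr0_norm//; apply: ler_pM => //.
  - rewrite lef_pV2 ?posrE ?oneDsqr_gt0// /oneDsqr; nra.
  - have [p0|p0] := leP 0 p.
      rewrite ge_min; apply/orP; left; rewrite -(powRr0 x) ler_powR//.
    rewrite ge_min; apply/orP; right.
    rewrite -[p]opprK powRN [leRHS]powRN lef_pV2 ?posrE ?powR_gt0//.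
    by apply: ge0_ler_powR; rewrite ?nnegrE ?oppr_ge0 ?(ltW p0) ?(ltW x0).
by apply: ge0_subset_integral => //; exact: measurable_cauchy_moment.
Qed.

End power_integrals.

(** * Convolution of two Cauchy densities *)

Section cauchy_stability.
Context {R : realType}.
Local Notation mu := (@lebesgue_measure R).

Lemma ge0_integralT_half (f : R -> \bar R) : measurable_fun setT f ->
  (forall x, 0 <= f x)%E ->
  (\int[mu]_x f x =
   \int[mu]_(x in `[0%R, +oo[) f (- x)%R + \int[mu]_(x in `[0%R, +oo[) f x)%E.
Proof.
move=> mf f0.
have mfN : measurable_fun setT (fun x : R => f (- x)%R) by exact: measurableT_comp.
rewrite -[X in (_ + X)%E]integral_itv_obnd_cbnd; last exact: measurable_funTS.
rewrite ge0_integration_by_substitution0//.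
under [X in (X + _)%E]eq_integral do rewrite opprK.
have e : setT = `]-oo, 0%R] `|` `]0%R, +oo[ :> set R.
  apply/seteqP; split => x //= _; rewrite !in_itv/= andbT.
  by case: (leP x 0); [left|right].
rewrite [in LHS]e ge0_integral_setU//.
- by rewrite -e.
- rewrite disj_set2E; apply/eqP/seteqP; split => x //=; rewrite !in_itv/= andbT.
  by case => x0; rewrite ltNge x0.
Qed.

Lemma integral_cauchy_kernel : (\int[mu]_x (cauchy_kernel x)%:E = pi%:E)%E.
Proof.
have mk : measurable_fun setT (fun x : R => (cauchy_kernel x)%:E).
  by apply/measurable_EFinP; exact: measurable_cauchy_kernel.
rewrite ge0_integralT_half//; last by move=> x; rewrite lee_fin ltW ?cauchy_kernel_gt0.
under [X in (X + _)%E]eq_integral do rewrite cauchy_kernelN.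
by rewrite integral0y_oneDsqr -EFinD -splitr.
Qed.

Section convolution.
Variables a b : R.
Hypotheses (a0 : 0 < a) (b0 : 0 < b).

Let q (z s : R) := b ^+ 2 + (a * s - z) ^+ 2.

Let q_gt0 z s : 0 < q z s.
Proof. by rewrite ltr_wpDr ?sqr_ge0// exprn_gt0. Qed.

Let g (z s : R) := b / ((1 + s ^+ 2) * q z s).

Let one_sqr_gt0 (s : R) : 0 < 1 + s ^+ 2.
Proof. by rewrite ltr_wpDr ?sqr_ge0. Qed.

Let affine_cvgy z : (a * s - z) / b @[s --> +oo] --> +oo.
Proof.
apply/cvgryPge => M; near=> s.
rewrite ler_pdivlMr// lerBrDr (mulrC a) -ler_pdivrMr//.
Unshelve. all: by end_near. Qed.

Let inv_cvg0 : s^-1 @[s --> (+oo : set_system R)] --> (0 : R).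
Proof.
apply/cvgr0Pnorm_lt => e e0; near=> s.
have s1 : e^-1 < s by near: s; apply: nbhs_pinfty_gt; exact: num_real.
have s0 : 0 < s by apply: lt_trans s1; rewrite invr_gt0.
by rewrite gtr0_norm ?invr_gt0// invf_plt ?posrE.
Unshelve. all: by end_near. Qed.

Let log_cvg z :
  ln (1 + s ^+ 2) - ln (q z s) @[s --> +oo] --> ln (a ^- 2).
Proof.
(* The ratio of the two quadratics in the variable w = 1 / s, continuous at w = 0. *)
pose phi (w : R) := (w ^+ 2 + 1) / ((b * w) ^+ 2 + (a - z * w) ^+ 2).
have d0 : (b * 0) ^+ 2 + (a - z * 0) ^+ 2 != 0.
  by rewrite !mulr0 subr0 expr0n add0r expf_neq0// gt_eqF.
have phi0 : phi 0 = a ^- 2.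
  by rewrite /phi !mulr0 subr0 expr0n !add0r mul1r.
have cphi : {for 0, continuous phi}.
  apply: cvgM.
    by apply: cvgD; [apply: cvgM; exact: cvg_id|exact: cvg_cst].
  apply: cvgV => //; apply: cvgD.
    by apply: cvgM; apply: cvgM; [exact: cvg_cst|exact: cvg_id|exact: cvg_cst|exact: cvg_id].
  by apply: cvgM; apply: cvgB; [exact: cvg_cst|apply: cvgM; [exact: cvg_cst|exact: cvg_id]|exact: cvg_cst|apply: cvgM; [exact: cvg_cst|exact: cvg_id]].
have c1 : phi s^-1 @[s --> (+oo : set_system R)] --> phi 0.
  exact: (@cvg_comp _ _ _ (fun s : R => s^-1) phi _ _ _ inv_cvg0 cphi).
have c2 : ln (phi s^-1) @[s --> (+oo : set_system R)] --> ln (a ^- 2).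
  apply: (@cvg_comp _ _ _ (fun s : R => phi s^-1) (@ln R) _ _ _ c1).
  rewrite phi0; apply: continuous_ln.
  by rewrite invr_gt0 exprn_gt0.
apply: cvg_trans c2; apply: near_eq_cvg; near=> s.
have s0 : 0 < s by near: s; apply: nbhs_pinfty_gt; exact: num_real.
rewrite -ln_div ?posrE//; congr ln; rewrite /phi /q.
have q0 := q_gt0 z s; rewrite /q in q0.
field; rewrite gt_eqF//= gt_eqF//.
Unshelve. all: by end_near. Qed.

Let continuous_q z : continuous (q z).
Proof.
move=> s; apply: cvgD; first exact: cvg_cst.
by apply: cvgM; (apply: cvgB; [apply: cvgM; [exact: cvg_cst|exact: cvg_id]|exact: cvg_cst]).
Qed.

Let continuous_g z : continuous (g z).
Proof.
move=> s; apply: cvgM; first exact: cvg_cst.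
apply: cvgV; first by rewrite mulf_neq0// gt_eqF.
apply: cvgM; last exact: continuous_q.
by apply: cvgD; [exact: cvg_cst|apply: cvgM; exact: cvg_id].
Qed.

Let D (z : R) := (z ^+ 2 + (a + b) ^+ 2) * (z ^+ 2 + (a - b) ^+ 2).
Let cA z := b * (b ^+ 2 + z ^+ 2 - a ^+ 2) / D z.
Let cB z := a * (z ^+ 2 + a ^+ 2 - b ^+ 2) / D z.
Let cC z := a * b * z / D z.

Let D_gt0 (z : R) : z != 0 -> 0 < D z.
Proof.
move=> z0; have zz : 0 < z ^+ 2 by rewrite lt_neqAle sqr_ge0 eq_sym expf_neq0.
by rewrite mulr_gt0// ltr_wpDr ?sqr_ge0.
Qed.

(* The antiderivative given by the partial fraction decomposition of g z. *)
Let G z (s : R) := cA z * atan s + cB z * atan ((a * s - z) / b) +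
  cC z * (ln (1 + s ^+ 2) - ln (q z s)).

Let dG (z s : R) : z != 0 -> is_derive s 1 (G z) (g z s).
Proof.
move=> z0.
have d1 := is_derive1_atan s.
have d2 : is_derive s 1 (fun s : R => (a * s - z) / b) (a / b).
  apply: is_derive_eq; rewrite /GRing.scale/=.
  ring.
have d3 := @is_derive1_comp R atan (fun s : R => (a * s - z) / b) s _ _ (is_derive1_atan ((a * s - z) / b)) d2.
have d4 : is_derive s 1 (fun s : R => 1 + s ^+ 2) (2 * s).
  by apply: is_derive_eq; rewrite /GRing.scale/= ?add0r; ring.
have d5 := @is_derive1_comp R (@ln R) (fun s : R => 1 + s ^+ 2) s _ _ (is_derive1_ln (one_sqr_gt0 s)) d4.
have d6 : is_derive s 1 (q z) (2 * a * (a * s - z)).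
  by rewrite /q; apply: is_derive_eq; rewrite /GRing.scale/= ?add0r; ring.
have d7 := @is_derive1_comp R (@ln R) (q z) s _ _ (is_derive1_ln (q_gt0 z s)) d6.
have e : G z = cA z \*: atan + cB z \*: (atan \o (fun s : R => (a * s - z) / b)) +
    cC z \*: ((@ln R \o (fun s : R => 1 + s ^+ 2)) - (@ln R \o q z)).
  by apply/funext => y; rewrite /G !fctE.
rewrite e; apply: is_derive_eq; rewrite /GRing.scale/=.
have z2 := D_gt0 z0; have qz := q_gt0 z s; have s2 := one_sqr_gt0 s.
rewrite /cA /cB /cC /g.
have -> : (1 + ((a * s - z) / b) ^+ 2)^-1 = b ^+ 2 / q z s.
  rewrite /q; field; rewrite gt_eqF//= -/(q z s) gt_eqF//=.
move: z2 qz s2; rewrite /D /q => z2 qz s2.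
have zz : 0 < z ^+ 2 by rewrite lt_neqAle sqr_ge0 eq_sym expf_neq0.
by field; rewrite !gt_eqF//= ltr_wpDr ?sqr_ge0.
Qed.

Let half (z : R) : z != 0 -> (\int[mu]_(s in `[0%R, +oo[) (g z s)%:E =
  ((cA z + cB z) * (pi / 2) + cC z * ln (a ^- 2) +
   cB z * atan (z / b) + cC z * ln (b ^+ 2 + z ^+ 2))%:E)%E.
Proof.
move=> z0.
have g0 s : 0 <= g z s by rewrite divr_ge0 ?mulr_ge0 ?ltW.
have cG : G z s @[s --> +oo] --> (cA z + cB z) * (pi / 2) + cC z * ln (a ^- 2).
  rewrite mulrDl; apply: cvgD; last by apply: cvgM; [exact: cvg_cst|exact: log_cvg].
  apply: cvgD; (apply: cvgM; first exact: cvg_cst); first exact: cvgy_atan.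
  move/cvgrPdist_lt: (@cvgy_atan R) => k; apply/cvgrPdist_lt => e e0.
  exact: (affine_cvgy z (k e e0)).
have e1 := @ge0_continuous_FTC2y R (g z) (G z) 0 _ (fun s _ => g0 s) _ cG.
rewrite e1; clear e1.
- have -> : G z 0 = - (cB z * atan (z / b)) - cC z * ln (b ^+ 2 + z ^+ 2).
    by rewrite /G /q atan0 !mulr0 sub0r mulNr atanN sqrrN expr0n/= addr0 ln1; ring.
  by rewrite -EFinD; congr EFin; ring.
- by apply: continuous_subspaceT; exact: continuous_g.
- by move=> s _; have h := dG s z0; apply: ex_derive.
- apply: cvg_at_right_filter; apply: differentiable_continuous.
  by apply/derivable1_diffP; have h := dG 0 z0; apply: ex_derive.
- by move=> s _; rewrite derive1E; have h := dG s z0; rewrite derive_val.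
Qed.

(** The two half-lines give [half] at z and at -z. The terms with logarithms and with atan (z / b)
    are odd in z and cancel, leaving pi (cA + cB). At z = 0 the denominator [D] vanishes if a =
    b. *)
Lemma cauchy_convolution (z : R) : z != 0 ->
  (\int[mu]_s (cauchy_kernel s * (b^-1 * cauchy_kernel ((z - a * s) / b)))%:E =
   (pi * ((a + b)^-1 * cauchy_kernel (z / (a + b))))%:E)%E.
Proof.
move=> z0; have ab0 : 0 < a + b by exact: addr_gt0.
have gE s : cauchy_kernel s * (b^-1 * cauchy_kernel ((z - a * s) / b)) = g z s.
  rewrite /cauchy_kernel /oneDsqr /g /q.
  have s2 := one_sqr_gt0 s; have qz := q_gt0 z s; rewrite /q in qz.
  field; rewrite !gt_eqF//=.
have gN s : g z (- s) = g (- z) s.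
  by rewrite /g /q sqrrN mulrN -opprD sqrrN opprK.
under eq_integral do rewrite gE.
rewrite ge0_integralT_half; last 2 first.
- by apply/measurable_EFinP; apply: continuous_measurable_fun; exact: continuous_g.
- by move=> s; rewrite lee_fin divr_ge0 ?mulr_ge0 ?ltW.
under [X in (X + _)%E]eq_integral do rewrite gN.
rewrite !half ?oppr_eq0// -EFinD; congr EFin.
rewrite /cA /cB /cC /D /cauchy_kernel /oneDsqr !sqrrN mulNr atanN.
have z2 := D_gt0 z0; rewrite /D in z2.
have zz : 0 < z ^+ 2 by rewrite lt_neqAle sqr_ge0 eq_sym expf_neq0.
move: (ln _) (ln _) (atan _) => l1 l2 t.
field; rewrite ?gt_eqF//=; first by rewrite ltr_wpDr ?sqr_ge0.
by rewrite ltr_wpDl ?sqr_ge0.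
Qed.

End convolution.

End cauchy_stability.

(** * Linear forms in independent Cauchy variables *)

Section cauchy_mean.
Context {R : realType}.
Local Notation mu := (@lebesgue_measure R).
Local Notation leb := (lebesgue_rV R).
Implicit Types (h : R -> \bar R) (a b c : R).

Let kernel_ge0 (x : R) : (0 <= (cauchy_kernel x)%:E)%E.
Proof. by rewrite lee_fin ltW ?cauchy_kernel_gt0. Qed.

Let mkernel d (T : measurableType d) (f : T -> R) : measurable_fun setT f ->
  measurable_fun setT (fun x => (cauchy_kernel (f x))%:E).
Proof.
move=> mf; apply/measurable_EFinP.
exact: (measurableT_comp measurable_cauchy_kernel mf).
Qed.

Let maff d (T : measurableType d) (f g : T -> R) c b : measurable_fun setT f ->
  measurable_fun setT g -> measurable_fun setT (fun x => (c * f x + b * g x)%R).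
Proof. by move=> mf mg; apply: measurable_funD; exact: measurable_funM. Qed.

(** pi times the expectation of h(a X) for a Cauchy variable X. *)
Definition cauchy_mean h a : \bar R :=
  (\int[mu]_t ((cauchy_kernel t)%:E * h (a * t)%R))%E.

Lemma cauchy_mean_ge0 h a : (forall x, 0 <= h x)%E -> (0 <= cauchy_mean h a)%E.
Proof. by move=> h0; apply: integral_ge0 => x _; exact: mule_ge0. Qed.

Lemma cauchy_mean_norm h a : measurable_fun setT h -> (forall x, 0 <= h x)%E ->
  cauchy_mean h `|a| = cauchy_mean h a.
Proof.
move=> mh h0; have [//|a0] := ger0P a.
rewrite /cauchy_mean -ge0_integral_lebesgue_opp.
- by apply: eq_integral => t _; rewrite cauchy_kernelN mulrNN.
- apply: emeasurable_funM; first exact: mkernel.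
  by apply: (measurableT_comp mh); exact: measurable_funM.
- by move=> x; exact: mule_ge0.
Qed.

Lemma cauchy_mean0 h : (forall x, 0 <= h x)%E -> cauchy_mean h 0 = (pi%:E * h 0%R)%E.
Proof.
move=> h0; rewrite /cauchy_mean -integral_cauchy_kernel -ge0_integralZr//.
- by apply: eq_integral => t _; rewrite mul0r.
- exact: mkernel.
Qed.

Let density_change h b c : 0 < b -> measurable_fun setT h ->
  (forall x, 0 <= h x)%E -> cauchy_mean (fun x => h (c + x)%R) b =
  (\int[mu]_z ((b^-1 * cauchy_kernel ((z - c) / b))%:E * h z))%E.
Proof.
move=> b0 mh h0; pose phi z := ((cauchy_kernel (z / b))%:E * h (c + z)%R)%E.
pose psi z := ((cauchy_kernel ((z - c) / b))%:E * h z)%E.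
have phi0 z : (0 <= phi z)%E by exact: mule_ge0.
have psi0 z : (0 <= psi z)%E by exact: mule_ge0.
have mphi : measurable_fun setT phi.
  apply: emeasurable_funM; first by apply: mkernel; exact: measurable_funM.
  by apply: (measurableT_comp mh); exact: measurable_funD.
have mpsi : measurable_fun setT psi.
  apply: emeasurable_funM => //; apply: mkernel; apply: measurable_funM => //.
  exact: measurable_funD.
transitivity (\int[mu]_t phi (b * t)%R)%E.
  apply: eq_integral => t _; rewrite /phi; congr ((cauchy_kernel _)%:E * _)%E.
  by rewrite mulrAC mulfV ?mul1r// gt_eqF.
rewrite ge0_integral_lebesgue_mull_gt0//.
have -> : (\int[mu]_z phi z = \int[mu]_z psi z)%E.
  rewrite -(@ge0_integral_lebesgue_addr _ psi c)//.
  by apply: eq_integral => z _; rewrite /psi addrK addrC.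
transitivity (\int[mu]_z ((b^-1)%:E * psi z))%E.
  apply/esym; apply: (@ge0_integralZl_EFin _ _ _ mu setT measurableT psi) => //.
  by rewrite invr_ge0 ltW.
by apply: eq_integral => z _; rewrite /psi muleA -EFinM.
Qed.

Let stable_gt0 h a b : 0 < a -> 0 < b -> measurable_fun setT h ->
  (forall x, 0 <= h x)%E ->
  (\int[mu]_s ((cauchy_kernel s)%:E * cauchy_mean (fun x => h (a * s + x)%R) b) =
   pi%:E * cauchy_mean h (a + b))%E.
Proof.
move=> a0 b0 mh h0; have ab0 : 0 < a + b by exact: addr_gt0.
pose w s z := cauchy_kernel s * (b^-1 * cauchy_kernel ((z - a * s) / b)).
have w0 s z : 0 <= w s z.
  by rewrite !mulr_ge0 ?invr_ge0 ?(ltW b0) ?(ltW (cauchy_kernel_gt0 _)).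
pose H (p : measurableTypeR R * measurableTypeR R) := ((w p.1 p.2)%:E * h p.2)%E.
have mw d (T : measurableType d) (f g : T -> R) : measurable_fun setT f ->
    measurable_fun setT g -> measurable_fun setT (fun x => (w (f x) (g x))%:E).
  move=> mf mg; apply/measurable_EFinP/measurable_funM.
    exact: (measurableT_comp measurable_cauchy_kernel mf).
  apply: measurable_funM => //; apply: (measurableT_comp measurable_cauchy_kernel).
  by apply: measurable_funM => //; apply: measurable_funB => //; exact: measurable_funM.
have H0 p : (0 <= H p)%E by rewrite mule_ge0 ?lee_fin.
have mH : measurable_fun setT H.
  by apply: emeasurable_funM; [exact: mw|exact: (measurableT_comp mh)].
transitivity (\int[mu]_s \int[mu]_z H (s, z))%E.
  apply: eq_integral => s _; rewrite density_change//.
  transitivity (\int[mu]_z ((cauchy_kernel s)%:E *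
      ((b^-1 * cauchy_kernel ((z - a * s) / b))%:E * h z)))%E.
    apply/esym; apply: ge0_integralZl_EFin => //.
    - by move=> z _; rewrite mule_ge0// lee_fin mulr_ge0 ?invr_ge0 ?(ltW b0) ?(ltW (cauchy_kernel_gt0 _)).
    - apply: emeasurable_funM => //; apply/measurable_EFinP/measurable_funM => //.
      apply: (measurableT_comp measurable_cauchy_kernel).
      by apply: measurable_funM => //; exact: measurable_funB.
    - by rewrite ltW ?cauchy_kernel_gt0.
  by apply: eq_integral => z _; rewrite muleA -EFinM.
transitivity (\int[mu]_z \int[mu]_s H (s, z))%E; first exact: (fubini_tonelli H).
pose d z : \bar R := (((a + b)^-1 * cauchy_kernel (z / (a + b)))%:E * h z)%E.
have d0 z : (0 <= d z)%E.
  by rewrite mule_ge0 ?lee_fin ?mulr_ge0 ?invr_ge0 ?(ltW ab0) ?(ltW (cauchy_kernel_gt0 _)).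
have md : measurable_fun setT d.
  apply: emeasurable_funM => //; apply/measurable_EFinP/measurable_funM => //.
  apply: (measurableT_comp measurable_cauchy_kernel).
  exact: measurable_funM.
have -> : cauchy_mean h (a + b) = (\int[mu]_z d z)%E.
  transitivity (cauchy_mean (fun x => h (0 + x)%R) (a + b)).
    by congr (cauchy_mean _ _); apply/funext => x; rewrite add0r.
  rewrite density_change//.
  by apply: eq_integral => z _; rewrite subr0.
have -> : (pi%:E * \int[mu]_z d z = \int[mu]_z (pi%:E * d z))%E.
  apply/esym; apply: (@ge0_integralZl_EFin _ _ _ mu setT measurableT d) => //.
  exact: pi_ge0.
(* The convolution formula excludes z = 0, which is a null set. *)
have mD : measurable (setT `\ (0 : R)) by exact: measurableD.
have mG : measurable_fun setT (fun z => \int[mu]_s H (s, z))%E.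
  exact: (measurable_fun_fubini_tonelli_G H).
rewrite -(@integral_setD1 _ _ 0%R setT)//; last exact: measurable_funTS.
rewrite -[RHS](@integral_setD1 _ _ 0%R setT)//; last first.
  by apply: measurable_funTS; exact: measurable_funeM.
apply: eq_integral => z; rewrite inE/= => -[_ /eqP z0].
transitivity ((\int[mu]_s (w s z)%:E) * h z)%E.
  transitivity (\int[mu]_s ((w s z)%:E * h z))%E; first by apply: eq_integral.
  apply: (@ge0_integralZr _ _ _ mu setT measurableT (fun s => (w s z)%:E)) => //; first exact: mw.
  by move=> s _; rewrite lee_fin.
by rewrite cauchy_convolution// /d EFinM muleA.
Qed.

(* The Cauchy law is strictly 1-stable. *)
Lemma cauchy_mean_stable h a b : measurable_fun setT h -> (forall x, 0 <= h x)%E ->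
  (\int[mu]_s ((cauchy_kernel s)%:E * cauchy_mean (fun x => h (a * s + x)%R) b) =
   pi%:E * cauchy_mean h (`|a| + `|b|))%E.
Proof.
move=> mh h0.
pose I a := (\int[mu]_s ((cauchy_kernel s)%:E * cauchy_mean (fun x => h (a * s + x)%R) `|b|))%E.
have mhc c : measurable_fun setT (fun x : R => h (c + x)%R).
  by apply: (measurableT_comp mh); exact: measurable_funD.
have mM a' : measurable_fun setT (fun s : R => cauchy_mean (fun x => h (a' * s + x)%R) `|b|).
  pose P (p : measurableTypeR R * measurableTypeR R) := ((cauchy_kernel p.2)%:E * h (a' * p.1 + `|b| * p.2)%R)%E.
  apply: (measurable_fun_fubini_tonelli_F P).
    apply: emeasurable_funM; first exact: mkernel.
    by apply: (measurableT_comp mh); exact: maff.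
  by move=> p; exact: mule_ge0.
have IN a' : I (- a') = I a'.
  rewrite /I -[RHS]ge0_integral_lebesgue_opp.
  - by apply: eq_integral => s _; rewrite cauchy_kernelN mulrN mulNr.
  - by apply: emeasurable_funM; [exact: mkernel|exact: mM].
  - by move=> s; rewrite mule_ge0// cauchy_mean_ge0.
transitivity (I a).
  by apply: eq_integral => s _; rewrite cauchy_mean_norm.
have IE : I a = I `|a|.
  have [a0|a0] := leP 0 a; first by rewrite (ger0_norm a0).
  by rewrite (ltr0_norm a0); exact: esym (IN a).
rewrite IE {IE}.
rewrite /I; have := normr_ge0 a; have := normr_ge0 b.
move: `|a| `|b| mM {IN I} => {}a {}b mM.
(* A zero scale is a point mass without density, so it is treated apart from the convolution. *)
rewrite le_eqVlt => /predU1P[<-|b0].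
  move=> a0; rewrite addr0 /cauchy_mean.
  rewrite -ge0_integralZl_EFin//; last 3 first.
  - by move=> t _; exact: mule_ge0.
  - apply: emeasurable_funM; first exact: mkernel.
    by apply: (measurableT_comp mh); exact: measurable_funM.
  - exact: pi_ge0.
  apply: eq_integral => s _.
  rewrite -/(cauchy_mean (fun x => h (a * s + x)%R) 0) cauchy_mean0// addr0.
  by rewrite muleCA.
rewrite le_eqVlt => /predU1P[<-|a0]; last exact: stable_gt0.
have Cb0 := cauchy_mean_ge0 b h0.
rewrite add0r.
transitivity (\int[mu]_s ((cauchy_kernel s)%:E * cauchy_mean h b))%E.
  apply: eq_integral => s _; congr (_ * _)%E; congr (cauchy_mean _ _).
  by apply/funext => x; rewrite mul0r add0r.
rewrite -integral_cauchy_kernel.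
apply: (@ge0_integralZr _ _ _ mu setT measurableT (fun s => (cauchy_kernel s)%:E)) => //.
exact: mkernel.
Qed.

Definition cauchy_density m (y : 'rV[R]_m) : R := \prod_i cauchy_kernel (y 0 i).

Lemma cauchy_density_gt0 m (y : 'rV[R]_m) : 0 < cauchy_density y.
Proof. by apply: prodr_gt0 => i _; exact: cauchy_kernel_gt0. Qed.

Lemma measurable_cauchy_density m : measurable_fun setT (@cauchy_density m).
Proof.
apply: measurable_prod => i _.
exact: (measurableT_comp measurable_cauchy_kernel (measurable_rV_coord i)).
Qed.

Lemma cauchy_density_cons m (t : R) (y : 'rV[R]_m) :
  cauchy_density (rV_cons (t, y)) = cauchy_kernel t * cauchy_density y.
Proof.
rewrite /cauchy_density big_ord_recl rV_cons0; congr (_ * _).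
by apply: eq_bigr => i _; rewrite rV_consS.
Qed.

(** By induction: stability merges the first variable with the combination of the others. The factor
    pi on the left balances the one unnormalised kernel inside [cauchy_mean]. *)
Lemma cauchy_mean_rV m (beta : 'rV[R]_m) h :
  measurable_fun setT h -> (forall x, 0 <= h x)%E ->
  (pi%:E * \int[leb m]_y ((cauchy_density y)%:E * h (dot beta y)) =
   (pi ^+ m)%:E * cauchy_mean h (\sum_i `|beta 0 i|))%E.
Proof.
elim: m => [|m IH] in beta h *.
  move=> mh h0; rewrite ge0_integral_rV0.
    by rewrite /cauchy_density !big_ord0 dotE big_ord0 cauchy_mean0// expr0 !mul1e.
  apply: emeasurable_funM; first by apply/measurable_EFinP; exact: measurable_cauchy_density.
  by apply: (measurableT_comp mh); exact: measurable_dot.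
move=> mh h0; have pi0 := @pi_ge0 R.
have [b [beta' ->]] := rV_consP beta.
rewrite big_ord_recl rV_cons0.
under eq_bigr do rewrite rV_consS.
set S := \sum_i _; have S0 : 0 <= S by exact: sumr_ge0.
have mdens k : measurable_fun setT (fun y : 'rV[R]_k => (cauchy_density y)%:E).
  by apply/measurable_EFinP; exact: measurable_cauchy_density.
have dens0 k (y : 'rV[R]_k) : (0 <= (cauchy_density y)%:E)%E.
  by rewrite lee_fin ltW ?cauchy_density_gt0.
have mhdot k (c : 'rV[R]_k) (h' : R -> \bar R) : measurable_fun setT h' ->
    measurable_fun setT (fun y : 'rV[R]_k => ((cauchy_density y)%:E * h' (dot c y))%E).
  move=> mh'; apply: emeasurable_funM; first exact: mdens.
  by apply: (measurableT_comp mh'); exact: measurable_dot.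
have mhb t : measurable_fun setT (fun x : R => h (b * t + x)%R).
  by apply: (measurableT_comp mh); exact: measurable_funD.
rewrite (@ge0_integral_rV_cons _ _ (fun y => ((cauchy_density y)%:E * h (dot (rV_cons (b, beta')) y))%E)); last 2 first.
- exact: mhdot.
- by move=> y; exact: mule_ge0.
pose T t := (\int[leb m]_y ((cauchy_density y)%:E * h (b * t + dot beta' y)%R))%E.
have T0 t : (0 <= T t)%E by apply: integral_ge0 => y _; exact: mule_ge0.
have mT : measurable_fun setT T.
  pose P (p : measurableTypeR R * 'rV[R]_m) := ((cauchy_density p.2)%:E * h (b * p.1 + dot beta' p.2)%R)%E.
  apply: (measurable_fun_fubini_tonelli_F P); last by move=> p; exact: mule_ge0.
  apply: emeasurable_funM; first exact: (measurableT_comp (mdens m)).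
  apply: (measurableT_comp mh); apply: measurable_funD; first exact: measurable_funM.
  exact: measurable_dot.
transitivity (pi%:E * \int[mu]_t ((cauchy_kernel t)%:E * T t))%E.
  congr (_ * _)%E; apply: eq_integral => t _.
  rewrite /T -ge0_integralZl//.
  - apply: eq_integral => y _.
    by rewrite cauchy_density_cons dot_rV_cons EFinM muleA.
  - by apply: (mhdot m beta' (fun x => h (b * t + x)%R)).
  - by move=> y _; exact: mule_ge0.
transitivity (\int[mu]_t ((pi ^+ m)%:E * ((cauchy_kernel t)%:E *
    cauchy_mean (fun x => h (b * t + x)%R) S)))%E.
  rewrite -ge0_integralZl_EFin//; last 2 first.
  - by move=> t _; exact: mule_ge0.
  - by apply: emeasurable_funM => //; exact: mkernel.
  apply: eq_integral => t _.
  by rewrite muleCA (IH beta' (fun x => h (b * t + x)%R))// muleCA.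
rewrite ge0_integralZl_EFin ?exprn_ge0//; last 2 first.
- by move=> t _; rewrite mule_ge0// cauchy_mean_ge0.
- apply: emeasurable_funM; first exact: mkernel.
  pose P (p : measurableTypeR R * measurableTypeR R) := ((cauchy_kernel p.2)%:E * h (b * p.1 + S * p.2)%R)%E.
  apply: (measurable_fun_fubini_tonelli_F P); last by move=> p; exact: mule_ge0.
  apply: emeasurable_funM; first exact: mkernel.
  by apply: (measurableT_comp mh); exact: maff.
by rewrite cauchy_mean_stable// (ger0_norm S0) muleA -EFinM exprSr.
Qed.

Lemma cauchy_mean_powR (p : R) (a : R) : p != 0 -> 0 <= a ->
  (cauchy_mean (fun x => (`|x| `^ p)%:E) a = (a `^ p)%:E * cauchy_moment p)%E.
Proof.
move=> p0 a0; rewrite /cauchy_moment -ge0_integralZl_EFin//; last 3 first.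
- by move=> x _; rewrite lee_fin mulr_ge0 ?powR_ge0// ltW ?cauchy_kernel_gt0.
- exact: measurable_cauchy_moment.
- exact: powR_ge0.
apply: eq_integral => t _; rewrite -!EFinM; congr EFin.
by rewrite normrM powRM// (ger0_norm a0) mulrCA.
Qed.

(** A linear form in Cauchy variables is a Cauchy variable scaled by the l_1 norm of its
    coefficients. So [c] is the Cauchy moment up to powers of pi, positive and finite in this range
    of p. *)
Lemma cauchy_density_powR m (p : R) : -1 < p < 1 -> p != 0 ->
  exists2 c : R, 0 < c & forall beta : 'rV[R]_m,
  (\int[leb m]_y (cauchy_density y * `|dot beta y| `^ p)%:E =
   (c * (\sum_i `|beta 0 i|) `^ p)%:E)%E.
Proof.
move=> p1 p0; have pi0 := @pi_gt0 R.
have c0 := cauchy_moment_gt0 p; have coo := cauchy_moment_lty p1.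
have cf : cauchy_moment p \is a fin_num by rewrite ge0_fin_numE// ltW.
exists (pi^-1 * pi ^+ m * fine (cauchy_moment p)).
  by rewrite !mulr_gt0 ?invr_gt0 ?exprn_gt0// fine_gt0// c0.
move=> beta; have := @cauchy_mean_rV m beta (fun x => (`|x| `^ p)%:E) _ _.
have mh : measurable_fun setT (fun x : R => (`|x| `^ p)%:E).
  by apply/measurable_EFinP; exact: (measurableT_comp (measurable_powR p) (@normr_measurable R setT)).
move=> /(_ mh) h; have {h} := h (fun x => _); rewrite cauchy_mean_powR ?sumr_ge0// => h.
have {}h := h (fun x => powR_ge0 _ _).
transitivity ((pi^-1)%:E * (pi%:E * \int[leb m]_y ((cauchy_density y)%:E * (`|dot beta y| `^ p)%:E)))%E.
  by rewrite muleA -EFinM mulVf ?gt_eqF// mul1e.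
rewrite h -[in LHS](fineK cf) -!EFinM; congr EFin; ring.
Qed.

End cauchy_mean.

(** * Norms on the plane *)

Section planar_norm.
Context {R : realType}.

(** Definiteness is put as a uniform lower bound, so that constants are available without a
    compactness argument. *)
Definition planar_norm (N : R -> R -> R) : Prop :=
  [/\ forall c s t, N (c * s) (c * t) = `|c| * N s t,
      forall s t s' t', N (s + s') (t + t') <= N s t + N s' t' &
      exists2 alpha : R, 0 < alpha & forall s t, alpha * (`|s| + `|t|) <= N s t].

Variables (N : R -> R -> R) (nN : planar_norm N).

Lemma planar_normZ c s t : N (c * s) (c * t) = `|c| * N s t.
Proof. by case: nN. Qed.

Lemma planar_normD s t s' t' : N (s + s') (t + t') <= N s t + N s' t'.
Proof. by case: nN. Qed.

Lemma planar_norm_ge0 s t : 0 <= N s t.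
Proof.
have [_ _ [a a0 h]] := nN; apply: le_trans (h s t).
by apply: mulr_ge0; [exact: ltW|exact: addr_ge0].
Qed.

Lemma planar_norm_gt0 s t : (s != 0) || (t != 0) -> 0 < N s t.
Proof.
have [_ _ [a a0 h]] := nN => st; apply: lt_le_trans (h s t).
rewrite mulr_gt0//; case/orP: st => st.
  by rewrite ltr_wpDr ?normr_gt0.
by rewrite ltr_wpDl ?normr_gt0.
Qed.

Lemma planar_norm_x0 s : N s 0 = `|s| * N 1 0.
Proof. by rewrite -planar_normZ mulr1 mulr0. Qed.

Lemma planar_norm_0x t : N 0 t = `|t| * N 0 1.
Proof. by rewrite -planar_normZ mulr1 mulr0. Qed.

Lemma planar_norm_le s t : N s t <= `|s| * N 1 0 + `|t| * N 0 1.
Proof.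
rewrite -planar_norm_x0 -planar_norm_0x.
by have := planar_normD s 0 0 t; rewrite addr0 add0r.
Qed.

Lemma planar_norm_continuous1 : continuous (N 1).
Proof.
move=> x; apply/cvgrPdist_le => e e0.
have N01 := planar_norm_ge0 0 1; have d0 : 0 < N 0 1 + 1 by rewrite ltr_wpDl.
have lip u v : N 1 u - N 1 v <= `|u - v| * N 0 1.
  rewrite lerBlDl -planar_norm_0x.
  by have := planar_normD 1 v 0 (u - v); rewrite addr0 subrKC.
near=> y.
have xy : `|x - y| <= e / (N 0 1 + 1).
  near: y; apply: cvgr_dist_le; first exact: cvg_id.
  by rewrite divr_gt0.
apply: (@le_trans _ _ (`|x - y| * N 0 1)).
  by rewrite ler_norml lerNl opprB lip andbT distrC lip.
move: xy; rewrite ler_pdivlMr// => xy; apply: le_trans xy.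
by rewrite ler_wpM2l// lerDl.
Unshelve. all: by end_near. Qed.

(** Homogeneity reduces N s t to |s| times the continuous function N 1 at t / s, and the line s = 0
    is added by an indicator. The inverse of s is written s (s^2)^(-1), with a power of a
    nonnegative number. *)
Lemma measurable_planar_norm d (T : measurableType d) (f g : T -> R) :
  measurable_fun setT f -> measurable_fun setT g ->
  measurable_fun setT (fun x => N (f x) (g x)).
Proof.
move=> mf mg.
have E x : N (f x) (g x) = `|f x| * N 1 (g x * (f x * (f x ^+ 2) `^ (-1))) +
    \1_[set 0 : R] (f x) * (`|g x| * N 0 1).
  have [f0|f0] := eqVneq (f x) 0.
    by rewrite f0 normr0 mul0r add0r indicE mem_set// mul1r planar_norm_0x.
  rewrite indicE memNset ?mul0r ?addr0; last by move=> /= /eqP; rewrite (negbTE f0).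
  rewrite powR_inv1 ?sqr_ge0// -planar_normZ mulr1; congr N.
  by rewrite expr2 invfM mulrA mulrC mulrCA !mulrA; field.
under eq_fun do rewrite E.
have mnorm (h : T -> R) : measurable_fun setT h -> measurable_fun setT (fun x => `|h x|).
  by move=> mh; exact: (measurableT_comp (@normr_measurable R setT) mh).
apply: measurable_funD; apply: measurable_funM.
- exact: mnorm.
- apply: (measurableT_comp (continuous_measurable_fun planar_norm_continuous1)).
  apply: measurable_funM => //; apply: measurable_funM => //.
  apply: (measurableT_comp (measurable_powR _)); exact: measurable_funX.
- exact: measurable_indic_comp.
- by apply: measurable_funM => //; exact: mnorm.
Qed.

End planar_norm.

(** * Star bodies lie between two balls *)

Section bodies.
Context {R : realType} {n : nat}.
Implicit Types (K : set 'rV[R]_n).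

(** The properties that carry the argument, common to star bodies and the ball. *)
Definition fat_bounded K : Prop :=
  [/\ measurable K, exists2 r : R, 0 < r & @eballr R n r `<=` K &
      exists2 r : R, 0 <= r & K `<=` @eballr R n r].

Lemma fat_bounded_eball : fat_bounded (eball R n).
Proof. by split; [exact: measurable_eballr|exists 1|exists 1]. Qed.

Lemma continuous_dotxx : continuous (fun x : 'rV[R]_n => dot x x).
Proof.
have h (s : seq 'I_n) : continuous (fun x : 'rV[R]_n => \sum_(i <- s) x 0 i * x 0 i).
  elim: s => [|i s IH].
    have -> : (fun x : 'rV[R]_n => \sum_(i <- [::]) x 0 i * x 0 i) = cst 0.
      by apply/funext => x; rewrite big_nil.
    exact: cst_continuous.
  have -> : (fun x : 'rV[R]_n => \sum_(j <- i :: s) x 0 j * x 0 j) =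
      (fun x : 'rV[R]_n => x 0 i * x 0 i + \sum_(j <- s) x 0 j * x 0 j).
    by apply/funext => x; rewrite big_cons.
  move=> x; have ci : {for x, continuous (fun y : 'rV[R]_n => y 0 i)} by exact: coord_continuous.
  exact: (continuousD (continuousM ci ci) (IH x)).
rewrite (_ : (fun _ => _) = fun x : 'rV[R]_n => \sum_i x 0 i * x 0 i); first exact: h.
by apply/funext => x; rewrite dotE.
Qed.

Lemma compact_esphere : compact (@esphere R n).
Proof.
apply: bounded_closed_compact.
  exists 1; split; first exact: num_real.
  move=> M M1 x /= x1; rewrite /Num.norm/= mx_normrE.
  apply: bigmax_le; first by rewrite ltW// (lt_trans _ M1).
  move=> [i j] _ /=; rewrite ord1; apply: le_trans (ltW M1).
  by rewrite -x1 ler_coord_enorm.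
rewrite (_ : @esphere R n = (fun x => dot x x) @^-1` [set 1]).
  apply: (iffLR (continuous_closedP _) continuous_dotxx).
  by rewrite -set_itv1; exact: interval_closed.
apply/seteqP; split => x /=; rewrite /esphere/= => h; first exact: enorm1_dot.
by rewrite /enorm h sqrtr1.
Qed.

Lemma fat_bounded_star_body K : (0 < n)%N -> star_body K -> fat_bounded K.
Proof.
move=> n0 [cK starK radK contK]; split; first exact: compact_measurable_rV.
- have sphere0 := @esphere_neq0 R n n0.
  have cS : {within @esphere R n, continuous (radial K)}.
    apply: continuous_subspaceW contK => u /= u1.
    by rewrite -enorm_gt0 u1.
  have [u] := EVT_min_rV sphere0 compact_esphere cS.
  rewrite inE => u1 umin.
  have r0 : 0 < radial K u by apply: radK; rewrite -enorm_gt0 u1.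
  (* Half the minimum of the radial function on the sphere: the length of x is then strictly below
     the supremum in its direction, so K contains a longer multiple of x. *)
  exists (radial K u / 2); first by rewrite divr_gt0.
  move=> x; rewrite /eballr/= => xr.
  have K0 : K 0.
    (* An empty K would have radial function 0, the supremum of the empty set. *)
    suff [y Ky] : K !=set0 by rewrite -(scale0r y); apply: starK => //; rewrite lexx ler01.
    apply/set0P/eqP => K0; move: r0; rewrite /radial K0.
    by rewrite (_ : mkset _ = set0) ?sup0 ?ltxx//; apply/seteqP; split => l //= [].
  have [->//|x0] := eqVneq x 0.
  have ex0 : 0 < enorm x by rewrite enorm_gt0.
  pose v := (enorm x)^-1 *: x.
  have v1 : enorm v = 1 by exact: enorm_normalize.
  have xv : enorm x < radial K v.
    apply: (@lt_le_trans _ _ (radial K u)); last by apply: umin; rewrite inE.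
    by apply: le_lt_trans xr _; rewrite ltr_pdivrMr// ltr_pMr// ltr1n.
  have S0 : [set l : R | 0 <= l /\ K (l *: v)] !=set0 by exists 0; rewrite /= scale0r.
  have [l [l0 Kl] xl] := sup_gt S0 xv.
  have lp : 0 < l := le_lt_trans (enorm_ge0 x) xl.
  have -> : x = (enorm x / l) *: (l *: v).
    by rewrite scalerA divfK ?gt_eqF// scalerA mulfV ?scale1r// gt_eqF.
  apply: starK => //; rewrite divr_ge0 ?enorm_ge0//=.
  by rewrite ler_pdivrMr// mul1r ltW.
- have [M [Mr MK]] := compact_bounded cK.
  exists (n%:R * (`|M| + 1)); first by rewrite mulr_ge0// addr_ge0.
  move=> x Kx; rewrite /eballr/=; apply: ler_enorm_coord; first by rewrite addr_ge0.
  move=> i; apply: (@le_trans _ _ `|x|).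
    rewrite [leRHS]/Num.norm/= mx_normrE.
    by apply: (le_bigmax _ (fun ij : 'I_1 * 'I_n => `|x ij.1 ij.2|) (0, i)).
  by apply: MK => //; rewrite (le_lt_trans (ler_norm M))// ltrDl.
Qed.

End bodies.

(** * Positive homogeneous functions pinched on the sphere *)

Section moment_like.
Context {R : realType} {n : nat}.

(** The shape shared by the real moments, the complex moments and, for p = -1, the section
    volumes. *)
Definition moment_like (p : R) (f : 'rV[R]_n -> R) : Prop :=
  [/\ measurable_fun setT f,
      forall (t : R) x, 0 < t -> f (t *: x) = t `^ p * f x &
      exists2 c : R * R, 0 < c.1 & forall u, esphere u -> c.1 <= f u <= c.2].

Lemma moment_like_enorm p f x : moment_like p f -> x != 0 ->
  f x = enorm x `^ p * f ((enorm x)^-1 *: x).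
Proof.
move=> [_ fh _]; rewrite -enorm_gt0 => x0.
by rewrite -fh// scalerA mulfV ?scale1r// gt_eqF.
Qed.

Lemma moment_like_gt0 p f x : moment_like p f -> x != 0 -> 0 < f x.
Proof.
move=> fp x0; rewrite (moment_like_enorm fp x0) mulr_gt0//.
  by rewrite powR_gt0// enorm_gt0.
have [_ _ [c c0 fc]] := fp.
have /fc/andP[h _] : esphere ((enorm x)^-1 *: x) by exact: enorm_normalize.
exact: lt_le_trans h.
Qed.

Lemma powR_bounds (p a b : R) : 0 < a -> a <= b ->
  exists2 c : R * R, 0 < c.1 & forall x, a <= x <= b -> c.1 <= x `^ p <= c.2.
Proof.
move=> a0 ab; have b0 := lt_le_trans a0 ab.
have [p0|p0] := leP 0 p.
  exists (a `^ p, b `^ p); rewrite ?powR_gt0// => x /andP[ax xb].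
  by rewrite !ge0_ler_powR// ?nnegrE ?ltW// (lt_le_trans a0).
exists (b `^ p, a `^ p); rewrite ?powR_gt0// => x /andP[ax xb] /=.
have x0 := lt_le_trans a0 ax.
rewrite -[p]opprK !(powRN _ (- p)) !lef_pV2 ?posrE ?powR_gt0//.
by rewrite !ge0_ler_powR// ?nnegrE ?oppr_ge0 ?ltW.
Qed.

Lemma moment_like_annulus p f : moment_like p f ->
  exists2 c : R * R, 0 < c.1 & forall x, annulus x -> c.1 <= f x <= c.2.
Proof.
move=> fp; have [_ _ [c c0 fc]] := fp.
have [|d d0 hd] := @powR_bounds p 1 2 ltr01; first by rewrite ler1n.
exists (d.1 * c.1, d.2 * c.2) => [/=|x Ax]; first exact: mulr_gt0.
have x0 := annulus_neq0 Ax.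
rewrite (moment_like_enorm fp x0) /=.
have /fc/andP[h1 h2] : esphere ((enorm x)^-1 *: x) by exact: enorm_normalize.
have /andP[k1 k2] := hd _ Ax.
have c0' := ltW c0; have d0' := ltW d0.
have f0 := le_trans c0' h1.
by apply/andP; split; apply: ler_pM; rewrite ?powR_ge0.
Qed.

End moment_like.

(** * Moments of a body for a gauge on the plane *)

Section moments.
Context {R : realType} {m : nat}.
Local Notation leb := (lebesgue_rV R).
Local Notation mu := (@lebesgue_measure R).
Implicit Types (u x : 'rV[R]_m) (K : set 'rV[R]_m) (p : R).

(** Broad enough for |s|, the gauge of the real body, which is degenerate in t; hence a lower bound
    in s alone. *)
Definition pregauge (N : R -> R -> R) : Prop :=
  [/\ measurable_fun setT (fun z : R * R => N z.1 z.2),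
      forall c s t, N (c * s) (c * t) = `|c| * N s t,
      exists2 a : R, 0 < a & forall s t, a * `|s| <= N s t &
      exists2 b : R, 0 < b & forall s t, N s t <= b * (`|s| + `|t|)].

Lemma pregauge_planar_norm N : planar_norm N -> pregauge N.
Proof.
move=> nN; have [h1 h2 [a a0 ha]] := nN; split => //.
- exact: (measurable_planar_norm nN measurable_fst measurable_snd).
- by exists a => // s t; apply: le_trans (ha s t); rewrite ler_pM2l// lerDl.
- exists (N 1 0 + N 0 1).
    by rewrite addr_gt0// planar_norm_gt0// oner_eq0 ?orbT.
  move=> s t; apply: le_trans (planar_norm_le nN s t) _.
  have := planar_norm_ge0 nN 1 0; have := planar_norm_ge0 nN 0 1.
  have := normr_ge0 s; have := normr_ge0 t; nra.
Qed.

Lemma pregauge_norm_fst : pregauge (fun s _ => `|s|).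
Proof.
split.
- exact: (measurableT_comp (@normr_measurable R setT) measurable_fst).
- by move=> c s _; rewrite normrM.
- by exists 1 => // s _; rewrite mul1r.
- by exists 1 => // s t; rewrite mul1r lerDl.
Qed.

Variables (N : R -> R -> R) (pN : pregauge N) (J : 'M[R]_m).
Hypothesis JJ : J *m J^T = 1%:M.

Lemma pregauge_ge0 s t : 0 <= N s t.
Proof.
by have [_ _ [a a0 h] _] := pN; apply: le_trans (h s t); rewrite mulr_ge0// ltW.
Qed.

Lemma measurable_pregauge d (T : measurableType d) (f g : T -> R) :
  measurable_fun setT f -> measurable_fun setT g ->
  measurable_fun setT (fun z => N (f z) (g z)).
Proof.
move=> mf mg; have [mN _ _ _] := pN.
exact: (measurableT_comp mN (measurable_fun_pair mf mg)).
Qed.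

Definition gauge_at u x : R := N (dot x u) (dot x (u *m J)).

(** The real and the complex moments are this integral for two gauges. Values are extended reals so
    that finiteness can be proved afterwards. *)
Definition emoment p K u : \bar R :=
  (\int[leb m]_(x in K) (gauge_at u x `^ p)%:E)%E.

Lemma measurable_gauge_at d (T : measurableType d) (f g : T -> 'rV[R]_m) :
  measurable_fun setT f -> measurable_fun setT g ->
  measurable_fun setT (fun z => gauge_at (f z) (g z)).
Proof.
move=> mf mg; apply: measurable_pregauge; apply: measurable_dot => //.
exact: measurable_rV_mulmx_cst.
Qed.

Lemma measurable_powR_fun d (T : measurableType d) (f : T -> R) p :
  measurable_fun setT f -> measurable_fun setT (fun z => f z `^ p).
Proof. exact: (measurableT_comp (measurable_powR p)). Qed.

Lemma emoment_ge0 p K u : (0 <= emoment p K u)%E.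
Proof. by apply: integral_ge0 => x _; rewrite lee_fin powR_ge0. Qed.

Lemma gauge_atZ t u x : 0 < t -> gauge_at (t *: u) x = t * gauge_at u x.
Proof.
move=> t0; have [_ h _ _] := pN.
by rewrite /gauge_at -scalemxAl !dotZr h gtr0_norm.
Qed.

Lemma emomentZ p K t u : measurable K -> 0 < t ->
  emoment p K (t *: u) = ((t `^ p)%:E * emoment p K u)%E.
Proof.
move=> mK t0; rewrite /emoment -ge0_integralZl_EFin//.
- apply: eq_integral => x _.
  by rewrite gauge_atZ// powRM ?(ltW t0)//; exact: pregauge_ge0.
- by move=> x _; rewrite lee_fin powR_ge0.
- apply/measurable_EFinP/measurable_funTS.
  by apply: measurable_powR_fun; exact: measurable_gauge_at.
- exact: powR_ge0.
Qed.

Lemma measurable_emoment p K : measurable K -> measurable_fun setT (emoment p K).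
Proof.
move=> mK; rewrite (_ : emoment p K = fun u => \int[leb m]_x (\1_K x * gauge_at u x `^ p)%:E)%E; last first.
  by apply/funext => u; rewrite /emoment (integral_mulindic _ _ (fun x => gauge_at u x `^ p)).
pose P (z : 'rV[R]_m * 'rV[R]_m) := (\1_K z.2 * gauge_at z.1 z.2 `^ p)%:E.
apply: (measurable_fun_fubini_tonelli_F P).
- apply/measurable_EFinP/measurable_funM; first exact: measurable_indic_comp.
  by apply: measurable_powR_fun; exact: measurable_gauge_at.
- by move=> z; rewrite lee_fin mulr_ge0// powR_ge0.
Qed.

Lemma enorm_orthogonal u : enorm (u *m J) = enorm u.
Proof. exact: enorm_mulmx_orthonormal. Qed.

(** The ball of radius r / 4 around (r / 2) u lies in K and avoids the hyperplane orthogonal to u,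
    where the gauge may vanish: on it the inner product with u is at least r / 4. *)
Lemma gauge_at_bounds K (r : R) : 0 < r -> @eballr R m r `<=` K -> exists2 c : R * R,
  0 < c.1 /\ c.1 <= c.2 & forall u x, esphere u -> @eballr R m (r / 4) (x - (r / 2) *: u) ->
    K x /\ c.1 <= gauge_at u x <= c.2.
Proof.
move=> r0 rK; have [_ _ [a a0 ha] [b b0 hb]] := pN.
have ab : a <= b.
  by have := le_trans (ha 1 0) (hb 1 0); rewrite normr1 normr0 addr0 !mulr1.
exists (a * (r / 4), b * (r + r)).
  split; first by rewrite mulr_gt0// divr_gt0.
  by rewrite ler_pM ?(ltW a0)//=; lra.
move=> u x u1; rewrite /eballr/= => xu.
set y := x - _ in xu.
have uu : dot u u = 1 by exact: enorm1_dot.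
have xE : x = y + (r / 2) *: u by rewrite subrK.
clearbody y.
have yu := dot_le_enorm y u; rewrite u1 mulr1 in yu.
have xr : enorm x <= r.
  rewrite -(@ler_pXn2r _ 2) ?nnegrE ?enorm_ge0 ?(ltW r0)// sqr_enorm xE.
  rewrite dotDl !dotDr !dotZl !dotZr uu (dotC u y) -sqr_enorm.
  have := enorm_ge0 y; have := ler_norm (dot y u).
  move: (dot y u) (enorm y) xu yu => D E xu yu DD E0.
  have : E ^+ 2 <= (r / 4) ^+ 2 by rewrite ler_pXn2r ?nnegrE//; lra.
  have DE : D <= r / 4 by lra.
  have := ler_wpM2l (ltW r0) DE; nra.
have xu4 : r / 4 <= dot x u.
  rewrite xE dotDl dotZl uu.
  have := lerNnormlW yu; lra.
split; first exact: rK.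
apply/andP; split.
  apply: le_trans (ha _ _); rewrite ler_pM2l//; apply: le_trans xu4 _; exact: ler_norm.
apply: le_trans (hb _ _) _; rewrite ler_pM2l// lerD//.
  by apply: le_trans (dot_le_enorm _ _) _; rewrite u1 mulr1.
by apply: le_trans (dot_le_enorm _ _) _; rewrite enorm_orthogonal u1 mulr1.
Qed.

Lemma emoment_lower p K : fat_bounded K ->
  exists2 c : R, 0 < c & forall u, esphere u -> (c%:E <= emoment p K u)%E.
Proof.
move=> [mK [r r0 rK] _].
have [c [c0 cc] hc] := gauge_at_bounds r0 rK.
have [d d0 hd] := @powR_bounds _ p c.1 c.2 c0 cc.
have r40 : 0 < r / 4 by rewrite divr_gt0.
have bl := lebesgue_eballr_gt0 m r40; have bo := lebesgue_eballr_lty m (ltW r40).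
set b := leb m _ in bl bo.
have bf : b \is a fin_num by rewrite ge0_fin_numE// ltW.
exists (d.1 * fine b); first by rewrite mulr_gt0// fine_gt0// bl.
move=> u u1.
pose B := [set x | @eballr R m (r / 4) (x - (r / 2) *: u)].
have mB : measurable B.
  rewrite -[X in measurable X]setTI.
  apply: (measurable_rV_add (f := fun x => x) (g := fun=> - ((r / 2) *: u))) => //.
  exact: measurable_eballr.
have bE : leb m B = b.
  transitivity (\int[leb m]_x (\1_(@eballr R m (r / 4)) (x + - ((r / 2) *: u)))%:E)%E.
    by rewrite -[B in LHS]setIT -integral_indic.
  rewrite (@ge0_integral_rV_addr _ _ (fun x => (\1_(@eballr R m (r / 4)) x)%:E))//.
    by rewrite integral_indic ?setIT//; exact: measurable_eballr.
  by apply/measurable_EFinP/measurable_indic; exact: measurable_eballr.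
have mg : measurable_fun setT (fun x => (gauge_at u x `^ p)%:E).
  by apply/measurable_EFinP/measurable_powR_fun; exact: measurable_gauge_at.
apply: (@le_trans _ _ (\int[leb m]_(x in B) (cst d.1%:E x))%E).
  by rewrite integral_cst//= bE EFinM fineK.
apply: (@le_trans _ _ (\int[leb m]_(x in B) (gauge_at u x `^ p)%:E)%E).
  apply: ge0_le_integral => //.
  - by move=> x _; rewrite lee_fin ltW.
  - exact: measurable_funTS.
  by move=> x Bx; rewrite lee_fin; have [_ /hd/andP[]] := hc u x u1 Bx.
apply: ge0_subset_integral => //.
- exact: measurable_funTS.
- by move=> x _; rewrite lee_fin powR_ge0.
by move=> x Bx; have [] := hc u x u1 Bx.
Qed.

Lemma emoment_upper_ge0 p K : 0 <= p -> fat_bounded K ->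
  exists c : R, forall u, esphere u -> (emoment p K u <= c%:E)%E.
Proof.
move=> p0 [mK _ [r r0 Kr]]; have [_ _ _ [b b0 hb]] := pN.
have bo := lebesgue_eballr_lty m r0.
have bf : leb m (@eballr R m r) \is a fin_num by rewrite ge0_fin_numE.
exists ((b * (r + r)) `^ p * fine (leb m (@eballr R m r))) => u u1.
apply: (@le_trans _ _ (\int[leb m]_(x in @eballr R m r) (cst ((b * (r + r)) `^ p)%:E x))%E); last first.
  rewrite integral_cst//=; last exact: measurable_eballr.
  by rewrite EFinM fineK.
have mB := @measurable_eballr R m r.
rewrite /emoment; apply: (@le_trans _ _ (\int[leb m]_(x in @eballr R m r) (gauge_at u x `^ p)%:E)%E).
  apply: ge0_subset_integral => //.
  - by apply/measurable_funTS/measurable_EFinP/measurable_powR_fun; exact: measurable_gauge_at.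
  - by move=> x _; rewrite lee_fin powR_ge0.
apply: ge0_le_integral => //.
- by move=> x _; rewrite lee_fin powR_ge0.
- by apply/measurable_funTS/measurable_EFinP/measurable_powR_fun; exact: measurable_gauge_at.
move=> x; rewrite /eballr/= => xr; rewrite lee_fin ge0_ler_powR// ?nnegrE.
- exact: pregauge_ge0.
- by rewrite mulr_ge0 ?(ltW b0)// addr_ge0.
apply: le_trans (hb _ _) _; rewrite ler_pM2l// lerD//.
  by apply: le_trans (dot_le_enorm _ _) _; rewrite u1 mulr1.
by apply: le_trans (dot_le_enorm _ _) _; rewrite enorm_orthogonal u1 mulr1.
Qed.

End moments.

(** * Finiteness of moments of negative order *)

Section moment_bounds.
Context {R : realType} {k : nat}.
Local Notation leb := (lebesgue_rV R).
Local Notation mu := (@lebesgue_measure R).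
Implicit Types (K : set 'rV[R]_k.+1).

Lemma dot_frame (u : 'rV[R]_k.+1) B t (y : 'rV[R]_k) : enorm u = 1 -> is_frame u B ->
  dot (t *: u + y *m B) u = t.
Proof.
move=> u1 [_ Bu]; rewrite dotDl dotZl enorm1_dot// mulr1.
by rewrite /dot -mulmxA Bu mulmx0 mxE addr0.
Qed.

Lemma sqr_enorm_frame (u : 'rV[R]_k.+1) B t (y : 'rV[R]_k) : enorm u = 1 ->
  is_frame u B -> enorm (t *: u + y *m B) ^+ 2 = t ^+ 2 + enorm y ^+ 2.
Proof.
move=> u1 uB; rewrite sqr_enorm dotDr dotC dotZl dotC dot_frame// -expr2.
have yBu : dot u (y *m B) = 0.
  by have := dot_frame 0 y u1 uB; rewrite scale0r add0r dotC.
rewrite dotDl dotZl yBu mulr0 add0r; congr (_ + _).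
by case: uB => BB _; rewrite dot_mulmx_orthonormal// sqr_enorm.
Qed.

Variables (N : R -> R -> R) (pN : pregauge N) (J : 'M[R]_k.+1).
Hypothesis JJ : J *m J^T = 1%:M.

(** On the slice at height t along u the integrand is at most (a |t|)^p, and the slice lies in a
    ball of radius r. Since |t| <= r on K, the Cauchy kernel is bounded below there and the Cauchy
    moment dominates the integral. *)
Lemma emoment_upper_lt0 (p : R) K : -1 < p -> p < 0 -> fat_bounded K ->
  exists c : R, forall u, esphere u -> (emoment N J p K u <= c%:E)%E.
Proof.
move=> p1 p0 [mK _ [r r0 Kr]]; have [_ _ [a a0 ha] _] := pN.
have bo := lebesgue_eballr_lty k r0.
set b := leb k _ in bo.
have b0 : (0 <= b)%E by exact: measure_ge0.
have bf : b \is a fin_num by rewrite ge0_fin_numE.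
have coo : (cauchy_moment p < +oo)%E by apply: cauchy_moment_lty; rewrite p1 (lt_trans p0 ltr01).
have c0 := cauchy_moment_gt0 p.
have cf : cauchy_moment p \is a fin_num by rewrite ge0_fin_numE// ltW.
(* The factor 1 + r^2 compensates the Cauchy kernel, at least 1 / (1 + r^2) for |t| <= r. *)
pose A := a `^ p * fine b * (1 + r ^+ 2).
have A0 : 0 <= A by rewrite !mulr_ge0 ?powR_ge0 ?fine_ge0// addr_ge0// sqr_ge0.
exists (A * fine (cauchy_moment p)) => u u1.
have uB := householder_is_frame u1; set B := householder_frame u in uB.
rewrite /emoment (integral_mulindic _ _ (fun x => gauge_at N J u x `^ p)).
pose g x : \bar R := (\1_K x * gauge_at N J u x `^ p)%:E.
have mg : measurable_fun setT g.
  apply/measurable_EFinP/measurable_funM; first exact: measurable_indic.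
  by apply: measurable_powR_fun; exact: measurable_gauge_at.
have g0 x : (0 <= g x)%E by rewrite lee_fin mulr_ge0// powR_ge0.
rewrite (ge0_integral_frame u1 uB mg g0).
pose P (z : measurableTypeR R * 'rV[R]_k) := g (z.1 *: u + z.2 *m B)%R.
have mP : measurable_fun setT P.
  apply: (measurableT_comp mg); apply: measurable_rV_add.
    exact: measurable_rV_scale.
  exact: measurable_rV_mulmx_cst.
pose G (t : R) : \bar R := (\int[leb k]_y g (t *: u + y *m B)%R)%E.
have mG : measurable_fun setT G by apply: (measurable_fun_fubini_tonelli_F P) => // z; exact: g0.
have G0 t : (0 <= G t)%E by exact: integral_ge0.
have mC := measurable_cauchy_moment p.
have C0 t : (0 <= (cauchy_kernel t * `|t| `^ p)%:E)%E.
  by rewrite lee_fin mulr_ge0 ?powR_ge0// ltW ?cauchy_kernel_gt0.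
have mB : measurable (@eballr R k r) by exact: measurable_eballr.
have mgt t : measurable_fun setT (fun y : 'rV[R]_k => g (t *: u + y *m B)%R).
  have mt : measurable_fun setT (fun y : 'rV[R]_k => t *: u + y *m B).
    apply: measurable_rV_add => //; exact: measurable_rV_mulmx_cst.
  exact: (measurableT_comp mg mt).
have GC t : t != 0 -> (G t <= A%:E * (cauchy_kernel t * `|t| `^ p)%:E)%E.
  move=> t0; have [tr|tr] := leP `|t| r; last first.
    rewrite /G integral0_eq; first exact: (mule_ge0 (x := A%:E)).
    move=> y _; rewrite /g indicE memNset ?mul0r// => /Kr; rewrite /eballr/=.
    apply/negP; rewrite -ltNge; apply: lt_le_trans tr _.
    rewrite -(@ler_pXn2r _ 2) ?nnegrE ?enorm_ge0// sqr_enorm_frame//.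
    by rewrite real_normK ?num_real// lerDl sqr_ge0.
  apply: (@le_trans _ _ (\int[leb k]_(y in @eballr R k r) (cst ((a * `|t|) `^ p)%:E y))%E); last first.
    rewrite integral_cst//= -/b -(fineK bf) -!EFinM lee_fin.
    rewrite powRM ?(ltW a0)// /A.
    have := cauchy_kernel_gt0 t; have : 1 <= (1 + r ^+ 2) * cauchy_kernel t.
      rewrite ler_pdivlMr ?oneDsqr_gt0// mul1r /oneDsqr lerD2l.
      by rewrite -[leLHS]real_normK ?num_real// ler_pXn2r ?nnegrE.
    move: (cauchy_kernel t) => x x1 x0.
    have -> : a `^ p * fine b * (1 + r ^+ 2) * (x * `|t| `^ p) =
      (a `^ p * `|t| `^ p * fine b) * ((1 + r ^+ 2) * x) by ring.
    by rewrite ler_peMr// !mulr_ge0 ?powR_ge0 ?fine_ge0.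
  rewrite /G [leRHS]integral_mkcond; apply: ge0_le_integral => //.
  - exact: (measurable_restrictT _ mB).1 (@measurable_cst _ _ _ _ _ _).
  move=> y _; rewrite patchE; case: ifPn => [_|yr].
    rewrite lee_fin; apply: (@le_trans _ _ (gauge_at N J u (t *: u + y *m B) `^ p)).
      by rewrite indicE ler_piMl ?powR_ge0// lern1 leq_b1.
    have tp : 0 < a * `|t| by rewrite mulr_gt0 ?normr_gt0.
    have le := ha t (dot (t *: u + y *m B) (u *m J)).
    rewrite /gauge_at dot_frame//.
    rewrite -[p]opprK !(powRN _ (- p)) lef_pV2 ?posrE ?powR_gt0//; last exact: lt_le_trans le.
    by rewrite ge0_ler_powR// ?nnegrE ?oppr_ge0 ?ltW// (lt_le_trans tp).
  rewrite /g indicE memNset ?mul0r// => /Kr; rewrite /eballr/= => xr.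
  move/negP: yr; apply; rewrite inE /eballr/=; apply: le_trans xr.
  rewrite -(@ler_pXn2r _ 2) ?nnegrE ?enorm_ge0// sqr_enorm_frame//.
  by rewrite lerDr sqr_ge0.
(* At t = 0 the bound may fail, the power of 0 being 0 by convention; this is a null set. *)
have mD : measurable (setT `\ (0 : R)) by exact: measurableD.
rewrite -[leLHS]/(\int[mu]_t G t)%E -(@integral_setD1 _ _ 0%R setT)//; last exact: measurable_funTS.
apply: (@le_trans _ _ (\int[mu]_(t in setT `\ 0%R) (A%:E * (cauchy_kernel t * `|t| `^ p)%:E))%E).
  apply: ge0_le_integral => //.
  - exact: measurable_funTS.
  - by apply: measurable_funTS; exact: measurable_funeM.
  - by move=> t [_ /eqP t0]; exact: GC.
apply: (@le_trans _ _ (\int[mu]_t (A%:E * (cauchy_kernel t * `|t| `^ p)%:E))%E).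
  apply: ge0_subset_integral => //; first exact: measurable_funeM.
  by move=> t _; exact: mule_ge0.
rewrite ge0_integralZl_EFin// -/(cauchy_moment p) -[in leLHS](fineK cf) EFinM//.
Qed.

End moment_bounds.

(** * Volumes as annulus integrals, and Jensen's inequality for bodies *)

Section annulus_moment.
Context {R : realType} {m : nat} (m_gt0 : (0 < m)%N).
Local Notation leb := (lebesgue_rV R).
Implicit Types (p q : R) (f F : 'rV[R]_m -> R) (K : set 'rV[R]_m).

Definition annulus_moment q f : R :=
  fine (\int[leb m]_(x in @annulus R m) (f x `^ q)%:E)%E.

Lemma annulus_moment_ge0 q f : 0 <= annulus_moment q f.
Proof.
by apply: fine_ge0; apply: integral_ge0 => x _; rewrite lee_fin powR_ge0.
Qed.

(** As f has degree p, f^(- 1 / p) has degree -1, like a radial function, and its m-th power is f^(-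
    m / p). *)
Lemma vol_moment_like p f rho : p != 0 -> moment_like p f ->
  (forall u, esphere u -> rho u = f u `^ (- p^-1)) ->
  vol (star_of_radial rho) = (m%:R * ln 2)^-1 * annulus_moment (- (m%:R / p)) f.
Proof.
move=> p0 fp fr; have [mf fh _] := fp.
rewrite (@vol_star_of_radial _ _ m_gt0 rho (fun x => f x `^ (- p^-1)))//.
- congr (_ * fine _); apply: eq_integral => x _; congr EFin.
  by rewrite -powR_mulrn ?powR_ge0// -powRrM; congr (_ `^ _); rewrite mulNr mulrC.
- exact: (measurableT_comp (measurable_powR _) mf).
- by move=> x x0; rewrite powR_gt0// (moment_like_gt0 fp).
- move=> t x t0 x0; rewrite fh// powRM ?powR_ge0 ?ltW ?(moment_like_gt0 fp)//.
  by rewrite -powRrM mulrN mulfV// powR_inv1// ltW.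
Qed.

Lemma measurable_moment_powR q p f : moment_like p f ->
  measurable_fun setT (fun x => (f x `^ q)%:E).
Proof.
move=> [mf _ _]; apply/measurable_EFinP.
exact: (measurableT_comp (measurable_powR _) mf).
Qed.

Lemma annulus_moment_fin_num q p f : moment_like p f ->
  (\int[leb m]_(x in @annulus R m) (f x `^ q)%:E)%E \is a fin_num.
Proof.
move=> fp; have mA := @measurable_annulus R m.
have [[c1 c2] /= c0 fc] := moment_like_annulus fp.
have c12 : c1 <= Num.max c1 c2 by rewrite le_max lexx.
have [d _ hd] := @powR_bounds _ q c1 (Num.max c1 c2) c0 c12.
rewrite ge0_fin_numE; last by apply: integral_ge0 => x _; rewrite lee_fin powR_ge0.
apply: (@le_lt_trans _ _ (\int[leb m]_(x in @annulus R m) (cst d.2%:E x))%E).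
  apply: ge0_le_integral => //.
  - by move=> x _; rewrite lee_fin powR_ge0.
  - apply: measurable_funTS; exact: (measurable_moment_powR q fp).
  move=> x Ax; rewrite lee_fin; have /andP[h1 h2] := fc x Ax.
  by have /andP[] : d.1 <= f x `^ q <= d.2 by apply: hd; rewrite h1 le_max h2 orbT.
rewrite integral_cst//=.
have Aoo : (leb m (@annulus R m) < +oo)%E.
  apply: le_lt_trans (lebesgue_eballr_lty m (ler0n R 2)).
  by apply: le_measure; rewrite ?inE//; [exact: measurable_eballr|move=> x /andP[]].
have Af : leb m (@annulus R m) \is a fin_num by rewrite ge0_fin_numE.
by rewrite -(fineK Af) -EFinM ltry.
Qed.

Lemma ler_annulus_moment q p q' p' f F c : moment_like p f -> moment_like p' F ->
  0 <= c -> (forall x, annulus x -> f x `^ q <= c * F x `^ q') ->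
  annulus_moment q f <= c * annulus_moment q' F.
Proof.
move=> fp Fp c0 fF; have mA := @measurable_annulus R m.
have ff := annulus_moment_fin_num q fp; have Ff := annulus_moment_fin_num q' Fp.
have cF : (c%:E * \int[leb m]_(x in @annulus R m) (F x `^ q')%:E =
    \int[leb m]_(x in @annulus R m) (c%:E * (F x `^ q')%:E))%E.
  apply/esym; apply: ge0_integralZl_EFin => //.
  - by move=> x _; rewrite lee_fin powR_ge0.
  - apply: measurable_funTS; exact: (measurable_moment_powR q' Fp).
rewrite -lee_fin EFinM (fineK ff) (fineK Ff) cF.
apply: ge0_le_integral.
- exact: mA.
- by move=> x _; rewrite lee_fin powR_ge0.
- apply: measurable_funTS; exact: (measurable_moment_powR q fp).
- by apply: measurable_funTS; apply: measurable_funeM; exact: (measurable_moment_powR q' Fp).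
- by move=> x Ax; rewrite -EFinM lee_fin fF.
Qed.

Variables (d : measure_display) (Y : measurableType d).
Variables (nu : {sigma_finite_measure set Y -> \bar R}) (W : Y -> R).
Variables (Q : Y -> 'M[R]_m).
Hypothesis mW : measurable_fun setT W.
Hypothesis W_ge0 : forall y, 0 <= W y.
Hypothesis mQ : forall i j, measurable_fun setT (fun y => Q y i j).
Hypothesis QQ : forall y, Q y *m (Q y)^T = 1%:M.

Definition rotation_average f F : Prop := forall x, esphere x ->
  (\int[nu]_y (W y * f (x *m Q y))%:E = (F x)%:E)%E.

(** The common degree p carries the identity from the sphere to every nonzero vector. *)
Lemma rotation_average_neq0 p f F x : moment_like p f -> moment_like p F ->
  rotation_average f F -> x != 0 ->
  (\int[nu]_y (W y * f (x *m Q y))%:E = (F x)%:E)%E.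
Proof.
move=> fp Fp fF x0; have ex0 : 0 < enorm x by rewrite enorm_gt0.
have [mf fh _] := fp; set v := (enorm x)^-1 *: x.
have v1 : esphere v by exact: enorm_normalize.
have xE : x = enorm x *: v by rewrite scalerA mulfV ?scale1r// gt_eqF.
rewrite (moment_like_enorm Fp x0) EFinM -fF// -ge0_integralZl_EFin ?powR_ge0//.
- apply: eq_integral => y _; rewrite -EFinM; congr EFin.
  by rewrite [in LHS]xE -scalemxAl fh// mulrCA.
- move=> y _; rewrite lee_fin mulr_ge0// ltW//; apply: (moment_like_gt0 fp).
  by rewrite -enorm_gt0 enorm_mulmx_orthonormal// v1 ltr01.
- apply/measurable_EFinP/measurable_funM => //.
  by apply: (measurableT_comp mf); exact: measurable_rV_mulmx.
Qed.

Variables (p q b : R) (fB FB : 'rV[R]_m -> R).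
Hypothesis q_range : q <= 0 \/ 1 <= q.
Hypotheses (fBp : moment_like p fB) (FBp : moment_like p FB).
Hypothesis fFB : rotation_average fB FB.
Hypothesis fB_const : forall u, esphere u -> fB u = b.

(** The mass M of [W] is read off from the ball: [fB] is constant on spheres, so FB = M fB there.
    With c = M^q the bound is sharp for the ball, and the same c serves every pair f, F. *)
Lemma jensen_rotation_average : exists2 c : R, 0 <= c &
  c * annulus_moment q fB <= annulus_moment q FB /\
  forall f F, moment_like p f -> moment_like p F -> rotation_average f F ->
    annulus_moment q F <= c * annulus_moment q f.
Proof.
have [u u1] := @esphere_neq0 R m m_gt0.
have u0 : u != 0 by rewrite -enorm_gt0 u1.
have b0 : 0 < b by rewrite -(fB_const u1) (moment_like_gt0 fBp).
have mWE : measurable_fun setT (fun y => (W y)%:E) by exact/measurable_EFinP.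
have WE0 y : (0 <= (W y)%:E)%E by rewrite lee_fin.
have fBE x : x != 0 -> fB x = enorm x `^ p * b.
  move=> x0; rewrite (moment_like_enorm fBp x0) fB_const//.
  exact: enorm_normalize.
have xQ (x : 'rV[R]_m) y : x != 0 -> x *m Q y != 0.
  by move=> x0; rewrite -enorm_gt0 enorm_mulmx_orthonormal ?enorm_gt0.
have fBQ x y : x != 0 -> fB (x *m Q y) = fB x.
  by move=> x0; rewrite (fBE _ (xQ x y x0)) (fBE _ x0) enorm_mulmx_orthonormal.
have bW x : x != 0 -> (\int[nu]_y (W y)%:E * (fB x)%:E = (FB x)%:E)%E.
  move=> x0; rewrite -(rotation_average_neq0 fBp FBp fFB x0) -ge0_integralZr//.
    by apply: eq_integral => y _; rewrite fBQ// EFinM.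
  by rewrite lee_fin ltW// (moment_like_gt0 fBp).
pose M := FB u / b.
have M0 : 0 < M by rewrite divr_gt0// (moment_like_gt0 FBp).
have WM : (\int[nu]_y (W y)%:E = M%:E)%E.
  have := bW u u0; rewrite fB_const// => /(congr1 (fun z => z * (b^-1)%:E)%E).
  by rewrite -muleA -!EFinM mulfV ?mule1// gt_eqF.
exists (M `^ q); first exact: powR_ge0.
split.
  have Mq0 : 0 < M `^ q by exact: powR_gt0.
  rewrite -ler_pdivlMl//; apply: ler_annulus_moment fBp FBp _ _.
    by rewrite invr_ge0 ltW.
  move=> x Ax; have x0 := annulus_neq0 Ax.
  have := bW x x0; rewrite WM -EFinM => -[<-].
  have fx0 := ltW (moment_like_gt0 fBp x0).
  by rewrite (powRM _ (ltW M0) fx0) mulKf// gt_eqF.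
move=> f F fp Fp fF; have [mf _ _] := fp; have [mF _ _] := Fp.
have [[c1 c2] /= c0 fc] := moment_like_annulus fp.
have FE x : annulus x -> (\int[nu]_y (W y * f (x *m Q y))%:E = (F x)%:E)%E.
  by move=> /annulus_neq0 x0; exact: (rotation_average_neq0 fp Fp fF x0).
have := jensen_annulus mW W_ge0 mQ QQ mf c0 fc M0 WM FE q_range mF.
have ff := annulus_moment_fin_num q fp; have Ff := annulus_moment_fin_num q Fp.
by rewrite /annulus_moment -(fineK ff) -(fineK Ff) -EFinM lee_fin.
Qed.

End annulus_moment.

(** * Rotations in the complex lines *)

Section planar_rotation.
Context {R : realType} {m : nat} (J : 'M[R]_m).
Hypotheses (JJ : J *m J^T = 1%:M) (JT : J^T = - J).

(* (s + t J) / |(s, t)|; the last summand makes it 1 at (0, 0), where the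
   others vanish since x / 0 = 0. *)
Definition planar_rotation (s t : R) : 'M[R]_m :=
  let r := Num.sqrt (s ^+ 2 + t ^+ 2) in
  (s / r)%:M + (t / r) *: J + (\1_[set 0 : R] r)%:M.

Lemma sqr_sqrt_sum2 (s t : R) : Num.sqrt (s ^+ 2 + t ^+ 2) ^+ 2 = s ^+ 2 + t ^+ 2.
Proof. by rewrite sqr_sqrtr// addr_ge0 ?sqr_ge0. Qed.

Lemma sqrt_sum2_eq0 (s t : R) : Num.sqrt (s ^+ 2 + t ^+ 2) = 0 -> s = 0 /\ t = 0.
Proof.
move=> r0; have := sqr_sqrt_sum2 s t; rewrite r0 expr0n/= => /esym/eqP.
by rewrite paddr_eq0 ?sqr_ge0// !sqrf_eq0 => /andP[/eqP-> /eqP->].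
Qed.

Lemma planar_rotation_orthogonal s t :
  planar_rotation s t *m (planar_rotation s t)^T = 1%:M.
Proof.
rewrite /planar_rotation; set r := Num.sqrt _.
have [r0|r0] := eqVneq r 0.
  by rewrite r0 invr0 !mulr0 scale0r raddf0 !add0r indicE mem_set// tr_scalar_mx mulmx1.
rewrite indicE memNset; last by move=> /= /eqP; rewrite (negbTE r0).
rewrite raddf0 addr0 linearD/= linearZ/= tr_scalar_mx JT.
have J2 : J *m J = - 1%:M by rewrite -JJ JT mulmxN opprK.
rewrite mulmxDl !mulmxDr mul_scalar_mx !scale_scalar_mx.
rewrite mul_scalar_mx mul_mx_scalar -scalemxAl -scalemxAr mulmxN J2 opprK.
rewrite !scalerN !scalerA addrA subrK scalemx1.
rewrite -raddfD; congr _%:M.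
have /eqP := sqr_sqrt_sum2 s t; rewrite -/r => /eqP h.
have -> : s / r * (s / r) + t / r * (t / r) = (s ^+ 2 + t ^+ 2) / r ^+ 2.
  by field.
by rewrite -h mulfV// expf_neq0.
Qed.

Lemma planar_rotationE s t (u : 'rV[R]_m) :
  s *: u + t *: (u *m J) = Num.sqrt (s ^+ 2 + t ^+ 2) *: (u *m planar_rotation s t).
Proof.
rewrite /planar_rotation; have [r0|r0] := eqVneq (Num.sqrt (s ^+ 2 + t ^+ 2)) 0.
  by rewrite r0; case: (sqrt_sum2_eq0 r0) => -> ->; rewrite !scale0r addr0.
rewrite indicE memNset; last by move=> /= /eqP; rewrite (negbTE r0).
rewrite raddf0 addr0 mulmxDr mul_mx_scalar -scalemxAr scalerDr !scalerA.
by rewrite !(mulrC (Num.sqrt _)) !divfK.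
Qed.

Lemma measurable_planar_rotation d (T : measurableType d) (f g : T -> R) i j :
  measurable_fun setT f -> measurable_fun setT g ->
  measurable_fun setT (fun z => planar_rotation (f z) (g z) i j).
Proof.
move=> mf mg.
have mr : measurable_fun setT (fun z => Num.sqrt (f z ^+ 2 + g z ^+ 2)).
  apply: (measurableT_comp measurable_sqrtr).
  by apply: measurable_funD; exact: measurable_funX.
have mV : measurable_fun setT (fun z => (Num.sqrt (f z ^+ 2 + g z ^+ 2))^-1).
  under eq_fun do rewrite -powR_inv1 ?sqrtr_ge0//.
  exact: (measurableT_comp (measurable_powR _) mr).
under eq_fun do rewrite !mxE !mulrb.
apply: measurable_funD; first apply: measurable_funD.
- by case: (i == j) => //; exact: measurable_funM.
- by apply: measurable_funM => //; exact: measurable_funM.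
- by case: (i == j) => //; exact: measurable_indic_comp.
Qed.

End planar_rotation.

(** * Averaging formula for zonotope norms *)

Section zonotope.
Context {R : realType} {m l : nat}.
Local Notation leb := (lebesgue_rV R).
Variables (J : 'M[R]_m).
Hypotheses (JJ : J *m J^T = 1%:M) (JT : J^T = - J).
Variables (alpha beta : 'rV[R]_l).

(** The support function of the sum of the segments joining the points (alpha_i, beta_i) to their
    opposites. *)
Definition zonotope_norm (s t : R) : R := \sum_i `|s * alpha 0 i + t * beta 0 i|.

Lemma measurable_zonotope_norm :
  measurable_fun setT (fun z : R * R => zonotope_norm z.1 z.2).
Proof.
apply: measurable_sum => i.
apply: (measurableT_comp (@normr_measurable R setT)).
by apply: measurable_funD; apply: measurable_funM.
Qed.

Lemma zonotope_normZ c s t : zonotope_norm (c * s) (c * t) = `|c| * zonotope_norm s t.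
Proof.
rewrite /zonotope_norm mulr_sumr; apply: eq_bigr => i _.
by rewrite -normrM mulrDr !mulrA.
Qed.

Local Notation abs1 := (fun s _ : R => `|s|).
Local Notation sy y := (dot alpha y).
Local Notation ty y := (dot beta y).
Local Notation ry y := (Num.sqrt (sy y ^+ 2 + ty y ^+ 2)).

(** For fixed y the random linear form is the inner product of x with sy u + ty uJ, a multiple of a
    rotated u. The order of quantifiers matters: one [W] serves all bodies. *)
Lemma zonotope_rotation_average (p : R) : -1 < p < 1 -> p != 0 ->
  pregauge zonotope_norm -> exists W : 'rV[R]_l -> R,
  [/\ measurable_fun setT W, forall y, 0 <= W y &
  forall K,
    moment_like p (fun u => fine (emoment abs1 J p K u)) -> measurable K ->
    (forall u, esphere u -> emoment abs1 J p K u \is a fin_num) ->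
    (forall u, esphere u -> emoment zonotope_norm J p K u \is a fin_num) ->
    rotation_average (leb l) W
      (fun y => planar_rotation J (sy y) (ty y))
      (fun u => fine (emoment abs1 J p K u))
      (fun u => fine (emoment zonotope_norm J p K u))].
Proof.
move=> p1 p0 pN; have [c c0 hc] := @cauchy_density_powR R l p p1 p0.
have ms : measurable_fun setT (fun y : 'rV[R]_l => sy y) by exact: measurable_dot.
have mt : measurable_fun setT (fun y : 'rV[R]_l => ty y) by exact: measurable_dot.
have mr : measurable_fun setT (fun y : 'rV[R]_l => ry y).
  apply: (measurableT_comp measurable_sqrtr).
  by apply: measurable_funD; exact: measurable_funX.
(* c^-1 normalises the Cauchy average, and ry^p is the factor that homogeneity extracts when sy u +
   ty uJ is replaced by its unit direction. *)
exists (fun y => c^-1 * cauchy_density y * ry y `^ p); split.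
- apply: measurable_funM; last exact: (measurableT_comp (measurable_powR _) mr).
  by apply: measurable_funM => //; exact: measurable_cauchy_density.
- by move=> y; rewrite !mulr_ge0 ?invr_ge0 ?powR_ge0 ?ltW ?cauchy_density_gt0.
move=> K fp mK ff Ff u u1; rewrite fineK; last exact: Ff.
have cp : pregauge abs1 := pregauge_norm_fst.
have u0 : u != 0 by rewrite -enorm_gt0 u1.
have dens0 (y : 'rV[R]_l) := ltW (cauchy_density_gt0 y).
have c'0 : 0 <= c^-1 by rewrite invr_ge0 ltW.
pose g y x : R := c^-1 * cauchy_density y *
  (\1_K x * `|sy y * dot x u + ty y * dot x (u *m J)| `^ p).
have g0 y x : 0 <= g y x by rewrite !mulr_ge0 ?powR_ge0.
pose P (z : 'rV[R]_l * 'rV[R]_m) := (g z.1 z.2)%:E.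
have mP : measurable_fun setT P.
  apply/measurable_EFinP/measurable_funM.
    apply: measurable_funM => //.
    exact: (measurableT_comp (@measurable_cauchy_density R l)).
  apply: measurable_funM; first exact: measurable_indic_comp.
  apply: (measurableT_comp (measurable_powR _)).
  apply: (measurableT_comp (@normr_measurable R setT)).
  by apply: measurable_funD; apply: measurable_funM; exact: measurable_dot.
have P0 z : (0 <= P z)%E by rewrite lee_fin.
transitivity (\int[leb l]_y \int[leb m]_x P (y, x))%E.
  apply: eq_integral => y _.
  have -> : (\int[leb m]_x P (y, x) = (c^-1 * cauchy_density y)%:E *
      emoment abs1 J p K (sy y *: u + ty y *: (u *m J)))%E.
    rewrite /emoment (integral_mulindic _ _ (fun x => gauge_at abs1 J _ x `^ p)).
    transitivity (\int[leb m]_x ((c^-1 * cauchy_density y)%:E * (\1_K x *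
        gauge_at abs1 J (sy y *: u + ty y *: (u *m J)) x `^ p)%:E))%E.
      by apply: eq_integral => x _; rewrite /gauge_at dotDr !dotZr -EFinM.
    apply: ge0_integralZl_EFin => //.
    - by move=> x _; rewrite lee_fin mulr_ge0 ?powR_ge0.
    - apply/measurable_EFinP/measurable_funM; first exact: measurable_indic.
      by apply: measurable_powR_fun; exact: (measurable_gauge_at cp).
    - by rewrite mulr_ge0.
  rewrite planar_rotationE//; set v := u *m _.
  have v1 : esphere v.
    by rewrite /esphere/= enorm_mulmx_orthonormal//; exact: planar_rotation_orthogonal.
  (* Without a direction both sides are 0, because the power p of 0 is 0 for p != 0. *)
  have [r0|r0] := eqVneq (ry y) 0.
    rewrite r0 powR0// mulr0 mul0r scale0r.
    rewrite /emoment integral0_eq ?mule0// => x _.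
    by rewrite /gauge_at dotC dot0l normr0 powR0.
  rewrite emomentZ//; last by rewrite lt_neqAle eq_sym r0 sqrtr_ge0.
  by rewrite EFinM fineK ?ff// EFinM muleA.
rewrite (fubini_tonelli P)// /emoment.
rewrite (integral_mulindic _ _ (fun x => gauge_at zonotope_norm J u x `^ p)).
apply: eq_integral => x _.
transitivity (\int[leb l]_y ((c^-1 * \1_K x)%:E * (cauchy_density y *
    `|dot (dot x u *: alpha + dot x (u *m J) *: beta) y| `^ p)%:E))%E.
  apply: eq_integral => y _; rewrite /P /g/= -EFinM; congr EFin.
  rewrite dotDl !dotZl (mulrC (dot x u)) (mulrC (dot x (u *m J))); ring.
rewrite ge0_integralZl_EFin//; last 3 first.
- by move=> y _; rewrite lee_fin mulr_ge0 ?powR_ge0.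
- apply/measurable_EFinP/measurable_funM; first exact: measurable_cauchy_density.
  apply: (measurableT_comp (measurable_powR _)).
  by apply: (measurableT_comp (@normr_measurable R setT)); exact: measurable_dot.
- by rewrite mulr_ge0.
rewrite hc -EFinM; congr EFin.
rewrite mulrACA mulVf ?gt_eqF// mul1r; congr (_ * _ `^ _).
by apply: eq_bigr => i _; rewrite !mxE.
Qed.

End zonotope.

(** * Piecewise linear interpolation of a convex Lipschitz function *)

Section convex_interpolation.
Context {R : realType}.
Variables (g : R -> R) (c delta t0 : R) (n : nat).
Hypotheses (n_gt0 : (0 < n)%N) (delta_gt0 : 0 < delta).
Hypothesis g_lip : forall x y, g x - g y <= c * `|x - y|.
Hypothesis g_convex : forall x y w, 0 <= w -> w <= 1 ->
  g ((1 - w) * x + w * y) <= (1 - w) * g x + w * g y.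

Definition interp_node (i : nat) : R := t0 + i%:R * delta.

(** Piece 0 lies to the left of node 0 and piece n + 1 to the right of node n. These unbounded
    pieces get the extreme slopes -c and c of a c-Lipschitz function, so that the slopes are
    nondecreasing. *)
Definition interp_slope (i : nat) : R :=
  if i is j.+1 then
    if (j < n)%N then (g (interp_node j.+1) - g (interp_node j)) / delta else c
  else - c.

Definition interp_jump (i : nat) : R := interp_slope i.+1 - interp_slope i.

Local Notation node := interp_node.
Local Notation slope := interp_slope.
Local Notation jump := interp_jump.

Lemma interp_nodeS i : node i.+1 = node i + delta.
Proof. by rewrite /interp_node -natr1 mulrDl mul1r addrA. Qed.

Lemma interp_node0 : node 0 = t0.
Proof. by rewrite /interp_node mul0r addr0. Qed.

Lemma interp_node_le i j : (i <= j)%N -> node i <= node j.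
Proof. by move=> ij; rewrite lerD2l ler_wpM2r ?(ltW delta_gt0)// ler_nat. Qed.

(** Inner jumps are nonnegative by convexity at the midpoint of two adjacent intervals, the two
    outer ones by the Lipschitz bound. *)
Lemma interp_jump_ge0 i : (i <= n)%N -> 0 <= jump i.
Proof.
have lip j : g (node j.+1) - g (node j) <= c * delta /\
    g (node j) - g (node j.+1) <= c * delta.
  split; apply: le_trans (g_lip _ _) _; rewrite interp_nodeS.
    by rewrite addrC addKr ger0_norm// ltW.
  by rewrite opprD addrA subrr sub0r normrN ger0_norm// ltW.
rewrite /interp_jump subr_ge0 => ij; rewrite /interp_slope.
case: i ij => [_|i ij].
  by rewrite n_gt0 ler_pdivlMr// mulNr lerNl opprB; case: (lip 0%N).
rewrite ij; case: ifP => ij'; last first.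
  by rewrite ler_pdivrMr//; case: (lip i).
rewrite ler_pM2r ?invr_gt0//.
have := @g_convex (node i) (node i.+2) (2^-1).
have -> : (1 - 2^-1) * node i + 2^-1 * node i.+2 = node i.+1.
  by rewrite !interp_nodeS; field.
have h0 : (0 : R) <= 2^-1 by rewrite invr_ge0.
have h1 : (2^-1 : R) <= 1 by rewrite invf_le1// ler1n.
move=> /(_ h0 h1).
have -> : 1 - 2^-1 = 2^-1 :> R by field.
rewrite -mulrDr ler_pdivlMl// => h; lra.
Qed.

Lemma sum_interp_jump : \sum_(i < n.+1) jump i = 2 * c.
Proof.
have h j : \sum_(i < j) jump i = slope j + c.
  elim: j => [|j IH]; first by rewrite big_ord0 /= addNr.
  by rewrite big_ord_recr IH [LHS]addrC addrA subrK.
by rewrite h /= ltnn; lra.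
Qed.

(* The summands are jumps times positive parts, so that only the nodes to the
   left of t contribute. *)
Definition interp_partial (j : nat) (t : R) : R :=
  g t0 - c * (t - t0) + \sum_(i < j) jump i * ((`|t - node i| + (t - node i)) / 2).

Local Notation partial := interp_partial.

Lemma interp_partialS j t : (j <= n)%N -> node j <= t ->
  partial j.+1 t = g (node j) + slope j.+1 * (t - node j).
Proof.
elim: j => [|j IH] jn jt; rewrite /interp_partial big_ord_recr [X in _ + (_ + X)]/=.
  rewrite big_ord0 add0r ger0_norm ?subr_ge0// interp_node0.
  by rewrite /interp_jump [slope 0]/=; move: (slope 1) => s; field.
rewrite addrA -/(partial j.+1 t) IH ?(ltnW jn)//; last first.
  by apply: le_trans jt; exact: interp_node_le.
rewrite ger0_norm ?subr_ge0// /interp_jump.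
have -> : slope j.+1 = (g (node j.+1) - g (node j)) / delta by rewrite /interp_slope jn.
rewrite interp_nodeS; field.
by rewrite gt_eqF.
Qed.

Lemma interp_partial_le j t : t <= node j -> forall k, partial (j + k) t = partial j t.
Proof.
move=> tj; elim => [|k IH]; first by rewrite addn0.
rewrite addnS /interp_partial big_ord_recr /= addrA -/(partial _ t) IH.
have tk : t - node (j + k) <= 0.
  by rewrite subr_le0 (le_trans tj)// interp_node_le// leq_addr.
by rewrite ler0_norm// addNr mul0r mulr0 addr0.
Qed.

Lemma interp_cases t : [\/ t <= node 0, node n <= t |
  exists2 j, (j < n)%N & node j <= t <= node j.+1].
Proof.
have [h|h] := leP t (node 0); first exact: Or31.
suff H k : t <= node k \/ node k <= t -> (k <= n)%N -> node k <= t \/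
    exists2 j, (j < n)%N & node j <= t <= node j.+1.
  by case: (H n) => //; [case: (leP t (node n)) => ?; [left|right; exact: ltW]|exact: Or32|exact: Or33].
elim: k => [|k IH] _ kn; first by left; exact: ltW.
case: IH => [| |kt|]; [|exact: ltnW| |by right].
  by case: (leP t (node k)) => ?; [left|right; exact: ltW].
case: (leP t (node k.+1)) => tk; last by left; exact: ltW.
by right; exists k => //; rewrite kt.
Qed.

(** Between nodes the interpolant is a chord, above g by convexity and within c delta of it by the
    Lipschitz bound. On the unbounded pieces the error does not shrink with delta, so the upper
    bounds there are left as hypotheses. *)
Lemma interp_bounds t (e : R) : c * delta <= e ->
  (t <= node 0 -> g t0 - c * (t - t0) <= g t + e) ->
  (node n <= t -> g (node n) + c * (t - node n) <= g t + e) ->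
  g t <= partial n.+1 t <= g t + e.
Proof.
move=> ce e0 en.
have [h|h|[j jn /andP[h1 h2]]] := interp_cases t.
- have := interp_partial_le h n.+1; rewrite add0n => ->.
  rewrite /interp_partial big_ord0 addr0 e0// andbT.
  rewrite interp_node0 in h.
  have := g_lip t t0; rewrite ler0_norm ?subr_le0//; lra.
- rewrite interp_partialS// /interp_slope ltnn en// andbT.
  have := g_lip t (node n); rewrite ger0_norm ?subr_ge0//; lra.
have := interp_partial_le h2 (n - j); rewrite addSn subnKC ?(ltnW jn)// => ->.
rewrite interp_partialS ?(ltnW jn)// /interp_slope jn.
pose w := (t - node j) / delta.
have w0 : 0 <= w by rewrite divr_ge0 ?subr_ge0// ltW.
have w1 : w <= 1 by rewrite ler_pdivrMr// mul1r lerBlDl -interp_nodeS.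
have wd : t = (1 - w) * node j + w * node j.+1.
  by rewrite interp_nodeS /w; field; rewrite gt_eqF.
have -> : g (node j) + (g (node j.+1) - g (node j)) / delta * (t - node j) =
    (1 - w) * g (node j) + w * g (node j.+1).
  by rewrite /w; field; rewrite gt_eqF.
apply/andP; split; first by rewrite {1}wd g_convex.
have c0 : 0 <= c.
  have := g_lip 1 0; have := g_lip 0 1; rewrite sub0r subr0 normrN normr1; lra.
have l1 : g (node j) <= g t + e.
  have := g_lip (node j) t; rewrite ler0_norm ?subr_le0// => l.
  have : c * - (node j - t) <= c * delta.
    by rewrite ler_wpM2l//; move: h2; rewrite interp_nodeS; lra.
  lra.
have l2 : g (node j.+1) <= g t + e.
  have := g_lip (node j.+1) t; rewrite ger0_norm ?subr_ge0// => l.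
  have : c * (node j.+1 - t) <= c * delta.
    by rewrite ler_wpM2l//; move: h1; rewrite interp_nodeS; lra.
  lra.
have := ler_wpM2l w0 l2.
have w1' : 0 <= 1 - w by rewrite subr_ge0.
have := ler_wpM2l w1' l1; lra.
Qed.

End convex_interpolation.

(** * Plane norms are limits of zonotope norms *)

Section zonotope_approximation.
Context {R : realType}.
Variables (N : R -> R -> R) (nN : planar_norm N).

Let c := N 0 1.
Let g (t : R) := N 1 t.

Let g_lip x y : g x - g y <= c * `|x - y|.
Proof.
rewrite lerBlDl mulrC -planar_norm_0x//.
by have := planar_normD nN 1 y 0 (x - y); rewrite addr0 subrKC.
Qed.

Let g_convex x y w : 0 <= w -> w <= 1 ->
  g ((1 - w) * x + w * y) <= (1 - w) * g x + w * g y.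
Proof.
move=> w0 w1; have v0 : 0 <= 1 - w by rewrite subr_ge0.
have := planar_normD nN ((1 - w) * 1) ((1 - w) * x) (w * 1) (w * y).
by rewrite !(planar_normZ nN) !ger0_norm// !mulr1 subrK.
Qed.

Let g_norm (t : R) : c * `|t| <= g t + N 1 0 /\ g t <= c * `|t| + N 1 0.
Proof.
rewrite !(mulrC c) -planar_norm_0x//; split.
  have := planar_normD nN 1 t (- 1) 0; rewrite subrr addr0.
  have -> : N (- 1) 0 = N 1 0; last by [].
  by rewrite planar_norm_x0// normrN1 mul1r.
by have := planar_normD nN 0 t 1 0; rewrite add0r addr0.
Qed.

(** On the line s = 1 the norm is convex, and its interpolant is a constant K plus a nonnegative
    combination of the |t - node_i|. Homogenising in s gives a zonotope norm with K as coefficient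
    of |s|, whence the need for K >= 0. The lower bound of the norm turns additive errors into
    relative ones. *)
Lemma planar_norm_zonotope (e : R) : 0 < e ->
  exists l (alpha beta : 'rV[R]_l), forall s t,
    N s t <= zonotope_norm alpha beta s t <= (1 + e) * N s t.
Proof.
move=> e0; have [_ _ [a a0 ha]] := nN.
have ea0 : 0 < e * a by exact: mulr_gt0.
have ga t : a <= g t.
  by apply: le_trans (ha 1 t); rewrite normr1 ler_peMr ?lerDl// ltW.
have gat t : a * `|t| <= g t.
  by apply: le_trans (ha 1 t); rewrite ler_pM2l// lerDr.
(* Beyond T the interpolant exceeds g by at most 2 N(1, 0), which is at most e g t since g t >= a
   |t|. Within [-T, T] the number n of intervals makes c delta <= e a. *)
pose T := Num.max 1 (2 * N 1 0 / (e * a)).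
have T0 : 0 < T by rewrite lt_max ltr01.
have TA : 2 * N 1 0 <= e * (a * T).
  by rewrite mulrA [leRHS]mulrC -ler_pdivrMr// le_max lexx orbT.
pose n := (Num.truncn (2 * T * c / (e * a))).+1.
have n0 : 0 < n%:R :> R by rewrite ltr0n.
pose delta := 2 * T / n%:R.
have d0 : 0 < delta by rewrite !mulr_gt0 ?invr_gt0.
have cd : c * delta <= e * a.
  rewrite mulrA ler_pdivrMr// (mulrC c) [leRHS]mulrC -ler_pdivrMr//.
  exact/ltW/truncnS_gt.
pose node := interp_node delta (- T).
have nn : node n = T.
  by rewrite /node /interp_node mulrC divfK ?gt_eqF//; ring.
have node0 : node 0%N = - T by exact: interp_node0.
pose P := interp_partial g c delta (- T) n n.+1.
pose d := interp_jump g c delta (- T) n.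
have Pg t : g t <= P t <= (1 + e) * g t.
  rewrite mulrDl mul1r.
  have far : T <= `|t| -> 2 * N 1 0 <= e * g t.
    move=> Tt; apply: le_trans TA _; rewrite ler_pM2l//.
    by apply: le_trans (gat t); rewrite ler_pM2l.
  have [gt1 _] := g_norm t.
  apply: interp_bounds => //.
  - by apply: le_trans cd _; rewrite ler_pM2l.
  - rewrite -/node node0 => tT; have t0 : t <= 0 by lra.
    move: far gt1; rewrite ler0_norm// lerNr => /(_ tT) h1 h2.
    have [_] := g_norm (- T); rewrite normrN gtr0_norm//; lra.
  - rewrite -/node nn => tT; have t0 : 0 <= t by lra.
    move: far gt1; rewrite ger0_norm// => /(_ tT) h1 h2.
    have [_] := g_norm T; rewrite gtr0_norm//; lra.
have sd : \sum_(i < n.+1) d i = 2 * c by exact: sum_interp_jump.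
(* What is left of the interpolant besides absolute values: the total jump 2 c makes the terms
   linear in t cancel. *)
pose K := g (- T) - c * T - (\sum_(i < n.+1) d i * node i) / 2.
have PE t : P t = K + \sum_(i < n.+1) d i / 2 * `|t - node i|.
  rewrite /P /interp_partial -/d -/node /K.
  have -> : \sum_(i < n.+1) d i * ((`|t - node i| + (t - node i)) / 2) =
      \sum_(i < n.+1) d i / 2 * `|t - node i| + (t / 2 * \sum_(i < n.+1) d i -
      (\sum_(i < n.+1) d i * node i) / 2).
    rewrite mulr_sumr mulr_suml -sumrB -big_split/=; apply: eq_bigr => i _.
    by field.
  by rewrite sd; field.
have dge0 (i : 'I_n.+1) : 0 <= d i.
  by apply: interp_jump_ge0 => //; rewrite -ltnS.
(* At t = T, to the right of all nodes, P and g agree. Adding this relation to the definition of K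
   eliminates the weighted sum of the nodes: 2 K = g T + g (- T) - 2 c T, nonnegative by the
   triangle inequality. *)
have K0 : 0 <= K.
  have PT : P T = g T.
    rewrite -{1}nn /P interp_partialS ?ltnn// -/node nn.
    by rewrite subrr mulr0 addr0.
  have := PE T; rewrite PT.
  have -> : \sum_(i < n.+1) d i / 2 * `|T - node i| =
      T / 2 * (\sum_(i < n.+1) d i) - (\sum_(i < n.+1) d i * node i) / 2.
    rewrite mulr_sumr mulr_suml -sumrB; apply: eq_bigr => i _.
    rewrite ger0_norm; first by field.
    by rewrite subr_ge0 -nn; apply: interp_node_le => //; rewrite -ltnS.
  rewrite sd /K.
  have h : 2 * (c * T) <= g T + g (- T).
    have := planar_normD nN 1 T (- 1) T; rewrite subrr.
    rewrite planar_norm_0x// gtr0_norm ?addr_gt0//.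
    have -> : N (- 1) T = g (- T).
      by have := planar_normZ nN (-1) 1 (- T); rewrite normrN1 mul1r mulr1 mulN1r opprK.
    by rewrite -/c -/(g T); lra.
  move: (\sum_(i < n.+1) d i * node i) h => S; lra.
exists n.+2, (rV_cons (K, \row_(i < n.+1) (- (d i / 2 * node i)))),
  (rV_cons (0, \row_(i < n.+1) (d i / 2))) => s t.
have -> : zonotope_norm (rV_cons (K, \row_(i < n.+1) (- (d i / 2 * node i))))
    (rV_cons (0, \row_(i < n.+1) (d i / 2))) s t =
    `|s| * K + \sum_(i < n.+1) d i / 2 * `|t - s * node i|.
  rewrite /zonotope_norm big_ord_recl !rV_cons0 mulr0 addr0 normrM (ger0_norm K0).
  congr (_ + _); apply: eq_bigr => i _; rewrite !rV_consS !mxE.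
  have di : 0 <= d i / 2 by rewrite divr_ge0.
  rewrite -[X in X * `|_|](ger0_norm di) -normrM; congr (`|_|); ring.
(* On the axis s = 0 the total jump 2 c gives c |t|, which is N 0 t exactly. *)
have [->|s0] := eqVneq s 0.
  rewrite normr0 mul0r add0r.
  have -> : \sum_(i < n.+1) d i / 2 * `|t - 0 * node i| = N 0 t.
    under eq_bigr do rewrite mul0r subr0 -mulrA.
    by rewrite -mulr_suml sd planar_norm_0x// -/c; field.
  by rewrite lexx ler_peMl ?planar_norm_ge0// lerDl ltW.
have -> : `|s| * K + \sum_(i < n.+1) d i / 2 * `|t - s * node i| = `|s| * P (t / s).
  rewrite PE [RHS]mulrDr mulr_sumr; congr (_ + _); apply: eq_bigr => i _.
  by rewrite mulrCA -normrM mulrBr mulrCA mulfV// mulr1.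
have -> : N s t = `|s| * g (t / s).
  by rewrite -(planar_normZ nN) mulr1 mulrCA mulfV// mulr1.
by rewrite mulrCA !ler_pM2l ?normr_gt0// Pg.
Qed.

End zonotope_approximation.

(** * Hyperplane sections as a moment of degree -1 *)

Lemma ge0_integral_lebesgue_dilation (R : realType) (f : R -> \bar R) (t : R) :
  0 < t -> measurable_fun setT f -> (forall x, 0 <= f x)%E ->
  (\int[@lebesgue_measure R]_x f x =
   t%:E * \int[@lebesgue_measure R]_x f (t * x)%R)%E.
Proof.
move=> t0 mf f0; rewrite ge0_integral_lebesgue_mull_gt0//.
by rewrite muleA -EFinM mulfV ?mul1e// gt_eqF.
Qed.

Section sections.
Context {R : realType} {k : nat}.
Local Notation leb := (lebesgue_rV R).
Implicit Types (K : set 'rV[R]_k.+1) (u x : 'rV[R]_k.+1).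

(** Uses the Householder frame, measurable in u, instead of the chosen frame of [section_vol];
    [section_vol_moment] identifies the two on the sphere. *)
Definition section_measure K u : \bar R :=
  leb k [set y | K (y *m householder_frame u)].

Definition section_moment K x : R :=
  (enorm x)^-1 * fine (section_measure K ((enorm x)^-1 *: x)).

Lemma measurable_section K u : measurable K ->
  measurable [set y : 'rV[R]_k | K (y *m householder_frame u)].
Proof.
move=> mK; rewrite -[X in measurable X]setTI.
by apply: (@measurable_rV_mulmx_cst _ _ _ _ _ _ (householder_frame u)) => //; exact: measurable_id.
Qed.

Lemma measurable_section_measure K : measurable K ->
  measurable_fun setT (section_measure K).
Proof.
move=> mK.
pose P (z : 'rV[R]_k.+1 * 'rV[R]_k) : \bar R := (\1_K (z.2 *m householder_frame z.1))%:E.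
have mP : measurable_fun setT P.
  apply/measurable_EFinP/measurable_indic_comp => //.
  apply: measurable_rV_mulmx => // i j.
  exact: (measurableT_comp (measurable_householder_frame i j)).
have P0 z : (0 <= P z)%E by rewrite lee_fin.
rewrite (_ : section_measure K = fun u => \int[leb k]_y P (u, y))%E.
  exact: (measurable_fun_fubini_tonelli_F P).
apply/funext => u; rewrite /section_measure -[X in leb k X]setIT -integral_indic//.
exact: measurable_section.
Qed.

Lemma section_measure_bounds K : fat_bounded K ->
  exists2 c : R * R, 0 < c.1 & forall u, esphere u ->
    (c.1%:E <= section_measure K u <= c.2%:E)%E.
Proof.
move=> [mK [r r0 rK] [r' r'0 Kr']].
have l0 := lebesgue_eballr_gt0 k r0; have loo := lebesgue_eballr_lty k (ltW r0).
have l'oo := lebesgue_eballr_lty k r'0.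
exists (fine (leb k (@eballr R k r)), fine (leb k (@eballr R k r'))).
  by rewrite fine_gt0// l0.
move=> u u1; have [BB _] := householder_is_frame u1.
have mS := measurable_section u mK.
rewrite !fineK ?ge0_fin_numE//; apply/andP; split; apply: le_measure.
- by rewrite inE; exact: measurable_eballr.
- by rewrite inE.
- by move=> y yr; apply: rK; rewrite /eballr/= enorm_mulmx_orthonormal.
- by rewrite inE.
- by rewrite inE; exact: measurable_eballr.
- by move=> y /= /Kr'; rewrite /eballr/= enorm_mulmx_orthonormal.
Qed.

Lemma section_momentE K u : esphere u -> section_moment K u = fine (section_measure K u).
Proof. by move=> u1; rewrite /section_moment u1 invr1 mul1r scale1r. Qed.

Lemma section_measure_fin K u : fat_bounded K -> esphere u ->
  section_measure K u = (section_moment K u)%:E.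
Proof.
move=> fK u1; rewrite section_momentE// fineK//.
have [c c0 /(_ u u1)/andP[h1 h2]] := section_measure_bounds fK.
rewrite ge0_fin_numE; first exact: le_lt_trans h2 (ltry _).
by apply: le_trans h1; rewrite lee_fin ltW.
Qed.

Lemma section_vol_moment K u : measurable K -> esphere u ->
  section_vol K u = section_moment K u.
Proof.
move=> mK u1; rewrite section_momentE//.
by rewrite (section_volE u1 (householder_is_frame u1)).
Qed.

Lemma moment_like_section K : fat_bounded K -> moment_like (-1) (section_moment K).
Proof.
move=> fK; have [mK _ _] := fK; split.
- have mV : measurable_fun setT (fun x : 'rV[R]_k.+1 => (enorm x)^-1).
    under eq_fun do rewrite -powR_inv1 ?enorm_ge0//.
    by apply: measurable_powR_fun; exact: measurable_enorm.
  apply: measurable_funM => //.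
  apply: (measurableT_comp (fine_measurable (D := setT) measurableT)).
  apply: (measurableT_comp (measurable_section_measure mK)).
  exact: measurable_rV_scale.
- move=> t x t0; rewrite /section_moment enormZ gtr0_norm// powR_inv1 ?ltW//.
  by rewrite invfM scalerA [_ * t]mulrAC mulVf ?mul1r ?gt_eqF// mulrA.
- have [c c0 hc] := section_measure_bounds fK; exists c => // u u1.
  by have := hc u u1; rewrite section_measure_fin// !lee_fin.
Qed.

End sections.

(** * Hyperplanes containing the complement of a fixed plane *)

Section orthonormal_pair.
Context {R : realType} {k : nat}.
Local Notation leb := (lebesgue_rV R).
Local Notation mu := (@lebesgue_measure R).
Variables (u w : 'rV[R]_k.+2).
Hypotheses (u1 : enorm u = 1) (w1 : enorm w = 1) (uw : dot u w = 0).

Let B := householder_frame u.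
Let uB : is_frame u B := householder_is_frame u1.
Let v := w *m B^T.

Let vB : v *m B = w.
Proof.
rewrite /v -mulmxA (frame_tr_mul u1 uB) mulmxBr mulmx1 mulmxA mulmx_tr11 dotC uw.
by rewrite -scalemx1 scale0r mul0mx subr0.
Qed.

Let v1 : enorm v = 1.
Proof. by rewrite -w1 -vB enorm_mulmx_orthonormal//; case: uB. Qed.

Let vF : is_frame v (householder_frame v) := householder_is_frame v1.

(** An orthonormal basis of the complement of the plane of u and w, from two nested hyperplane
    frames: v holds the coordinates of w in the frame of the first. *)
Definition pair_frame : 'M[R]_(k, k.+2) := householder_frame v *m B.

Local Notation D := pair_frame.

Lemma pair_frame_orthonormal : D *m D^T = 1%:M.
Proof.
case: uB vF => BB _ [FF _].
by rewrite /D trmx_mul mulmxA -(mulmxA _ B) BB mulmx1.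
Qed.

Lemma pair_frame_mul1 : D *m u^T = 0.
Proof. by case: uB => _ Bu; rewrite /D -mulmxA Bu mulmx0. Qed.

Lemma pair_frame_mul2 : D *m w^T = 0.
Proof.
case: vF => _ Fv; rewrite /D -mulmxA.
by rewrite -[B *m w^T]trmxK trmx_mul trmxK -/v.
Qed.

Lemma ge0_integral_pair_frame (f : 'rV[R]_k.+2 -> \bar R) :
  measurable_fun setT f -> (forall x, 0 <= f x)%E ->
  (\int[leb k.+2]_x f x = \int[mu]_a \int[mu]_b \int[leb k]_z
     f (a *: u + b *: w + z *m D)%R)%E.
Proof.
move=> mf f0; rewrite (ge0_integral_frame u1 uB mf f0).
apply: eq_integral => a _.
have mg : measurable_fun setT (fun y : 'rV[R]_k.+1 => f (a *: u + y *m B)).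
  have mt : measurable_fun setT (fun y : 'rV[R]_k.+1 => a *: u + y *m B).
    by apply: measurable_rV_add => //; exact: measurable_rV_mulmx_cst.
  exact: (measurableT_comp mf mt).
transitivity (\int[mu]_b \int[leb k]_z
    f (a *: u + (b *: v + z *m householder_frame v) *m B)%R)%E.
  exact: (ge0_integral_frame v1 vF mg (fun y => f0 _)).
apply: eq_integral => b _; apply: eq_integral => z _; congr f.
by rewrite mulmxDl -scalemxAl vB addrA -mulmxA.
Qed.

(** Kept in the shape of the radius inside [planar_rotation J (- s) 1]. *)
Let r (s : R) := Num.sqrt ((- s) ^+ 2 + 1 ^+ 2).

Let sqr_r s : r s ^+ 2 = s ^+ 2 + 1.
Proof. by rewrite sqr_sqrt_sum2 sqrrN expr1n. Qed.

Let r_gt0 s : 0 < r s.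
Proof. by rewrite sqrtr_gt0 sqrrN expr1n ltr_wpDl ?sqr_ge0. Qed.

(** With the rows of [D], this unit vector spans the hyperplane orthogonal to - s u + w, which meets
    the plane of u and w in the line of slope s. *)
Let a (s : R) := (r s)^-1 *: (u + s *: w).

Let C (s : R) : 'M[R]_(k.+1, k.+2) := col_mx (a s : 'M[R]_(1, k.+2)) D.

Let dot_uu := enorm1_dot u1.
Let dot_ww := enorm1_dot w1.

Let C_frame s : is_frame ((r s)^-1 *: (- s *: u + w)) (C s).
Proof.
have r0 := r_gt0 s; have wu : dot w u = 0 by rewrite dotC.
have aa : dot (a s) (a s) = 1.
  rewrite /a dotZl dotZr !(dotDl, dotDr) !(dotZl, dotZr) dot_uu dot_ww uw wu.
  rewrite mulrA -invfM -expr2 sqr_r; field.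
  by rewrite -sqr_r expf_neq0// gt_eqF.
have uD : u *m D^T = 0.
  by apply: trmx_inj; rewrite trmx_mul trmxK pair_frame_mul1 trmx0.
have wD : w *m D^T = 0.
  by apply: trmx_inj; rewrite trmx_mul trmxK pair_frame_mul2 trmx0.
have trD (x : 'rV[R]_k.+2) : x *m D^T = 0 -> D *m x^T = 0.
  by move=> xD; apply: trmx_inj; rewrite trmx_mul trmxK xD trmx0.
have Da : a s *m D^T = 0.
  by rewrite /a -scalemxAl mulmxDl -scalemxAl uD wD scaler0 addr0 scaler0.
have aD := trD _ Da.
set w' := (r s)^-1 *: (- s *: u + w).
have Dw' : D *m w'^T = 0.
  by apply: trD; rewrite /w' -scalemxAl mulmxDl -scalemxAl uD wD scaler0 addr0 scaler0.
have aw' : dot (a s) w' = 0.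
  rewrite /a /w' dotZl dotZr !(dotDl, dotDr) !(dotZl, dotZr) dot_uu dot_ww uw wu.
  ring.
split.
  transitivity (col_mx (a s : 'M[R]_(1, k.+2)) D *m row_mx (a s)^T D^T).
    by congr (_ *m _); exact: (@tr_col_mx R 1 k k.+2 (a s) D).
  rewrite mul_col_row pair_frame_orthonormal aD Da mulmx_tr11 aa.
  exact: esym (scalar_mx_block 1 k 1).
rewrite /C; transitivity (col_mx (a s *m w'^T) (D *m w'^T)).
  exact: (@mul_col_mx R 1 k k.+2 1).
rewrite mulmx_tr11 aw' Dw' raddf0.
exact: (@col_mx0 R 1 k 1).
Qed.

(** Points of the hyperplane are written t (u + s w) + z D; the Jacobian of this parametrisation is
    the length r s of u + s w. *)
Lemma section_measure_pair (K : set 'rV[R]_k.+2) s : measurable K ->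
  section_measure K ((r s)^-1 *: (- s *: u + w)) =
  ((r s)%:E * \int[mu]_t \int[leb k]_z
    (\1_K (t *: u + (t * s) *: w + z *m D))%:E)%E.
Proof.
move=> mK; have r0 := r_gt0 s.
set w' := (r s)^-1 *: _; have w'1 : enorm w' = 1.
  rewrite /enorm (_ : dot w' w' = 1) ?sqrtr1//.
  rewrite /w' dotZl dotZr !(dotDl, dotDr) !(dotZl, dotZr) dot_uu dot_ww uw (dotC w) uw.
  rewrite mulrA -invfM -expr2 sqr_r; field.
  by rewrite -sqr_r expf_neq0// gt_eqF.
rewrite /section_measure (frame_indep w'1 (C_frame s) (householder_is_frame w'1) mK).
have mS : measurable [set y : 'rV[R]_k.+1 | K (y *m C s)].
  rewrite -[X in measurable X]setTI.
  by apply: (@measurable_rV_mulmx_cst _ _ _ _ _ _ (C s)) => //; exact: measurable_id.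
rewrite -[X in leb k.+1 X]setIT -integral_indic//.
pose h (t : R) : \bar R := (\int[leb k]_z (\1_K (t *: a s + z *m D))%:E)%E.
have hE : (\int[leb k.+1]_y (\1_[set y | K (y *m C s)] y)%:E = \int[mu]_t h t)%E.
  rewrite (@ge0_integral_rV_cons _ _ (fun y => (\1_[set y | K (y *m C s)] y)%:E)).
  - apply: eq_integral => t _; apply: eq_integral => z _; congr EFin.
    rewrite !indicE; congr (nat_of_bool _)%:R.
    have -> : t *: a s + z *m D = rV_cons (t, z) *m C s.
      by rewrite -mul_scalar_mx; exact/esym/(@mul_row_col R 1 1 k k.+2 t%:M z (a s) D).
    by apply/idP/idP; rewrite !inE.
  - exact/measurable_EFinP/measurable_indic.
  - by move=> y; rewrite lee_fin.
rewrite hE.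
have mh : measurable_fun setT h.
  pose P (z : measurableTypeR R * 'rV[R]_k) : \bar R := (\1_K (z.1 *: a s + z.2 *m D))%:E.
  apply: (measurable_fun_fubini_tonelli_F P) => [|z]; last by rewrite lee_fin.
  apply/measurable_EFinP/measurable_indic_comp => //; apply: measurable_rV_add.
    exact: measurable_rV_scale.
  exact: measurable_rV_mulmx_cst.
have h0 t : (0 <= h t)%E by apply: integral_ge0 => z _; rewrite lee_fin.
transitivity ((r s)%:E * \int[mu]_t h (r s * t)%R)%E.
  exact: ge0_integral_lebesgue_dilation.
apply: (congr1 (mule (r s)%:E)); apply: eq_integral => t _; rewrite /h.
apply: eq_integral => z _; congr (\1_K (_ + _))%:E.
by rewrite /a scalerA mulrAC mulfV ?gt_eqF// mul1r scalerDr scalerA.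
Qed.

End orthonormal_pair.

(** * The averaging formula for p = -1 *)

Section section_rotation_average.
Context {R : realType}.
Local Notation leb := (lebesgue_rV R).
Local Notation mu := (@lebesgue_measure R).

(* The substitution b = a s in the inner integral. *)
Lemma ge0_integral_slopes (phi psi : measurableTypeR R * measurableTypeR R -> \bar R) :
  measurable_fun setT phi -> measurable_fun setT psi ->
  (forall z, 0 <= phi z)%E -> (forall z, 0 <= psi z)%E ->
  (forall a s, a != 0 -> (`|a|%:E * phi (a, (a * s)%R) = psi (a, s))%E) ->
  (\int[mu]_a \int[mu]_b phi (a, b) = \int[mu]_s \int[mu]_a psi (a, s))%E.
Proof.
move=> mphi mpsi phi0 psi0 phipsi.
have -> : (\int[mu]_s \int[mu]_a psi (a, s) = \int[mu]_a \int[mu]_s psi (a, s))%E.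
  by apply/esym; exact: (fubini_tonelli psi mpsi psi0).
have mD : measurable (setT `\ (0 : R)) by exact: measurableD.
rewrite -(@integral_setD1 _ _ 0%R setT)//; last first.
  by apply: measurable_funTS; exact: (measurable_fun_fubini_tonelli_F phi).
rewrite -[RHS](@integral_setD1 _ _ 0%R setT)//; last first.
  by apply: measurable_funTS; exact: (measurable_fun_fubini_tonelli_F psi).
apply: eq_integral => a; rewrite inE/= => -[_ /eqP a0].
have mphia : measurable_fun setT (fun b => phi (a, b)).
  by apply: (measurableT_comp mphi); exact: measurable_pair1.
have mphia' : measurable_fun setT (fun s : R => phi (a, (a * s)%R)).
  by apply: (measurableT_comp mphia); exact: measurable_funM.
have a0' : 0 < `|a| by rewrite normr_gt0.
transitivity (`|a|%:E * \int[mu]_s phi (a, (a * s)%R))%E.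
  have := @ge0_integral_lebesgue_mull _ (fun b => phi (a, b)) a a0 mphia (fun b => phi0 _).
  move=> ->; by rewrite muleA -EFinM mulfV ?mul1e// gt_eqF.
rewrite -ge0_integralZl_EFin//.
by apply: eq_integral => s _; exact: phipsi.
Qed.

Lemma dot_skew m (J : 'M[R]_m) u : J^T = - J -> dot u (u *m J) = 0.
Proof.
move=> JT; have : dot u (u *m J) = - dot u (u *m J).
  by rewrite -[in LHS](trmxK J) -dot_mulmx JT mulmxN dotNl dotC.
by move/eqP; rewrite -addr_eq0 -mulr2n mulrn_eq0 => /eqP.
Qed.

Variables (k : nat) (J : 'M[R]_k.+2).
Hypotheses (JJ : J *m J^T = 1%:M) (JT : J^T = - J).
Variables (N : R -> R -> R) (nN : planar_norm N).

Let r (s : R) := Num.sqrt ((- s) ^+ 2 + 1 ^+ 2).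

Let r_gt0 s : 0 < r s.
Proof. by rewrite sqrtr_gt0 sqrrN expr1n ltr_wpDl ?sqr_ge0. Qed.

Let N1_gt0 s : 0 < N 1 s.
Proof. by rewrite planar_norm_gt0// oner_eq0. Qed.

(** In N(a, a s) = |a| N(1, s) the factor |a| cancels against the Jacobian of b = a s, leaving 1 /
    N(1, s); the factor 1 / r s converts the slope parametrisation to the measure of the section. *)
Let W (s : R) : R := (N 1 s)^-1 * (r s)^-1.

Let measurable_N1V : measurable_fun setT (fun s : R => (N 1 s)^-1).
Proof.
under eq_fun do rewrite -powR_inv1 ?(ltW (N1_gt0 _))//.
apply: measurable_powR_fun; exact: (measurable_planar_norm nN).
Qed.

Let measurable_W : measurable_fun setT W.
Proof.
apply: measurable_funM; first exact: measurable_N1V.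
under eq_fun do rewrite -powR_inv1 ?(ltW (r_gt0 _))//.
apply: measurable_powR_fun; apply: (measurableT_comp measurable_sqrtr).
by apply: measurable_funD => //; apply: measurable_funX; exact: measurable_funN.
Qed.

Let W_ge0 s : 0 <= W s.
Proof. by apply: mulr_ge0; rewrite invr_ge0 ltW. Qed.

(** N(1, s) >= a (1 + |s|) >= a r s, so W is at most the Cauchy kernel divided by a. *)
Let integral_W : exists c : R, (\int[mu]_s (W s)%:E <= c%:E)%E.
Proof.
have [_ _ [a a0 ha]] := nN; exists (a^-1 * pi).
have mk : measurable_fun setT (fun s : R => (cauchy_kernel s)%:E).
  by apply/measurable_EFinP; exact: measurable_cauchy_kernel.
have k0 (s : R) : (0 <= (cauchy_kernel s)%:E)%E by rewrite lee_fin ltW ?cauchy_kernel_gt0.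
rewrite EFinM -integral_cauchy_kernel.
have -> : (a^-1%:E * \int[mu]_s (cauchy_kernel s)%:E =
    \int[mu]_s (a^-1%:E * (cauchy_kernel s)%:E))%E.
  by apply/esym; apply: ge0_integralZl_EFin => //; rewrite invr_ge0 ltW.
apply: ge0_le_integral => //.
- by move=> s _; rewrite lee_fin.
- exact/measurable_EFinP.
- exact: measurable_funeM.
move=> s _; rewrite -EFinM lee_fin /W.
have rr : r s ^+ 2 = oneDsqr s.
  by rewrite sqr_sqrt_sum2 sqrrN expr1n addrC.
rewrite /cauchy_kernel -rr -!invfM lef_pV2 ?posrE ?mulr_gt0 ?exprn_gt0//.
rewrite expr2 mulrA ler_pM2r//; apply: le_trans (ha 1 s).
rewrite ler_pM2l// normr1 -(@ler_pXn2r _ 2) ?nnegrE ?(ltW (r_gt0 _)) ?addr_ge0//.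
by rewrite rr /oneDsqr sqrrD expr1n mul1r real_normK ?num_real// lerD2r lerDl mulrn_wge0.
Qed.

(** Stated in the extended reals, so that finiteness of the complex moment at p = -1 can be deduced
    from bounded sections and the integrability of [W]. *)
Lemma emoment_sections K u : fat_bounded K -> esphere u ->
  (\int[mu]_s (W s * section_moment K (u *m planar_rotation J (- s) 1))%:E =
   emoment N J (-1) K u)%E.
Proof.
move=> fK u1; have [mK _ _] := fK; have pN := pregauge_planar_norm nN.
pose w := u *m J.
have w1 : enorm w = 1 by rewrite enorm_mulmx_orthonormal.
have uw : dot u w = 0 by exact: dot_skew.
pose D := pair_frame u w.
have Du (z : 'rV[R]_k) : dot (z *m D) u = 0.
  by rewrite /dot -mulmxA pair_frame_mul1// mulmx0 mxE.
have Dw (z : 'rV[R]_k) : dot (z *m D) w = 0.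
  by rewrite /dot -mulmxA pair_frame_mul2// mulmx0 mxE.
pose I (a b : R) : \bar R := (\int[leb k]_z (\1_K (a *: u + b *: w + z *m D))%:E)%E.
have I0 a b : (0 <= I a b)%E by apply: integral_ge0 => z _; rewrite lee_fin.
have mx (a b : R) : measurable_fun setT (fun z : 'rV[R]_k => a *: u + b *: w + z *m D).
  by apply: measurable_rV_add => //; exact: measurable_rV_mulmx_cst.
have mI d (T : measurableType d) (f g : T -> R) : measurable_fun setT f ->
    measurable_fun setT g -> measurable_fun setT (fun t => I (f t) (g t)).
  move=> mf mg.
  pose P (p : T * 'rV[R]_k) : \bar R :=
    (\1_K (f p.1 *: u + g p.1 *: w + p.2 *m D))%:E.
  apply: (measurable_fun_fubini_tonelli_F P) => [|p]; last by rewrite lee_fin.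
  apply/measurable_EFinP/measurable_indic_comp => //.
  apply: measurable_rV_add; last exact: measurable_rV_mulmx_cst.
  apply: measurable_rV_add; apply: measurable_rV_scale => //.
    exact: (measurableT_comp mf).
  exact: (measurableT_comp mg).
pose phi (p : measurableTypeR R * measurableTypeR R) : \bar R := ((N p.1 p.2 `^ (-1))%:E * I p.1 p.2)%E.
pose psi (p : measurableTypeR R * measurableTypeR R) : \bar R := (((N 1 p.2)^-1)%:E * I p.1 (p.1 * p.2)%R)%E.
have mphi : measurable_fun setT phi.
  apply: emeasurable_funM; last exact: mI.
  apply/measurable_EFinP; apply: measurable_powR_fun.
  exact: (measurable_planar_norm nN).
have mpsi : measurable_fun setT psi.
  apply: emeasurable_funM; last by apply: mI => //; exact: measurable_funM.
  apply/measurable_EFinP; exact: (measurableT_comp measurable_N1V measurable_snd).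
have phi0 z : (0 <= phi z)%E by rewrite mule_ge0// lee_fin powR_ge0.
have psi0 z : (0 <= psi z)%E by rewrite mule_ge0// lee_fin invr_ge0 ltW.
pose g x : \bar R := (\1_K x * gauge_at N J u x `^ (-1))%:E.
have mg : measurable_fun setT g.
  apply/measurable_EFinP/measurable_funM; first exact: measurable_indic.
  by apply: measurable_powR_fun; exact: (measurable_gauge_at pN).
have g0 x : (0 <= g x)%E by rewrite lee_fin mulr_ge0// powR_ge0.
have EE : emoment N J (-1) K u = (\int[mu]_a \int[mu]_b phi (a, b))%E.
  rewrite /emoment (integral_mulindic _ _ (fun x => gauge_at N J u x `^ (-1))).
  rewrite (ge0_integral_pair_frame u1 w1 uw mg g0).
  apply: eq_integral => a _; apply: eq_integral => b _; rewrite /phi /=.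
  transitivity (\int[leb k]_z ((N a b `^ (-1))%:E *
      (\1_K (a *: u + b *: w + z *m D))%:E))%E.
    apply: eq_integral => z _; rewrite /g -EFinM mulrC /gauge_at -/w -/D.
    have -> : dot (a *: u + b *: w + z *m D) u = a.
      by rewrite !dotDl !dotZl Du (dotC w) uw enorm1_dot// mulr1 mulr0 !addr0.
    have -> : dot (a *: u + b *: w + z *m D) w = b.
      by rewrite !dotDl !dotZl Dw uw enorm1_dot// mulr1 mulr0 add0r !addr0.
    by [].
  apply: ge0_integralZl_EFin => //; last exact: powR_ge0.
  by apply/measurable_EFinP/measurable_indic_comp.
rewrite EE (ge0_integral_slopes mphi mpsi phi0 psi0); last first.
  move=> a s a0; rewrite /phi /psi /= muleA -EFinM; congr (_%:E * _)%E.
  rewrite powR_inv1 ?planar_norm_ge0//.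
  have -> : N a (a * s) = `|a| * N 1 s by rewrite -(planar_normZ nN) mulr1.
  by rewrite invfM mulrA mulfV ?mul1r// normr_eq0.
apply: eq_integral => s _; rewrite /psi /=.
transitivity (((N 1 s)^-1)%:E * \int[mu]_a I a (a * s)%R)%E; last first.
  apply/esym; apply: ge0_integralZl_EFin => //.
  - by apply: mI => //; exact: measurable_funM.
  - by rewrite invr_ge0 ltW.
have r0 := r_gt0 s.
have uE : u *m planar_rotation J (- s) 1 = (r s)^-1 *: (- s *: u + w).
  rewrite -[X in _ + X]scale1r planar_rotationE// scalerA mulVf ?scale1r//.
  by rewrite gt_eqF.
have e1 : esphere (u *m planar_rotation J (- s) 1).
  rewrite /esphere/= enorm_mulmx_orthonormal//; exact: planar_rotation_orthogonal.
have := section_measure_pair u1 w1 uw s mK; rewrite -/(r s) -uE section_measure_fin//.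
rewrite -/D => h; rewrite EFinM h /W EFinM -muleA; congr (_ * _)%E.
by rewrite muleA -EFinM mulVf ?mul1e// gt_eqF.
Qed.

(** The uniform bound on the moment takes the place of [emoment_upper_lt0], whose Cauchy moment
    diverges at p = -1. *)
Lemma section_rotation_average : exists W : R -> R,
  [/\ measurable_fun setT W, forall s, 0 <= W s &
  forall K, fat_bounded K ->
    (exists c : R, forall u, esphere u -> (emoment N J (-1) K u <= c%:E)%E) /\
    rotation_average mu W (fun s => planar_rotation J (- s) 1)
      (section_moment K) (fun u => fine (emoment N J (-1) K u))].
Proof.
exists W; split => // K fK.
have [c Wc] := integral_W.
have [[c1 c2] /= c10 hc] := section_measure_bounds fK.
have fp := moment_like_section fK; have [mf _ _] := fp.
have bound u : esphere u -> (emoment N J (-1) K u <= (c2 * c)%:E)%E.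
  move=> u1; rewrite -emoment_sections//.
  have e1 s : esphere (u *m planar_rotation J (- s) 1).
    by rewrite /esphere/= enorm_mulmx_orthonormal//; exact: planar_rotation_orthogonal.
  have f2 s : c1 <= section_moment K (u *m planar_rotation J (- s) 1) <= c2.
    by have := hc _ (e1 s); rewrite section_measure_fin// !lee_fin.
  have c20 : 0 <= c2.
    by have /andP[h1 h2] := f2 0; exact: le_trans (ltW c10) (le_trans h1 h2).
  have mu' : measurable_fun setT (fun s : R => u *m planar_rotation J (- s) 1).
    apply: measurable_rV_mulmx => // i j.
    by apply: measurable_planar_rotation => //; exact: measurable_funN.
  have mF := measurableT_comp mf mu'.
  apply: (@le_trans _ _ (\int[mu]_s (c2%:E * (W s)%:E))%E); last first.
    rewrite ge0_integralZl_EFin//.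
    - by rewrite EFinM lee_wpmul2l ?lee_fin.
    - by move=> s _; rewrite lee_fin.
    - exact/measurable_EFinP.
  apply: ge0_le_integral => //.
  - move=> s _; rewrite lee_fin mulr_ge0//.
    by have /andP[h1 _] := f2 s; exact: le_trans (ltW c10) h1.
  - by apply/measurable_EFinP; exact: measurable_funM measurable_W mF.
  - by apply: measurable_funeM; exact/measurable_EFinP.
  - move=> s _; rewrite -EFinM lee_fin mulrC ler_wpM2r//.
    by have /andP[_] := f2 s.
split; first by exists (c2 * c).
move=> u u1; rewrite emoment_sections// fineK//.
rewrite ge0_fin_numE ?emoment_ge0//.
exact: le_lt_trans (bound u u1) (ltry _).
Qed.

End section_rotation_average.

(** * Comparison of the moments of two close gauges *)

Section comparison.
Context {R : realType} {m : nat} (J : 'M[R]_m).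
Hypothesis JJ : J *m J^T = 1%:M.
Local Notation leb := (lebesgue_rV R).
Implicit Types (N : R -> R -> R) (p : R) (K : set 'rV[R]_m).

Lemma moment_like_emoment N p K c : pregauge N -> fat_bounded K ->
  (forall u, esphere u -> (emoment N J p K u <= c%:E)%E) ->
  moment_like p (fun u => fine (emoment N J p K u)) /\
  forall u, u != 0 -> emoment N J p K u \is a fin_num.
Proof.
move=> pN fK up; have [mK _ _] := fK.
have ff u : esphere u -> emoment N J p K u \is a fin_num.
  move=> u1; rewrite ge0_fin_numE ?emoment_ge0//.
  exact: le_lt_trans (up u u1) (ltry _).
have [a a0 lo] := emoment_lower pN JJ p fK.
split; first split.
- apply: (measurableT_comp (fine_measurable (D := setT) measurableT)).
  exact: (measurable_emoment pN).
- by move=> t x t0; rewrite (emomentZ pN)// fine_mule_EFin// powR_gt0.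
- exists (a, c) => // u u1; rewrite -!lee_fin fineK ?ff//=.
  by rewrite lo ?up.
move=> u u0; have e0 : 0 < enorm u by rewrite enorm_gt0.
have -> : u = enorm u *: ((enorm u)^-1 *: u).
  by rewrite scalerA mulfV ?scale1r// gt_eqF.
rewrite (emomentZ pN)// fin_numM// ff//.
exact: enorm_normalize.
Qed.

Lemma le_emoment N N' p K u c : pregauge N -> pregauge N' -> measurable K -> 0 <= c ->
  (forall s t, N s t `^ p <= c * N' s t `^ p) ->
  (emoment N J p K u <= c%:E * emoment N' J p K u)%E.
Proof.
move=> pN pN' mK c0 h.
have mg L : pregauge L -> measurable_fun K (fun x => (gauge_at L J u x `^ p)%:E).
  move=> pL; apply/measurable_EFinP/measurable_funTS/measurable_powR_fun.
  exact: measurable_gauge_at.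
have -> : (c%:E * emoment N' J p K u =
    \int[leb m]_(x in K) (c%:E * (gauge_at N' J u x `^ p)%:E))%E.
  apply/esym; apply: ge0_integralZl_EFin => //; last exact: mg.
  by move=> x _; rewrite lee_fin powR_ge0.
apply: ge0_le_integral.
- exact: mK.
- by move=> x _; rewrite lee_fin powR_ge0.
- exact: mg.
- by apply: measurable_funeM; exact: mg.
- by move=> x _; rewrite -EFinM lee_fin; exact: h.
Qed.

Lemma ler_powR_npos (q a b : R) : q <= 0 -> 0 < a -> a <= b -> b `^ q <= a `^ q.
Proof.
move=> q0 a0 ab; have b0 := lt_le_trans a0 ab.
rewrite -[q]opprK !(powRN _ (- q)) lef_pV2 ?posrE ?powR_gt0//.
by rewrite ge0_ler_powR ?nnegrE ?oppr_ge0 ?(ltW a0) ?(ltW b0).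
Qed.

(* Compares the two functions (in the roles of x and y) after raising to the
   power q = - m / p, which turns the factor lambda ^ p into lambda ^ m. *)
Lemma powR_sandwich p lambda x y : p != 0 -> 0 < lambda -> 0 < x -> 0 < y ->
  (if 0 <= p then x <= y else y <= x) ->
  (if 0 <= p then y <= lambda `^ p * x else x <= lambda `^ (- p) * y) ->
  y `^ (- (m%:R / p)) <= x `^ (- (m%:R / p)) <= lambda ^+ m * y `^ (- (m%:R / p)).
Proof.
move=> p0 l0 x0 y0 h1 h2; set q := - (m%:R / p).
have lq : (lambda `^ (- p)) `^ q = lambda ^+ m.
  by rewrite -powRrM /q mulrNN mulrCA mulfV// mulr1 powR_mulrn// ltW.
have lp0 : 0 < lambda `^ p by exact: powR_gt0.
have lp0' : 0 < lambda `^ (- p) by exact: powR_gt0.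
rewrite -lq -powRM ?(ltW lp0') ?(ltW y0)//.
move: h1 h2; case: (leP 0 p) => hp h1 h2.
  have q0 : q <= 0 by rewrite oppr_le0 divr_ge0.
  apply/andP; split; first exact: ler_powR_npos.
  apply: ler_powR_npos => //; first exact: mulr_gt0.
  by rewrite powRN mulrC ler_pdivrMr// mulrC.
have q0 : 0 <= q by rewrite oppr_ge0 mulr_ge0_le0// invr_le0 ltW.
apply/andP; split; apply: ge0_ler_powR => //; rewrite nnegrE ?(ltW x0) ?(ltW y0)//.
by rewrite mulr_ge0 ?(ltW lp0') ?(ltW y0).
Qed.

(** A larger gauge gives a smaller body whatever the sign of p, since the power q reverses the order
    exactly when the power p preserves it. The factor lambda^m is the effect of a dilation on
    volume. *)
Lemma annulus_moment_compare N N' p K c c' (lambda : R) : p != 0 ->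
  pregauge N -> pregauge N' -> fat_bounded K ->
  (forall u, esphere u -> (emoment N J p K u <= c%:E)%E) ->
  (forall u, esphere u -> (emoment N' J p K u <= c'%:E)%E) ->
  0 < lambda -> (forall s t, N s t <= N' s t <= lambda * N s t) ->
  let q : R := - (m%:R / p) in
  annulus_moment q (fun u => fine (emoment N' J p K u)) <=
    annulus_moment q (fun u => fine (emoment N J p K u)) /\
  annulus_moment q (fun u => fine (emoment N J p K u)) <=
    lambda ^+ m * annulus_moment q (fun u => fine (emoment N' J p K u)).
Proof.
move=> p0 pN pN' fK up up' l0 NN' q; have [mK _ _] := fK.
have [fp ff] := moment_like_emoment pN fK up.
have [fp' ff'] := moment_like_emoment pN' fK up'.
pose F u := fine (emoment N J p K u); pose F' u := fine (emoment N' J p K u).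
rewrite -/F -/F'; rewrite -/F in fp; rewrite -/F' in fp'.
have N0 s t := pregauge_ge0 pN s t; have N0' s t := pregauge_ge0 pN' s t.
have lp0 : 0 < lambda `^ p by exact: powR_gt0.
have lp0' : 0 < lambda `^ (- p) by exact: powR_gt0.
have step L L' d u : pregauge L -> pregauge L' -> u != 0 ->
    emoment L J p K u \is a fin_num -> emoment L' J p K u \is a fin_num -> 0 <= d ->
    (forall s t, L s t `^ p <= d * L' s t `^ p) ->
    fine (emoment L J p K u) <= d * fine (emoment L' J p K u).
  move=> pL pL' u0 lf lf' d0 h.
  by rewrite -lee_fin EFinM (fineK lf) (fineK lf'); exact: le_emoment.
have FF' u : u != 0 -> (if 0 <= p then F u <= F' u else F' u <= F u) /\
    (if 0 <= p then F' u <= lambda `^ p * F u else F u <= lambda `^ (- p) * F' u).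
  move=> u0; have fu := ff u u0; have fu' := ff' u u0.
  case: (leP 0 p) => hp; split.
  - rewrite -[F' u]mul1r; apply: step => // s t; rewrite mul1r.
    by have /andP[h _] := NN' s t; rewrite ge0_ler_powR ?nnegrE.
  - apply: step => //; first exact: ltW.
    move=> s t; rewrite -powRM// ?(ltW l0)//.
    have /andP[_ h] := NN' s t; rewrite ge0_ler_powR ?nnegrE// mulr_ge0// ltW//.
  - rewrite -[F u]mul1r; apply: step => // s t; rewrite mul1r.
    (* For p < 0 the convention that the power of 0 is 0 breaks monotonicity at 0, but N and N'
       vanish together. *)
    have /andP[h1 h2] := NN' s t; have [n0|n0] := eqVneq (N s t) 0.
      have -> : N' s t = 0 by apply/le_anti; rewrite N0' andbT -(mulr0 lambda) -n0.
      by rewrite n0.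
    by apply: ler_powR_npos => //; [exact: ltW|rewrite lt_neqAle eq_sym n0 N0].
  - apply: step => //; first exact: ltW.
    move=> s t; have /andP[h1 h2] := NN' s t; have [n0|n0] := eqVneq (N' s t) 0.
      have -> : N s t = 0 by apply/le_anti; rewrite N0 andbT -n0.
      by rewrite n0 powR0// mulr0.
    have np' : 0 < N' s t by rewrite lt_neqAle eq_sym n0 N0'.
    rewrite mulrC powRN ler_pdivlMr// -powRM// ?(ltW l0)// mulrC.
    by apply: ler_powR_npos => //; exact: ltW.
have main u : u != 0 -> F' u `^ q <= F u `^ q <= lambda ^+ m * F' u `^ q.
  move=> u0; have [h1 h2] := FF' u u0.
  have Fu := moment_like_gt0 fp u0; have Fu' := moment_like_gt0 fp' u0.
  exact: powR_sandwich.
split.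
  rewrite -[leRHS]mul1r; apply: ler_annulus_moment fp' fp _ _ => // x /annulus_neq0 x0.
  by rewrite mul1r; case/andP: (main x x0).
apply: ler_annulus_moment fp fp' _ _; first by rewrite exprn_ge0// ltW.
by move=> x /annulus_neq0 x0; case/andP: (main x x0).
Qed.

End comparison.

(** * The inequality for moments *)

Section busemann.
Context {R : realType} {k : nat}.
Local Notation m := k.+2.
Local Notation leb := (lebesgue_rV R).
Local Notation mu := (@lebesgue_measure R).
Local Notation abs1 := (fun s _ : R => `|s|).
Variables (J : 'M[R]_m) (N : R -> R -> R) (p : R).
Hypotheses (JJ : J *m J^T = 1%:M) (JT : J^T = - J) (nN : planar_norm N).
Hypotheses (p_range : -1 <= p < 1) (p_neq0 : p != 0).

Let q : R := - (m%:R / p).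

(** The lower bound on p enters here: for p < 0 one has - p <= 1 <= m. *)
Let q_range : q <= 0 \/ 1 <= q.
Proof.
have /andP[p1 _] := p_range; rewrite /q; have [p0|p0] := leP 0 p.
  by left; rewrite oppr_le0 divr_ge0.
right; rewrite -mulrN -invrN ler_pdivlMr ?oppr_gt0// mul1r.
by apply: (@le_trans _ _ 1); [rewrite lerNl|rewrite ler1n].
Qed.

Definition real_moment (K : set 'rV[R]_m) : 'rV[R]_m -> R :=
  if p == -1 then section_moment K else fun u => fine (emoment abs1 J p K u).

Definition complex_moment (K : set 'rV[R]_m) : 'rV[R]_m -> R :=
  fun u => fine (emoment N J p K u).

Let emoment_upper L K : pregauge L -> -1 < p -> fat_bounded K ->
  exists c : R, forall u, esphere u -> (emoment L J p K u <= c%:E)%E.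
Proof.
move=> pL p1 fK; have [p0|p0] := leP 0 p; first exact: emoment_upper_ge0.
exact: emoment_upper_lt0.
Qed.

Let p_gt : p != -1 -> -1 < p.
Proof. by have /andP[p1 _] := p_range; rewrite lt_neqAle eq_sym => ->. Qed.

Lemma moment_like_real K : fat_bounded K -> moment_like p (real_moment K).
Proof.
move=> fK; rewrite /real_moment; have [->|pn] := eqVneq p (-1).
  exact: moment_like_section.
have [c hc] := emoment_upper pregauge_norm_fst (p_gt pn) fK.
by have [] := moment_like_emoment JJ pregauge_norm_fst fK hc.
Qed.

Let pN := pregauge_planar_norm nN.

Let complex_upper K : fat_bounded K ->
  exists c : R, forall u, esphere u -> (emoment N J p K u <= c%:E)%E.
Proof.
move=> fK; have [->|pn] := eqVneq p (-1).
  by have [W [_ _ /(_ K fK)[]]] := section_rotation_average JJ JT nN.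
exact: emoment_upper pN (p_gt pn) fK.
Qed.

Lemma moment_like_complex K : fat_bounded K -> moment_like p (complex_moment K).
Proof.
move=> fK; have [c hc] := complex_upper fK.
by have [] := moment_like_emoment JJ pN fK hc.
Qed.

Local Notation ball := (eball R m).

(** The reflection taking the first basis vector to u preserves the ball and Lebesgue measure. For
    sections, an orthonormal frame identifies each of them with the unit ball one dimension
    lower. *)
Lemma real_moment_ball : exists b : R, forall u, esphere u -> real_moment ball u = b.
Proof.
rewrite /real_moment; case: ifP => _.
  exists (fine (leb k.+1 (@eballr R k.+1 1))) => u u1.
  rewrite section_momentE; last exact: u1.
  rewrite /section_measure; apply: (congr1 (fun A => fine (leb k.+1 A))).
  have [BB _] := householder_is_frame u1.
  by apply/seteqP; split => y; rewrite /eballr /eball/= enorm_mulmx_orthonormal.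
pose e0 : 'rV[R]_m := delta_mx 0 0.
exists (fine (emoment abs1 J p ball e0)) => u u1; apply: (congr1 fine).
have pA : pregauge abs1 := pregauge_norm_fst.
have mg (v : 'rV[R]_m) : measurable_fun setT
    (fun x => (\1_(ball : set 'rV[R]_m) x * gauge_at abs1 J v x `^ p)%:E).
  apply/measurable_EFinP/measurable_funM.
    by apply: measurable_indic; exact: measurable_eballr.
  by apply: measurable_powR_fun; exact: (measurable_gauge_at pA).
have HH : householder u *m (householder u)^T = 1%:M.
  by rewrite trmx_householder householderK.
rewrite /emoment !(integral_mulindic _ _ (fun x => gauge_at abs1 J _ x `^ p)).
have g0 x : (0 <= (\1_(ball : set 'rV[R]_m) x * gauge_at abs1 J u x `^ p)%:E)%E.
  by rewrite lee_fin mulr_ge0// powR_ge0.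
transitivity (\int[leb m]_x (\1_(ball : set 'rV[R]_m) (x *m householder u) *
    gauge_at abs1 J u (x *m householder u) `^ p)%:E)%E.
  by apply/esym; exact: (ge0_integral_rV_orthogonal HH (mg u) g0).
apply: eq_integral => x _; rewrite /gauge_at.
have -> : dot (x *m householder u) u = dot x e0.
  by rewrite -[X in dot _ X](householder_row0 u1) dot_mulmx_orthonormal.
rewrite !indicE; congr ((nat_of_bool _)%:R * _)%:E.
by apply/idP/idP; rewrite !inE /eball/= enorm_mulmx_orthonormal.
Qed.

Let fB : fat_bounded ball := fat_bounded_eball.

Let section_case : p = -1 -> exists2 c : R, 0 <= c &
  c * annulus_moment q (real_moment ball) <= annulus_moment q (complex_moment ball) /\
  forall K, fat_bounded K ->
    annulus_moment q (complex_moment K) <= c * annulus_moment q (real_moment K).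
Proof.
move=> pE; have [b hb] := real_moment_ball.
have [W [mW W0 hW]] := section_rotation_average JJ JT nN.
have hK K : fat_bounded K -> rotation_average mu W
    (fun s => planar_rotation J (- s) 1) (real_moment K) (complex_moment K).
  move=> fK; have [_] := hW K fK.
  by rewrite /real_moment /complex_moment pE eqxx.
have mQ i j : measurable_fun setT (fun s : R => planar_rotation J (- s) 1 i j).
  by apply: measurable_planar_rotation => //; exact: measurable_funN.
have [c c0 [h1 h2]] := @jensen_rotation_average R m (ltn0Sn k.+1) _ (measurableTypeR R) mu W
  (fun s => planar_rotation J (- s) 1) mW W0 mQ
  (fun s => planar_rotation_orthogonal JJ JT (- s) 1) _ _ _ _ _ q_range
  (moment_like_real fB) (moment_like_complex fB) (hK _ fB) hb.
exists c; first exact: c0.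
split; first exact: h1.
move=> K fK.
exact: h2 _ _ (moment_like_real fK) (moment_like_complex fK) (hK K fK).
Qed.

(** The averaging formula is exact for a zonotope norm Z between N and nu N, and [cmp] transfers its
    consequence to N. The ball estimate loses nothing in the transfer because N <= Z; the factor
    lambda is paid for K only. *)
Let zonotope_case (lambda : R) : p != -1 -> 1 < lambda -> exists2 c : R, 0 <= c &
  c * annulus_moment q (real_moment ball) <= annulus_moment q (complex_moment ball) /\
  forall K, fat_bounded K -> annulus_moment q (complex_moment K) <=
    lambda * (c * annulus_moment q (real_moment K)).
Proof.
move=> pn l1; have p1 := p_gt pn; have l0 : 0 < lambda by exact: lt_trans l1.
(* An m-th root, because the comparison of gauges costs nu^m. *)
pose nu : R := lambda `^ (m%:R)^-1.
have nu0 : 0 < nu by exact: powR_gt0.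
have num : nu ^+ m = lambda.
  by rewrite -powR_mulrn ?(ltW nu0)// -powRrM mulVf ?pnatr_eq0// powRr1// ltW.
have nu1 : 1 < nu.
  rewrite ltNge; apply/negP => /(exprn_ile1 m (ltW nu0)).
  by rewrite num leNgt l1.
have [|l [alpha [beta hz]]] := planar_norm_zonotope nN (e := nu - 1).
  by rewrite subr_gt0.
pose Z := zonotope_norm alpha beta.
have NZ s t : N s t <= Z s t <= nu * N s t by have := hz s t; rewrite subrKC.
have pZ : pregauge Z.
  have [_ _ [a a0 ha] [b b0 hb]] := pN; split.
  - exact: measurable_zonotope_norm.
  - exact: zonotope_normZ.
  - by exists a => // s t; have /andP[h _] := NZ s t; exact: le_trans h.
  - exists (nu * b); first exact: mulr_gt0.
    move=> s t; have /andP[_ h] := NZ s t; apply: le_trans h _.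
    by rewrite -mulrA ler_pM2l.
have [b hb] := real_moment_ball.
have p2 : -1 < p < 1 by rewrite p1; case/andP: p_range.
have [W [mW W0 hW]] := zonotope_rotation_average JJ JT p2 p_neq0 pZ.
have realE K : real_moment K = fun u => fine (emoment abs1 J p K u).
  by rewrite /real_moment (negbTE pn).
have hK K : fat_bounded K -> moment_like p (fun u => fine (emoment Z J p K u)) /\
    rotation_average (leb l) W
      (fun y => planar_rotation J (dot alpha y) (dot beta y))
      (real_moment K) (fun u => fine (emoment Z J p K u)).
  move=> fK; have [mK _ _] := fK.
  have [c hc] := emoment_upper pregauge_norm_fst p1 fK.
  have [c' hc'] := emoment_upper pZ p1 fK.
  have [fp ff] := moment_like_emoment JJ pregauge_norm_fst fK hc.
  have [fp' ff'] := moment_like_emoment JJ pZ fK hc'.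
  split => //; rewrite realE; apply: hW => // u u1.
    by apply: ff; rewrite -enorm_gt0 u1.
  by apply: ff'; rewrite -enorm_gt0 u1.
have cmp K : fat_bounded K ->
    annulus_moment q (fun u => fine (emoment Z J p K u)) <=
      annulus_moment q (complex_moment K) /\
    annulus_moment q (complex_moment K) <=
      lambda * annulus_moment q (fun u => fine (emoment Z J p K u)).
  move=> fK; have [c hc] := complex_upper fK; have [c' hc'] := emoment_upper pZ p1 fK.
  by have := annulus_moment_compare JJ p_neq0 pN pZ fK hc hc' nu0 NZ; rewrite num.
have mQ i j : measurable_fun setT
    (fun y : 'rV[R]_l => planar_rotation J (dot alpha y) (dot beta y) i j).
  by apply: measurable_planar_rotation; exact: measurable_dot.
have [zB aB] := hK _ fB.
have [c c0 [h1 h2]] := jensen_rotation_average (ltn0Sn k.+1) mW W0 mQ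
  (fun y => planar_rotation_orthogonal JJ JT (dot alpha y) (dot beta y)) q_range
  (moment_like_real fB) zB aB hb.
exists c; first exact: c0.
split; first by have [h _] := cmp _ fB; exact: le_trans h1 h.
move=> K fK; have [zK aK] := hK K fK; have [_ h] := cmp K fK.
have h3 := h2 _ _ (moment_like_real fK) zK aK.
exact: le_trans h (ler_wpM2l (ltW l0) h3).
Qed.

(** The constant c, which may vary with lambda, cancels between K and the ball, so the inequality
    holds up to every factor lambda > 1. *)
Lemma annulus_moment_ratio K : fat_bounded K ->
  annulus_moment q (complex_moment K) / annulus_moment q (complex_moment ball) <=
  annulus_moment q (real_moment K) / annulus_moment q (real_moment ball).
Proof.
move=> fK; set x := annulus_moment q (complex_moment K).
set xB := annulus_moment q (complex_moment ball).
set y := annulus_moment q (real_moment K).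
set yB := annulus_moment q (real_moment ball).
have x0 : 0 <= x by exact: annulus_moment_ge0.
have xB0 : 0 <= xB by exact: annulus_moment_ge0.
have y0 : 0 <= y by exact: annulus_moment_ge0.
have yB0 : 0 <= yB by exact: annulus_moment_ge0.
have key (lambda : R) : 1 < lambda -> x / xB <= lambda * (y / yB).
  move=> l1; have l0 : 0 < lambda by exact: lt_trans l1.
  have [c c0 [h1 h2]] : exists2 c : R, 0 <= c & c * yB <= xB /\
      forall K, fat_bounded K -> annulus_moment q (complex_moment K) <=
        lambda * (c * annulus_moment q (real_moment K)).
    have [pE|pn] := eqVneq p (-1); last exact: zonotope_case.
    have [c c0 [h1 h2]] := section_case pE; exists c; first exact: c0.
    split; first exact: h1.
    move=> K' fK'; apply: le_trans (h2 K' fK') _.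
    have z0 := mulr_ge0 c0 (annulus_moment_ge0 q (real_moment K')).
    exact: (ler_peMl z0 (ltW l1)).
  have hK := h2 K fK; have hB := h2 ball fB.
  rewrite -/x -/y -/xB -/yB in hK hB; clear h2; clearbody x xB y yB.
  (* If the denominator were 0, the left quotient would be 0 by convention. *)
  have [xBE|xBn] := eqVneq xB 0.
    by rewrite xBE invr0 mulr0 !mulr_ge0 ?invr_ge0// ltW.
  have xBp : 0 < xB by rewrite lt_neqAle eq_sym xBn.
  have yBp : 0 < yB.
    rewrite lt_neqAle yB0 andbT eq_sym; apply/eqP => yBE.
    by move: hB; rewrite yBE !mulr0 leNgt xBp.
  rewrite ler_pdivrMr// mulrA mulrAC ler_pdivlMr//.
  apply: (@le_trans _ _ (lambda * (c * y) * yB)); first by rewrite ler_wpM2r.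
  have -> : lambda * (c * y) * yB = lambda * y * (c * yB) by ring.
  by rewrite ler_wpM2l// mulr_ge0// ltW.
clearbody x xB y yB; apply/ler_addgt0Pr => e e0.
have yy0 : 0 <= y / yB by rewrite divr_ge0.
have d0 : 0 < y / yB + 1 by rewrite ltr_wpDl.
(* With this lambda the excess (lambda - 1) y / yB is at most e; the summand 1 keeps the divisor
   positive. *)
have l1 : 1 < 1 + e / (y / yB + 1) by rewrite ltrDl divr_gt0.
apply: le_trans (key _ l1) _; rewrite mulrDl mul1r lerD2l.
by rewrite mulrAC ler_pdivrMr// ler_pM2l// lerDl.
Qed.

End busemann.

(** * Support functions of plane bodies and the complex structure *)

Section complex_support.
Context {R : realType}.
Implicit Types (C : set R[i]^o) (s t : R).

Lemma normc_ge_Im (z : R[i]) : `|complex.Im z|%:C <= `|z|.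
Proof. by rewrite normc_def lecR -sqrtr_sqr ler_wsqrtr// lerDr sqr_ge0. Qed.

Lemma continuous_le_normc (f : R[i]^o -> R) :
  (forall x y, `|f x - f y|%:C <= `|(x - y : R[i])|) -> continuous f.
Proof.
move=> fle x A /nbhs_ballP[e /= e0 eA].
apply/nbhs_ballP; exists e%:C; first by rewrite /= ltcR.
move=> y; rewrite -ball_normE/= => xy; apply: eA; rewrite -ball_normE/=.
by rewrite -ltcR; exact: le_lt_trans xy.
Qed.

Lemma continuous_Re : continuous (fun z : R[i]^o => complex.Re z : R).
Proof.
by apply: continuous_le_normc => x y; rewrite -raddfB; exact: normc_ge_Re.
Qed.

Lemma continuous_Im : continuous (fun z : R[i]^o => complex.Im z : R).
Proof.
by apply: continuous_le_normc => x y; rewrite -raddfB; exact: normc_ge_Im.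
Qed.

Lemma compact_image_bounded C (f : R[i]^o -> R) : compact C -> continuous f ->
  exists2 M : R, 0 < M & forall z, C z -> `|f z| <= M.
Proof.
move=> cC cf; have cI : compact (f @` C).
  by apply: continuous_compact => //; exact: continuous_subspaceT.
have [M [_ MK]] := compact_bounded cI.
exists (`|M| + 1); first by rewrite ltr_wpDl.
move=> z Cz; apply: MK; first by rewrite (le_lt_trans (ler_norm M))// ltrDl.
by exists z.
Qed.

Definition plane_support C s t : R :=
  sup [set complex.Re c * s + complex.Im c * t | c in C].

(** Compactness makes the suprema finite, symmetry gives absolute homogeneity, and a disc of radius
    d inside C gives the lower bound, by testing the points d and i d. *)
Lemma planar_norm_support C : convex_body0 C -> C = [set - c | c in C] ->
  planar_norm (plane_support C).
Proof.
move=> [cC _ C0] symC.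
have [M1 M10 hM1] := compact_image_bounded cC continuous_Re.
have [M2 M20 hM2] := compact_image_bounded cC continuous_Im.
have Cz : C 0 by exact: interior_subset C0.
have CN z : C z -> C (- z) by move=> zC; rewrite symC; exists z.
pose E s t := [set complex.Re c * s + complex.Im c * t | c in C].
have E0 s t : E s t !=set0 by eexists; exists 0; first exact: Cz.
have Eb s t : has_ubound (E s t).
  exists (M1 * `|s| + M2 * `|t|) => _ [c Cc <-].
  apply: lerD; apply: le_trans (ler_norm _) _; rewrite normrM ler_wpM2r//.
    exact: hM1.
  exact: hM2.
have le c s t : C c -> complex.Re c * s + complex.Im c * t <= plane_support C s t.
  by move=> Cc; apply: (ub_le_sup (Eb s t)); exists c.
have ub s t x : (forall c, C c -> complex.Re c * s + complex.Im c * t <= x) ->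
    plane_support C s t <= x.
  by move=> h; apply: (ge_sup (E0 s t)) => _ [c Cc <-]; exact: h.
have leN c s t : C c -> `|complex.Re c * s + complex.Im c * t| <= plane_support C s t.
  move=> Cc; rewrite ler_norml le// andbT lerNl.
  by apply: le_trans (le _ s t (CN _ Cc)); rewrite !raddfN !mulNr opprD.
have homog_le c s t : plane_support C (c * s) (c * t) <= `|c| * plane_support C s t.
  apply: ub => z zC; apply: le_trans (ler_norm _) _.
  rewrite mulrCA [complex.Im z * _]mulrCA -mulrDr normrM ler_wpM2l//.
  exact: leN.
split.
- move=> c s t; have [->|c0] := eqVneq c 0.
    rewrite normr0 !mul0r; apply/le_anti; apply/andP; split.
      by apply: ub => z _; rewrite !mulr0 addr0.
    by apply: le_trans (le 0 0 0 Cz); rewrite !mulr0 addr0.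
  apply/le_anti; rewrite homog_le/= -ler_pdivlMl ?normr_gt0//.
  by have := homog_le c^-1 (c * s) (c * t); rewrite !mulKf// normfV.
- move=> s t s' t'; apply: ub => z zC; rewrite !mulrDr addrACA.
  by apply: lerD; exact: le.
have /nbhs_ballP[e /= e0 eC] : nbhs (0 : R[i]^o) C by exact: C0.
have [d d0 hd] : exists2 d : R, 0 < d & forall z : R[i], `|z| <= d%:C -> C z.
  (* In the order of R[i] a positive radius is real; halving it replaces the open ball by a closed
     disc. *)
  move: e0; rewrite ltcE/= => /andP[/eqP im0 re0].
  exists (complex.Re e / 2); first by rewrite divr_gt0.
  move=> z zd; apply: eC; rewrite -ball_normE/= sub0r normrN.
  apply: le_lt_trans zd _; rewrite ltcE/= im0 eqxx/=.
  by rewrite ltr_pdivrMr// ltr_pMr// ltr1n.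
(* The average of the two bounds d |s| and d |t|. *)
exists (d / 2); first by rewrite divr_gt0.
move=> s t.
have h1 : d * `|s| <= plane_support C s t.
  have Cd : C (d%:C : R[i]).
    by apply: hd; rewrite normc_def/= expr0n/= addr0 sqrtr_sqr gtr0_norm.
  have := leN _ s t Cd.
  by rewrite /= mul0r addr0 normrM gtr0_norm.
have h2 : d * `|t| <= plane_support C s t.
  have Cd : C ((0 +i* d) : R[i]).
    by apply: hd; rewrite normc_def/= expr0n/= add0r sqrtr_sqr gtr0_norm.
  have := leN _ s t Cd.
  by rewrite /= mul0r add0r normrM gtr0_norm.
lra.
Qed.

(** Right multiplication by it is multiplication by i: (a, b) goes to (- b, a). *)
Definition complex_mx n : 'M[R]_(n + n) := block_mx 0 1%:M (- 1%:M) 0.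

Lemma complex_mx_tr n : (complex_mx n)^T = - complex_mx n.
Proof.
rewrite /complex_mx tr_block_mx opp_block_mx !raddf0 ?oppr0 opprK raddfN/= trmx1.
by [].
Qed.

Lemma complex_mx_orthonormal n : complex_mx n *m (complex_mx n)^T = 1%:M.
Proof.
rewrite complex_mx_tr mulmxN /complex_mx mulmx_block.
rewrite !mul0mx !mulmx0 !mulmx1 !mul1mx !add0r !addr0.
by rewrite opp_block_mx opprK oppr0 -scalar_mx_block.
Qed.

Lemma of_complexZ n (c : R[i]) (u : 'rV[R]_(n + n)) :
  of_complex (c *: to_complex u) =
  complex.Re c *: u + complex.Im c *: (u *m complex_mx n).
Proof.
rewrite -[u in RHS]hsubmxK /complex_mx mul_row_block !mulmx0 add0r addr0.
rewrite mulmx1 mulmxN mulmx1 !scale_row_mx add_row_mx /of_complex.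
by congr row_mx; apply/rowP => j; rewrite !mxE; case: c => a b /=; ring.
Qed.

Lemma support_complex_orbit n C (u x : 'rV[R]_(n + n)) :
  Defs.support (complex_orbit C u) x = gauge_at (plane_support C) (complex_mx n) u x.
Proof.
rewrite /Defs.support /gauge_at /plane_support; congr sup.
apply/seteqP; split => z /=.
  move=> [_ [c Cc <-] <-]; exists c => //.
  by rewrite of_complexZ dotDr !dotZr.
move=> [c Cc <-]; exists (of_complex (c *: to_complex u)); first by exists c.
by rewrite of_complexZ dotDr !dotZr.
Qed.

End complex_support.

(** * From moments back to intersection bodies *)

Section intersection_bodies.
Context {R : realType}.

(** The real-valued integral is [fine] of [emoment], so the moment under this radial function is
    [complex_moment] by conversion. *)
Definition gauge_intersection_body m (N : R -> R -> R) (J : 'M[R]_m) p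
    (K : set 'rV[R]_m) : set 'rV[R]_m :=
  star_of_radial (fun u => radial_of_moment p
    (\int[lebesgue_rV R m]_(x in K) (gauge_at N J u x `^ p))).

Lemma vol_intersection_body_ratio m (J : 'M[R]_m) (N : R -> R -> R) (p : R)
    (K : set 'rV[R]_m) : (1 < m)%N -> J *m J^T = 1%:M -> J^T = - J ->
  planar_norm N -> -1 <= p < 1 -> p != 0 -> fat_bounded K ->
  vol (gauge_intersection_body N J p K) /
    vol (gauge_intersection_body N J p (eball R m)) <=
  vol (intersection_body p K) / vol (intersection_body p (eball R m)).
Proof.
case: m => [//|[//|k]] in J K *; move=> _ JJ JT nN p1 p0 fK.
have fB : fat_bounded (eball R k.+2) := fat_bounded_eball.
pose q : R := - (k.+2%:R / p).
pose c : R := (k.+2%:R * ln 2)^-1.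
have c0 : c != 0.
  by rewrite invr_eq0 mulf_neq0 ?pnatr_eq0// gt_eqF// ln_gt0// ltr1n.
have volC L : fat_bounded L ->
    vol (gauge_intersection_body N J p L) = c * annulus_moment q (complex_moment J N p L).
  move=> fL; apply: vol_moment_like => //.
  exact: moment_like_complex.
have volR L : fat_bounded L ->
    vol (intersection_body p L) = c * annulus_moment q (real_moment J p L).
  move=> fL; have [mL _ _] := fL; apply: vol_moment_like => //.
    exact: moment_like_real.
  (* At p = -1 the exponent - p^-1 is 1, so the section volume is itself the radial function. *)
  move=> u u1; rewrite /real_moment; case: eqP => [->|//].
  by rewrite invrN invr1 opprK powRr1 ?section_vol_moment// -section_vol_moment// fine_ge0.
have cancel (x y x' y' a b a' b' : R) : x = c * a -> y = c * b -> x' = c * a' ->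
    y' = c * b' -> a / b <= a' / b' -> x / y <= x' / y'.
  move=> -> -> -> ->.
  by rewrite -(mulf_div c c) -(mulf_div c c a') mulfV// !mul1r.
exact: (cancel _ _ _ _ _ _ _ _ (volC K fK) (volC _ fB) (volR K fK) (volR _ fB)
  (annulus_moment_ratio JJ JT nN p1 p0 fK)).
Qed.

End intersection_bodies.

Theorem theorem4 (R : realType) (n : nat) (n_gt0 : (0 < n)%N)
    (C : set R[i]^o) (bodyC : convex_body0 C) (symC : C = [set - c | c in C])
    (p : R) (p_range : -1 <= p < 1) (p_neq0 : p != 0)
    (K : set 'rV[R]_(n + n)) (starK : star_body K) :
  vol (complex_intersection_body C p K) /
    vol (complex_intersection_body C p (eball R (n + n))) <=
  vol (intersection_body p K) /
    vol (intersection_body p (eball R (n + n))).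
Proof.
have nN := planar_norm_support bodyC symC.
have m1 : (1 < n + n)%N by case: n n_gt0 {K starK} => // k _; rewrite addnS.
have fK : fat_bounded K by apply: fat_bounded_star_body => //; exact: ltnW.
have bodyE L : complex_intersection_body C p L =
    gauge_intersection_body (plane_support C) (complex_mx n) p L.
  apply: (congr1 (@star_of_radial _ _)); apply/funext => u.
  apply: (congr1 (radial_of_moment p)); apply: eq_Rintegral => x _.
  by rewrite support_complex_orbit.
rewrite (bodyE K) (bodyE (eball R (n + n))).
apply: vol_intersection_body_ratio => //.
  exact: complex_mx_orthonormal.
exact: complex_mx_tr.
Qed.
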